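(* Let $(H,* )$ be a compact commutative hypergroup and $(J,\cdot)$ a discrete commutative hypergroup with $H\cap J=\{e\}$, where $e$ is the identity of both, and let $K=H\vee J$ be their hypergroup join. Suppose $|J|\ge 2$ and let $\alpha\in\widehat J$. Then $J$ is $\alpha$-amenable if and only if $K$ is $\alpha$-amenable (where $\alpha$ is regarded as a character of $K$ by setting it equal to $1$ on $H$). Moreover, if $H$ and $J$ are strong hypergroups and $\beta\in\widehat{\widehat H}$, then $\widehat H$ is $\beta$-amenable if and only if $\widehat K$ is $\beta$-amenable (where $\beta$ is regarded as a character of $\widehat K=\widehat H\cup\widehat J$ by setting it equal to $1$ on $\widehat J$).
   Context: Hypergroups are locally compact hypergroups in the sense of Jewett. For a commutative hypergroup $L$ with convolution of point measures $p(x,y)$, involution $x\mapsto\tilde x$, identity $e$ and Haar measure, the translation of a function is $T_xf(y)=\int_L f\,dp(x,y)$, and $\widehat L$ is the set of hermitian characters: bounded continuous $\alpha:L\to\mathbb C$ with $\alpha(e)=1$, $\int_L\alpha\,dp(x,y)=\alpha(x)\alpha(y)$, $\alpha(\tilde x)=\overline{\alpha(x)}$ for all $x,y\in L$, with the compact-open topology. For $\alpha\in\widehat L$, $L$ is called $\alpha$-amenable if there is a bounded linear functional $m_\alpha\in L^\infty(L)^*$ with $m_\alpha(\alpha)=1$ and $m_\alpha(T_xf)=\alpha(x)m_\alpha(f)$ for all $f\in L^\infty(L)$, $x\in L$. Hypergroup join. Let $m_H$ be the normalized Haar measure of $H$. $K=H\vee J$ is the set $H\cup J$ with the unique topology for which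 $H$ and $J$ are closed subspaces, and with convolution $\odot$ of point measures $\varepsilon_x$ given by: (1) $\varepsilon_x\odot\varepsilon_y$ agrees with the convolution of $H$ if $x,y\in H$; (2) $\varepsilon_x\odot\varepsilon_y=\varepsilon_x\cdot\varepsilon_y$ if $x,y\in J$, $x\ne\tilde y$; (3) $\varepsilon_x\odot\varepsilon_y=\varepsilon_y=\varepsilon_y\odot\varepsilon_x$ if $x\in H$, $y\in J\setminus\{e\}$; (4) if $y\in J$, $y\neq e$, and $\varepsilon_{\tilde y}\cdot\varepsilon_y=\sum_{w\in J}c_w\varepsilon_w$ (with $c_w\ge0$, only finitely many nonzero, $\sum_w c_w=1$), then $\varepsilon_{\tilde y}\odot\varepsilon_y=c_e m_H+\sum_{w\in J\setminus\{e\}}c_w\varepsilon_w$. If $m_J$ is the Haar measure of $J$ with $m_J(\{e\})=1$, then $m_H+1_{J\setminus\{e\}}m_J$ is a Haar measure of $K$. One has $\widehat K=\widehat H\cup\widehat J$ with $\widehat H\cap\widehat J=\{1\}$: a character of $J$ is extended to $K$ by the value $1$ on $H$, and a nontrivial character of $H$ is extended to $K$ by $0$ on $J\setminus\{e\}$. A commutative hypergroup $L$ is called strong if $\widehat L$ is a hypergroup under the convolution dual to pointwise multiplication of characters (i.e. for $\alpha,\beta\in\widehat L$ the product $\alpha\beta$ equals $x\mapsto\int_{\widehat L}\gamma(x)\,d\omega_{\alpha,\beta}(\gamma)$, where $\omega_{\alpha,\beta}$, the convolution of $\alpha$ and $\beta$, is a probability measure on $\widehat L$), with complex conjugation as involution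 and the constant character $1$ as identity. If $H$ and $J$ are strong, then so is $K$, and the hypergroup $\widehat K$ is the join of the hypergroups $\widehat H$ and $\widehat J$ (with $\widehat J$ compact and $\widehat H$ discrete); $\widehat{\widehat H}$ denotes the set of hermitian characters of the hypergroup $\widehat H$. *)

(* Defs.v *)
From HB Require Import structures.
From mathcomp Require Import all_boot all_order all_algebra.
From mathcomp Require Import all_classical all_reals all_analysis.
From mathcomp Require Import complex.

Set Implicit Arguments.
Unset Strict Implicit.
Unset Printing Implicit Defensive.

Import Order.TTheory GRing.Theory Num.Theory.
Import numFieldNormedType.Exports.

Local Open Scope classical_set_scope.
Local Open Scope ring_scope.

(* The regular alias [^o] carries the usual topology of the complex numbers. *)
Notation cplx R := ((R%type)[i])^o.

Notation borel L := (g_sigma_algebraType (@open L)).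

Section measures.
Context {R : realType} {L : ptopologicalType}.
Implicit Types (f : L -> R) (mu : set (borel L) -> \bar R).

(* A measure is a function on all subsets, whose values on non-Borel sets are
   irrelevant. *)
Definition eq_borel mu (nu : set (borel L) -> \bar R) :=
  forall A : set (borel L), measurable A -> mu A = nu A.

Definition radon mu :=
  [/\ forall C : set L, compact C -> (mu C < +oo)%E,
      forall A : set (borel L), measurable A ->
        mu A = ereal_inf [set mu U | U in [set U : set L | open U /\ A `<=` U]]
    & forall U : set L, open U ->
        mu U = ereal_sup [set mu C | C in [set C : set L | compact C /\ C `<=` U]]].

Definition supp mu : set L :=
  [set x | forall U : set L, open U -> U x -> (0 < mu U)%E].

Definition continuous_compact_support f :=
  continuous f /\ compact (closure [set x | f x <> 0]).

Definition cintegral (mu : {measure set (borel L) -> \bar R})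
    (f : L -> cplx R) : cplx R :=
  Complex (\int[mu]_x complex.Re (f x)) (\int[mu]_x complex.Im (f x)).

Definition borel_cfun (f : L -> cplx R) :=
  measurable_fun setT (fun x : borel L => complex.Re (f x)) /\
  measurable_fun setT (fun x : borel L => complex.Im (f x)).

Definition bounded_borel_cfun (f : L -> cplx R) :=
  borel_cfun f /\ exists M : R, forall x, `|f x| <= M%:C%C.

Definition locally_null (mu : set (borel L) -> \bar R) (N : set L) :=
  forall C : set L, compact C -> mu.-negligible (N `&` C : set (borel L)).

(* Bounded linear functionals on L^oo(mu).  Every class in L^oo(mu) has a
   bounded Borel representative; boundedness for the essential supremum forces
   [m] to be constant on classes modulo locally null sets.  The values of [m]
   outside bounded Borel functions are irrelevant. *)
Definition Linfty_functional (mu : set (borel L) -> \bar R)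
    (m : (L -> cplx R) -> cplx R) :=
  [/\ forall f g : L -> cplx R, bounded_borel_cfun f -> bounded_borel_cfun g ->
        m (fun x => f x + g x) = m f + m g,
      forall (c : cplx R) (f : L -> cplx R), bounded_borel_cfun f -> m (fun x => c * f x) = c * m f
    & exists N : R, forall (f : L -> cplx R) (M : R), bounded_borel_cfun f -> 0 <= M ->
        locally_null mu [set x | ~ (`|f x| <= M%:C%C)] ->
        `|m f| <= (N * M)%:C%C].

End measures.

(* Jewett's axioms.  The convolution of point measures determines that of
   bounded measures: [mu * nu = \int \int hconv x y dmu(x) dnu(y)], which gives
   the form of associativity below. *)
Record hypergroup (R : realType) (L : ptopologicalType) := Hypergroup {
  hconv : L -> L -> probability (borel L) R ;
  hinv : L -> L ;
  hid : L ;
  hypergroup_hausdorff : hausdorff_space L ;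
  hypergroup_locally_compact : locally_compact [set: L] ;
  conv_radon : forall x y, radon (hconv x y) ;
  conv_compact_supp : forall x y, compact (supp (hconv x y)) ;
  conv_continuous : forall f : L -> R, continuous_compact_support f ->
    continuous (fun z : L * L => \int[hconv z.1 z.2]_t f t) ;
  (* continuity of the supports for the Michael topology on compact subsets *)
  conv_supp_continuous : forall A B : set L, open A -> open B ->
    open [set z : L * L | supp (hconv z.1 z.2) `&` A !=set0 /\
                          supp (hconv z.1 z.2) `<=` B] ;
  conv_assoc : forall (x y z : L) (f : L -> R), continuous_compact_support f ->
    \int[hconv y z]_t \int[hconv x t]_s f s =
    \int[hconv x y]_t \int[hconv t z]_s f s ;
  conv_idl : forall x, eq_borel (hconv hid x) (dirac (x : borel L)) ;
  conv_idr : forall x, eq_borel (hconv x hid) (dirac (x : borel L)) ;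
  inv_continuous : continuous hinv ;
  hinvK : involutive hinv ;
  conv_inv : forall x y,
    eq_borel (fun A => hconv x y (hinv @^-1` A)) (hconv (hinv y) (hinv x)) ;
  hid_supp : forall x y, supp (hconv x y) hid <-> y = hinv x
}.

Section hypergroup_theory.
Context {R : realType} {L : ptopologicalType}.
Implicit Types (HL : hypergroup R L) (alpha : L -> cplx R).

Definition commutative_hypergroup HL :=
  forall x y, eq_borel (hconv HL x y) (hconv HL y x).

Definition is_haar HL (mu : {measure set (borel L) -> \bar R}) :=
  [/\ radon mu, mu setT <> 0%E
    & forall (x : L) (f : L -> R), continuous_compact_support f ->
        \int[mu]_y \int[hconv HL x y]_z f z = \int[mu]_y f y].

Definition translate HL (x : L) (f : L -> cplx R) : L -> cplx R :=
  fun y => cintegral (hconv HL x y) f.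

Definition hermitian_character HL alpha :=
  [/\ continuous alpha,
      exists M : R, forall x, `|alpha x| <= M%:C%C,
      alpha (hid HL) = 1,
      forall x y, cintegral (hconv HL x y) alpha = alpha x * alpha y
    & forall x, alpha (hinv HL x) = (alpha x)^*].

Definition dual_set HL : set {compact-open, L -> cplx R} :=
  [set alpha | hermitian_character HL alpha].

Definition dual HL : Type := set_type (dual_set HL).

Definition amenable HL (mu : {measure set (borel L) -> \bar R}) alpha :=
  exists m : (L -> cplx R) -> cplx R,
    [/\ Linfty_functional mu m, m alpha = 1
      & forall f x, bounded_borel_cfun f ->
          m (translate HL x f) = alpha x * m f].

Lemma hermitian_character1 HL : hermitian_character HL (fun=> 1).
Proof.
split=> //.
- by move=> x; exact: cst_continuous.
- by exists 1 => x; rewrite normr1.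
- move=> x y; rewrite mulr1 /cintegral /=.
  rewrite !Rintegral_cst// [X in fine X](probability_setT (hconv HL x y)) /=.
  by rewrite mul1r mul0r.
- by move=> x; rewrite conjC1.
Qed.

Definition dual1 HL : dual HL :=
  exist _ (fun=> 1 : cplx R) (mem_set (hermitian_character1 HL)).

End hypergroup_theory.

HB.instance Definition _ (R : realType) (L : ptopologicalType)
  (HL : hypergroup R L) := Topological.copy (dual HL) (set_type (dual_set HL)).
HB.instance Definition _ (R : realType) (L : ptopologicalType)
  (HL : hypergroup R L) := isPointed.Build (dual HL) (dual1 HL).

Definition char_fun (R : realType) (L : ptopologicalType)
  (HL : hypergroup R L) (alpha : dual HL) : L -> cplx R := set_val alpha.
Coercion char_fun : dual >-> Funclass.

(* [HL] is strong when such a [D] exists. *)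
Definition is_dual_hypergroup (R : realType) (L : ptopologicalType)
    (HL : hypergroup R L) (D : hypergroup R (dual HL)) :=
  [/\ forall (alpha beta : dual HL) (x : L),
        cintegral (hconv D alpha beta) (fun gamma : dual HL => gamma x) =
        alpha x * beta x,
      forall (alpha : dual HL) (x : L), (hinv D alpha : dual HL) x = (alpha x)^*
    & forall x : L, (hid D : dual HL) x = 1].

(* [K] is the join of [H] and [J], seen inside [K] through the inclusions [iH]
   and [iJ]. *)
Record is_join (R : realType) (H J K : ptopologicalType)
    (HH : hypergroup R H) (HJ : hypergroup R J)
    (mH : {measure set (borel H) -> \bar R}) (HK : hypergroup R K)
    (iH : H -> K) (iJ : J -> K) : Prop := IsJoin {
  join_injl : injective iH ;
  join_injr : injective iJ ;
  join_cover : forall k, (exists h, iH h = k) \/ (exists j, iJ j = k) ;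
  join_meet : forall h j, iH h = iJ j <-> h = hid HH /\ j = hid HJ ;
  join_continuousl : continuous iH ;
  join_continuousr : continuous iJ ;
  join_closedl : forall A : set H, closed A -> closed (iH @` A) ;
  join_closedr : forall A : set J, closed A -> closed (iJ @` A) ;
  join_hidl : hid HK = iH (hid HH) ;
  join_invl : forall h, hinv HK (iH h) = iH (hinv HH h) ;
  join_invr : forall j, hinv HK (iJ j) = iJ (hinv HJ j) ;
  join_conv1 : forall x y : H,
    eq_borel (hconv HK (iH x) (iH y)) (fun A => hconv HH x y (iH @^-1` A)) ;
  join_conv2 : forall x y : J, x <> hinv HJ y ->
    eq_borel (hconv HK (iJ x) (iJ y)) (fun A => hconv HJ x y (iJ @^-1` A)) ;
  join_conv3l : forall (x : H) (y : J), y <> hid HJ ->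
    eq_borel (hconv HK (iH x) (iJ y)) (dirac (iJ y : borel K)) ;
  join_conv3r : forall (x : H) (y : J), y <> hid HJ ->
    eq_borel (hconv HK (iJ y) (iH x)) (dirac (iJ y : borel K)) ;
  (* with [c_w] the mass of [hconv HJ (hinv HJ y) y] at [w], the sum of the
     [c_w * dirac (iJ w)] over [w <> e] is the second summand *)
  join_conv4 : forall y : J, y <> hid HJ ->
    eq_borel (hconv HK (iJ (hinv HJ y)) (iJ y))
      (fun A => hconv HJ (hinv HJ y) y [set hid HJ] * mH (iH @^-1` A) +
                hconv HJ (hinv HJ y) y (iJ @^-1` A `\ hid HJ))%E
}.

(* Extension of [f], living on a part [i : A -> X] of [X], by the constant [c]. *)
Definition extend (A X Y : Type) (i : A -> X) (c : Y) (f : A -> Y) (x : X) : Y :=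
  if pselect (exists a, i a = x) is left ex then f (projT1 (cid ex)) else c.

(* The value at [chi : dual HK] of a function [beta] on [dual HH], regarded as
   the function on [dual HK], the union of [dual HH] and [dual HJ], which is [1]
   on [dual HJ]: a nontrivial character of [H] is identified with its extension
   by [0]. *)
Definition extend_dual (R : realType) (H K : ptopologicalType)
    (HH : hypergroup R H) (HK : hypergroup R K) (iH : H -> K)
    (beta : dual HH -> cplx R) (chi : dual HK) : cplx R :=
  if pselect (exists eta : dual HH, eta <> dual1 HH /\
                char_fun chi = extend iH (0 : cplx R) eta) is left ex
  then beta (projT1 (cid ex)) else 1.

(* Main.v *)
Require Import Defs.
From mathcomp Require Import all_boot all_order all_algebra.
From mathcomp Require Import all_classical all_reals all_analysis.
From mathcomp Require Import measurable_realfun giry complex lra.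

Set Implicit Arguments.
Unset Strict Implicit.
Unset Printing Implicit Defensive.

Import Order.TTheory GRing.Theory Num.Theory.
Import numFieldNormedType.Exports.

Local Open Scope classical_set_scope.
Local Open Scope ring_scope.

(* Let K be the join of H and J.  Averaging a function on K over H gives a
   function on J, and a function on J extends to K by its value at e on H; both
   maps commute with translations, so composing with them carries invariant
   functionals from J to K and back.  Of the Haar measures only the null sets
   matter.

   The second equivalence is the same statement for the dual of K, which is the
   join of the compact dual of J and the discrete dual of H: the restriction of
   characters from K to H is the quotient map by the dual of J, and its other
   fibres are points.  The convolutions on the three duals are compared through
   their Fourier transforms, which determine a measure on the dual of H by
   orthogonality of characters, and a Radon measure on the dual of J by a
   Stone-Weierstrass argument. *)

(** * Regular Borel measures *)

(** A Haar measure is by definition invariant for continuous functions of compact support, while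
    functionals act on bounded Borel functions; averaging over [H] commutes with translation by [H]
    only once the invariance of [mH] reaches the latter. As the spaces need not be second countable,
    integrals of continuous functions pin down a measure only among inner regular ones, so the
    analytic core of the first half is that the convolution of a point mass with [mH] is again inner
    regular. The given Haar measure of [K] is compared with [mH] through one identity: for [b] in
    [J] off the identity, invariance expresses the integral of a function living on [H] through the
    product of [b] with its inverse, whose part on [H] is a multiple of [mH]. In the dual the
    identity is read backwards: the normalised restriction of a Haar measure of the dual of [K] is
    taken as Haar measure of the dual of [J], and the identity then yields [join_conv4]. The
    convolution on the dual of [K] is known only through its Fourier transform, so the join
    structure of that dual has to be proved. *)

Lemma open_near (T : topologicalType) (A : set T) :
  (forall x, A x -> nbhs x A) -> open A.
Proof. by rewrite openE. Qed.

Section borel_measures.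
Context {R : realType} {L : ptopologicalType}.
Implicit Types mu nu : {measure set (borel L) -> \bar R}.

Lemma open_borel (U : set L) : open U -> measurable (U : set (borel L)).
Proof. by move=> oU; exact: sub_sigma_algebra. Qed.

Lemma closed_borel (C : set L) : closed C -> measurable (C : set (borel L)).
Proof.
move=> cC; rewrite -[C]setCK; apply: measurableC; apply: open_borel.
exact: closed_openC.
Qed.

Lemma lsc_borel (f : L -> \bar R) :
  (forall a : R, open [set y | (a%:E < f y)%E]) ->
  measurable_fun setT (f : borel L -> _).
Proof.
move=> of_; apply: (measurability _ (ErealGenOInfty.measurableE R)).
move=> _ [_ [r ->] <-]; rewrite setTI preimage_itvoy.
exact: open_borel (of_ r).
Qed.

Lemma continuous_borel (f : L -> R) :
  continuous f -> measurable_fun setT (f : borel L -> _).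
Proof.
move=> cf; apply: (measurability _ (RGenOInfty.measurableE R)).
move=> _ [_ [r ->] <-]; rewrite setTI.
by apply: open_borel; apply: open_comp => // x _; exact: cf.
Qed.

Lemma eq_borel_open mu nu : (mu setT < +oo)%E ->
  (forall U : set L, open U -> mu U = nu U) -> eq_borel mu nu.
Proof.
move=> mufin munu A mA.
apply: (@measure_unique _ R (borel L) (@open L) (fun=> setT)) => //.
- by move=> U V; exact: openI.
- by move=> _; exact: openT.
- by rewrite bigcup_const//; exists 0%N.
Qed.

Definition inner_regular mu := forall U : set L, open U ->
  mu U = ereal_sup [set mu C | C in [set C : set L | compact C /\ C `<=` U]].

Lemma inner_regularP mu (U : set L) (e : \bar R) : inner_regular mu -> open U ->
  (e < mu U)%E -> exists C : set L, [/\ compact C, C `<=` U & (e < mu C)%E].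
Proof.
move=> rmu oU; rewrite rmu// => /ereal_sup_gt[_ [C [cC CU] <-] eC].
by exists C.
Qed.

Lemma inner_regular_le mu nu (U : set L) : inner_regular mu -> open U ->
  (forall C : set L, compact C -> C `<=` U -> (mu C <= nu U)%E) ->
  (mu U <= nu U)%E.
Proof.
move=> rmu oU h; rewrite rmu//; apply: ge_ereal_sup => _ [C [cC CU] <-].
exact: h.
Qed.

(** Finite measures are determined by their values on open sets, and inner regularity reduces an
    open set to its compact subsets. Both uniqueness arguments below, by Urysohn functions and by
    trigonometric polynomials, end in this comparison of a compact set with an open
    neighbourhood. *)
Lemma eq_borel_inner_regular mu nu : (mu setT < +oo)%E ->
  inner_regular mu -> inner_regular nu ->
  (forall C U : set L, compact C -> open U -> C `<=` U ->
    (mu C <= nu U)%E /\ (nu C <= mu U)%E) -> eq_borel mu nu.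
Proof.
move=> mufin rmu rnu h; apply: eq_borel_open => // U oU.
by apply/le_anti/andP; split; apply: inner_regular_le => // C cC CU;
  have [] := h C U cC oU CU.
Qed.

End borel_measures.

Section urysohn_compact.
Context {R : realType} {L : ptopologicalType}.
Hypotheses (hL : hausdorff_space L) (cL : compact [set: L]).

Lemma compact_separation (C U : set L) : compact C -> open U -> C `<=` U ->
  exists f : L -> R, [/\ continuous f, forall x, 0 <= f x <= 1,
    forall x, C x -> f x = 1 & forall x, ~ U x -> f x = 0].
Proof.
move=> cC oU CU.
have /normal_separatorP nL : normal_space L by apply: compact_normal.
have sep : uniform_separator (~` U) C.
  apply: (nL R).
  - exact: open_closedC.
  - exact: compact_closed.
  - by rewrite setIC; apply/disjoints_subset; rewrite setCK.
exists (Urysohn (~` U) C); split.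
- exact: Urysohn_continuous.
- move=> x; have /(_ (Urysohn (~` U) C x)) := @Urysohn_range L R (~` U) C.
  by rewrite /= in_itv /=; apply; exists x.
- by move=> x Cx; have := @Urysohn_sub1 _ R _ _ sep; apply; exists x.
- by move=> x nUx; have := @Urysohn_sub0 _ R _ _ sep; apply; exists x.
Qed.

End urysohn_compact.

(** * Invariance of Haar measure for bounded Borel functions *)

Section integral_bounds.
Context {R : realType} {L : ptopologicalType}.
Implicit Types mu : {measure set (borel L) -> \bar R}.
Local Open Scope ereal_scope.

Lemma le_measure_integral mu (f : L -> R) (C : set (borel L)) :
  measurable C -> measurable_fun setT (f : borel L -> _) ->
  (forall x, (0 <= f x)%R) -> (forall x, C x -> (1 <= f x)%R) ->
  mu C <= \int[mu]_x (f x)%:E.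
Proof.
move=> mC mf f0 f1; rewrite -[C in mu C]setIT -(@integral_indic _ _ _ mu setT measurableT _ mC).
apply: ge0_le_integral => //.
- exact/measurable_EFinP/measurable_indic.
- exact/measurable_EFinP.
- move=> x _; rewrite lee_fin indicE; case: (boolP (x \in C)) => //=.
  by rewrite inE => /f1.
Qed.

Lemma le_integral_measure mu (f : L -> R) (U : set (borel L)) :
  measurable U -> measurable_fun setT (f : borel L -> _) ->
  (forall x, (0 <= f x <= 1)%R) -> (forall x, ~ U x -> f x = 0%R) ->
  \int[mu]_x (f x)%:E <= mu U.
Proof.
move=> mU mf f01 f0; rewrite -[U in mu U]setIT -(@integral_indic _ _ _ mu setT measurableT _ mU).
apply: ge0_le_integral => //.
- by move=> x _; rewrite lee_fin; case/andP: (f01 x).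
- exact/measurable_EFinP.
- exact/measurable_EFinP/measurable_indic.
- move=> x _; rewrite lee_fin indicE; case: (boolP (x \in U)) => /=.
    by case/andP: (f01 x).
  by rewrite notin_setE => /f0 ->.
Qed.

Lemma fin_num_le_measure mu (A : set (borel L)) :
  mu setT < +oo -> measurable A -> mu A \is a fin_num.
Proof.
move=> mufin mA; rewrite ge0_fin_numE//.
by apply: le_lt_trans mufin; rewrite le_measure ?inE.
Qed.

Lemma fin_num_integral01 mu (f : L -> R) :
  mu setT < +oo -> measurable_fun setT (f : borel L -> _) ->
  (forall x, (0 <= f x <= 1)%R) -> \int[mu]_x (f x)%:E \is a fin_num.
Proof.
move=> mufin mf f01; rewrite ge0_fin_numE; last first.
  by apply: integral_ge0 => x _; rewrite lee_fin; case/andP: (f01 x).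
by apply: le_lt_trans mufin; apply: (@le_integral_measure mu f setT) => // x /(_ I).
Qed.

Lemma probability_fin (P : probability (borel L) R) : P setT < +oo.
Proof. by rewrite probability_setT ltry. Qed.

(* Urysohn functions squeeze each measure of a compact set below the other
   measure of any open neighbourhood. *)
Lemma eq_borel_continuous mu (nu : {measure set (borel L) -> \bar R}) :
  hausdorff_space L -> compact [set: L] -> mu setT < +oo ->
  inner_regular mu -> inner_regular nu ->
  (forall f : L -> R, continuous f -> (forall x, (0 <= f x <= 1)%R) ->
    \int[mu]_x (f x)%:E = \int[nu]_x (f x)%:E) ->
  eq_borel mu nu.
Proof.
move=> hL cL mufin irmu irnu munu; apply: eq_borel_inner_regular => // C U cC oU CU.
have [f [cf f01 f1 f0]] := compact_separation (R := R) hL cL cC oU CU.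
have mf := continuous_borel cf.
have mC : measurable (C : set (borel L)) by apply: closed_borel; apply: compact_closed.
have mU : measurable (U : set (borel L)) by apply: open_borel.
have f0' t : (0 <= f t)%R by case/andP: (f01 t).
have f1' t : C t -> (1 <= f t)%R by move=> /f1 ->.
by split; apply: (le_trans (le_measure_integral _ mC mf f0' f1')); [
  rewrite munu//|rewrite -munu//]; apply: le_integral_measure.
Qed.

End integral_bounds.

(* Counting the levels below [s] approximates [s] from below within [1]. *)
Lemma sum_levels {R : realType} (N : nat) (s : R) : 0 <= s ->
  let S := \sum_(k < N) (if k.+1%:R < s then 1 else 0 : R) in
  S <= s /\ (s <= N%:R -> s <= S + 1).
Proof.
move=> s0 /=.
(* The comparison is strict: at [s = n] the level [n] itself is not counted, and there the loss of
   [1] is attained. *)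
have sumT (n : nat) : n%:R <= s -> \sum_(k < n) (if k.+1%:R < s then 1 else 0 : R) >= n%:R - 1 /\
   (n%:R < s -> \sum_(k < n) (if k.+1%:R < s then 1 else 0 : R) = n%:R).
  elim: n => [|n IH] ns; first by rewrite big_ord0 sub0r; split => //; rewrite oppr_le0.
  rewrite big_ord_recr/=.
  have ns' : n%:R < s by apply: lt_le_trans ns; rewrite ltr_nat.
  have [_ /(_ ns') ->] := IH (ltW ns').
  rewrite -[n.+1]addn1 natrD; split => [|->//].
  by rewrite addrK lerDl; case: ifP.
elim: N => [|N [IH1 IH2]]; first by rewrite big_ord0 add0r; split => // /le_trans; apply.
rewrite big_ord_recr/=; have [Ns|sN] := ltP N.+1%:R s.
  have Ns' : N%:R < s by apply: lt_trans Ns; rewrite ltr_nat.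
  have [_ /(_ Ns') ->] := sumT _ (ltW Ns').
  by split => //; rewrite natr1 ltW.
rewrite addr0; split => // _; have [/IH2//|Ns] := leP s N%:R.
have [_ ->//] := sumT _ (ltW Ns).
by rewrite natr1.
Qed.

(** * Directed suprema of lower semicontinuous functions *)

Section tau_additivity.
Context {R : realType} {L : ptopologicalType}.
Variables (m : {measure set (borel L) -> \bar R}) (I : choiceType) (D : set I).
Variables (g_ : I -> L -> R) (g : L -> R).
Hypotheses (hL : hausdorff_space L).
Hypotheses (m1 : m setT = 1%E) (rm : inner_regular m) (D0 : D !=set0).
Hypothesis g_01 : forall i x, D i -> 0 <= g_ i x <= 1.
Hypothesis g01 : forall x, 0 <= g x <= 1.
Hypothesis g_lsc : forall i (a : R), D i -> open [set x | a < g_ i x].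
Hypothesis glsc : forall a : R, open [set x | a < g x].
Hypothesis g_dir : forall i j, D i -> D j ->
  exists k, [/\ D k, forall x, g_ i x <= g_ k x & forall x, g_ j x <= g_ k x].
Hypothesis g_sup : forall x a, a < g x -> exists2 i, D i & a < g_ i x.
Local Open Scope ereal_scope.

Let level_integral n (h : L -> R) : (forall a : R, open [set x | (a < h x)%R]) ->
  \int[m]_x (\sum_(k < n) (if k.+1%:R < n%:R * h x then 1 else 0 : R))%:E =
  \sum_(k < n) m [set x | (k.+1%:R / n%:R < h x)%R].
Proof.
case: n => [|n] hlsc.
  by rewrite big_ord0; under eq_integral do rewrite big_ord0; rewrite integral0.
transitivity (\int[m]_x (\sum_(k < n.+1)
    (\1_[set x : borel L | (k.+1%:R / n.+1%:R < h x)%R] x)%:E)).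
  apply: eq_integral => x _; rewrite -sumEFin; apply: eq_bigr => k _.
  rewrite indicE; congr (_%:E).
  have -> : ((k.+1%:R < n.+1%:R * h x) = (k.+1%:R / n.+1%:R < h x))%R.
    by rewrite ltr_pdivrMr// mulrC.
  by case: ifP => h1; [rewrite mem_set|rewrite memNset//= h1].
rewrite ge0_integral_sum//.
- apply: eq_bigr => k _; rewrite integral_indic ?setIT//.
  exact: open_borel.
- move=> k; apply/measurable_EFinP; apply: measurable_indic.
  exact: open_borel.
Qed.

Let levels (n : nat) (h : L -> R) (x : L) : R :=
  (\sum_(k < n) (if k.+1%:R < n%:R * h x then 1 else 0))%R.

Let level_measurable n (h : L -> R) : (forall a : R, open [set x | (a < h x)%R]) ->
  measurable_fun setT (levels n h : borel L -> _).
Proof.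
move=> hlsc; case: n => [|n].
  rewrite /levels; under eq_fun do rewrite big_ord0; exact: measurable_cst.
apply: measurable_sum => k.
rewrite (_ : (fun x => _) = \1_[set x : borel L | (k.+1%:R / n.+1%:R < h x)%R]).
  by apply: measurable_indic; exact: open_borel.
apply/funext => x; rewrite indicE.
have -> : ((k.+1%:R < n.+1%:R * h x) = (k.+1%:R / n.+1%:R < h x))%R.
  by rewrite ltr_pdivrMr// mulrC.
by case: ifP => h1; [rewrite mem_set|rewrite memNset//= h1].
Qed.

Let lsc_measurable (h : L -> R) : (forall a : R, open [set x | (a < h x)%R]) ->
  measurable_fun setT (h : borel L -> _).
Proof.
by move=> hlsc; apply/measurable_EFinP; apply: lsc_borel => a; exact: hlsc.
Qed.

Let g_compact (C : set L) (a : R) : compact C ->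
  (forall x, C x -> (a < g x)%R) ->
  exists2 i, D i & forall x, C x -> (a < g_ i x)%R.
Proof.
rewrite compact_cover => /(_ _ D (fun i => [set x | (a < g_ i x)%R])) h Ca.
have [D' D'D CD'] : finite_subset_cover D (fun i => [set x | (a < g_ i x)%R]) C.
  apply: h => [i Di|x /Ca /g_sup[i Di ax]]; [exact: g_lsc|by exists i].
have [k Dk kP] : exists2 k, D k & forall i, i \in finmap.enum_fset D' -> forall x, (g_ i x <= g_ k x)%R.
  have : {subset finmap.enum_fset D' <= D} by move=> i /D'D.
  elim: (finmap.enum_fset D') => [|i s IH] sD; first by have [k Dk] := D0; exists k.
  have [|k Dk kP] := IH; first by move=> j js; apply: sD; rewrite inE js orbT.
  have Di : D i by apply/set_mem/sD; rewrite inE eqxx.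
  have [l [Dl il kl]] := g_dir Di Dk.
  exists l => // j; rewrite inE => /predU1P[->//|js x].
  exact: le_trans (kP _ js x) (kl x).
exists k => // x /CD'[i /= iD' aix].
by apply: lt_le_trans aix _; exact: kP.
Qed.

Let g_levels (n N : nat) (d : R) : (0 < d)%R ->
  exists2 i, D i & forall k, (k < N)%N ->
    m [set x | (k.+1%:R / n%:R < g x)%R] <=
    m [set x | (k.+1%:R / n%:R < g_ i x)%R] + d%:E.
Proof.
move=> d0; elim: N => [|N [i Di IH]]; first by have [i Di] := D0; exists i.
pose a : R := (N.+1%:R / n%:R)%R.
have [j Dj jP] : exists2 j, D j & m [set x | (a < g x)%R] <= m [set x | (a < g_ j x)%R] + d%:E.
  have [C [cC Ca mC]] : exists C : set L, [/\ compact C, C `<=` [set x | (a < g x)%R] &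
      m [set x | (a < g x)%R] - d%:E < m C].
    apply: inner_regularP => //; rewrite lteBlDr// lteDl// ?lte_fin//.
    by apply: fin_num_le_measure; rewrite ?m1 ?ltry//; exact: open_borel (glsc a).
  have [j Dj jP] := g_compact cC Ca; exists j => //.
  rewrite -leeBlDr//; apply: le_trans (ltW mC) _.
  by rewrite le_measure ?inE//; [apply: closed_borel; apply: compact_closed|by apply: open_borel; apply: g_lsc].
have [k [Dk ik jk]] := g_dir Di Dj; exists k => // l; rewrite ltnS leq_eqVlt => /predU1P[->|lN].
  apply: le_trans jP _; rewrite leeD2r// le_measure ?inE//; [by apply: open_borel; apply: g_lsc..|].
  by move=> x /= h; apply: lt_le_trans h _.
apply: le_trans (IH _ lN) _; rewrite leeD2r// le_measure ?inE//; [by apply: open_borel; apply: g_lsc..|].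
by move=> x /= h; apply: lt_le_trans h _.
Qed.

(** Monotone convergence along a directed family that may be uncountable. Up to [1 / n], an integral
    is the mean of the measures of [n] superlevel sets. Each superlevel set of [g] contains a
    compact set of almost full measure, which directedness places inside a superlevel set of a
    single [g_ i]; directedness again makes one index serve all [n] levels. *)
Lemma tau_additive (e : R) : (0 < e)%R ->
  exists2 i, D i & \int[m]_x (g x)%:E <= \int[m]_x (g_ i x)%:E + e%:E.
Proof.
move=> e0; have e20 : (0 < e / 2)%R by rewrite divr_gt0.
(* Of the total error [e], one half pays for the rounding, which costs at most [1 / n], and the
   other half for the loss of [e / 2] in the measure of each level. *)
pose n := (Num.truncn (2 / e)).+1.
have ne : (1 < n%:R * (e / 2))%R.
  have := truncnS_gt (2 / e)%R; rewrite -/n ltr_pdivrMr// => h.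
  by rewrite mulrA ltr_pdivlMr// mul1r.
have [i Di iP] := @g_levels n n _ e20; exists i => //.
have mg := lsc_measurable glsc.
have mgi := lsc_measurable (fun a => @g_lsc i a Di).
have mfin : m setT < +oo by rewrite m1 ltry.
have := fin_num_integral01 mfin mg g01; have := fin_num_integral01 mfin mgi (fun x => g_01 x Di).
have g0 x : (0 <= g x)%R by case/andP: (g01 x).
have gi0 x : (0 <= g_ i x)%R by case/andP: (g_01 x Di).
have lev0 h x : (0 <= levels n h x)%R by apply: sumr_ge0 => k _; case: ifP.
have A : n%:R%:E * \int[m]_x (g x)%:E <= \sum_(k < n) m [set x | (k.+1%:R / n%:R < g x)%R] + 1.
  rewrite -level_integral// -ge0_integralZl_EFin//; [|by move=> x _; rewrite lee_fin|exact/measurable_EFinP].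
  rewrite -{1}m1 -[X in _ + X]mul1e -integral_cst// -ge0_integralD//; last 2 first.
    by move=> x _; rewrite lee_fin; exact: lev0.
    by apply/measurable_EFinP; apply: (level_measurable n glsc).
  apply: ge0_le_integral => //.
  - by move=> x _; rewrite -EFinM lee_fin mulr_ge0.
  - apply/measurable_EFinP; apply: measurable_funM => //.
  - apply: emeasurable_funD => //; by apply/measurable_EFinP; apply: (level_measurable n glsc).
  move=> x _; rewrite -EFinM -EFinD lee_fin.
  have [_] := @sum_levels R n (n%:R * g x) (mulr_ge0 (ler0n _ _) (g0 x)); apply.
  by rewrite ler_piMr//; case/andP: (g01 x).
have B : \sum_(k < n) m [set x | (k.+1%:R / n%:R < g_ i x)%R] <= n%:R%:E * \int[m]_x (g_ i x)%:E.
  rewrite -level_integral//; last by move=> a; exact: g_lsc.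
  rewrite -ge0_integralZl_EFin//; [|by move=> x _; rewrite lee_fin|exact/measurable_EFinP].
  apply: ge0_le_integral => //.
  - by move=> x _; rewrite lee_fin; exact: lev0.
  - by apply/measurable_EFinP; apply: (level_measurable n) => a; apply: g_lsc.
  - by apply/measurable_EFinP; apply: measurable_funM.
  move=> x _; rewrite -EFinM lee_fin.
  by have [+ _] := @sum_levels R n (n%:R * g_ i x) (mulr_ge0 (ler0n _ _) (gi0 x)).
have C : \sum_(k < n) m [set x | (k.+1%:R / n%:R < g x)%R] <=
    \sum_(k < n) m [set x | (k.+1%:R / n%:R < g_ i x)%R] + (n%:R * (e / 2))%:E.
  rewrite [X in _ + X](_ : _ = \sum_(k < n) (e / 2)%:E); last first.
    by rewrite sumEFin sumr_const card_ord mulr_natl.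
  by rewrite -big_split/=; apply: lee_sum => k _; exact: iP.
have := le_trans (le_trans A (leeD C (lexx 1))) (leeD (leeD B (lexx _)) (lexx _)).
case: (\int[m]_x (g x)%:E) => // a; case: (\int[m]_x (g_ i x)%:E) => // b h _ _.
move: h; rewrite -!EFinM -!EFinD !lee_fin => h.
have n0 : (0 < n%:R :> R)%R by rewrite ltr0n.
rewrite -(ler_pM2l n0); nra.
Qed.

End tau_additivity.

Section compact_hypergroup.
Context {R : realType} {L : ptopologicalType}.
Variable HL : hypergroup R L.
Hypothesis cL : compact [set: L].
Let hL := hypergroup_hausdorff HL.

Lemma compact_support (f : L -> R) : continuous f -> continuous_compact_support f.
Proof.
move=> cf; split => //; apply: subclosed_compact (subsetT _) => //.
exact: closed_closure.
Qed.

(** By inner regularity the mass of [U] is approached by integrals of Urysohn functions below the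
    indicator of [U], and those integrals are continuous in [y]. *)
Lemma conv_lsc (x : L) (U : set L) (a : R) : open U ->
  open [set y | (a%:E < hconv HL x y U)%E].
Proof.
move=> oU; apply: open_near => y /=.
have [_ _ ir] := conv_radon HL x y.
move=> /(inner_regularP ir oU)[C [cC CU aC]].
have [f [cf f01 f1 f0]] := compact_separation (R := R) hL cL cC oU CU.
have mf := continuous_borel cf.
pose I y := (\int[hconv HL x y]_t (f t)%:E)%E.
have Ifin z : I z \is a fin_num.
  by apply: fin_num_integral01 => //; exact: probability_fin.
have aI : a < fine (I y).
  rewrite -lte_fin fineK//; apply: lt_le_trans aC _.
  apply: le_measure_integral => //.
  - by apply: closed_borel; apply: compact_closed.
  - by move=> z; case/andP: (f01 z).
  - by move=> z Cz; rewrite f1.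
have cI : continuous (fun z => fine (I z)).
  move=> z; have := @conv_continuous _ _ HL f (compact_support cf) (x, z).
  apply: (@continuous_comp L (L * L)%type R (fun z => (x, z)) (fun z : L * L => \int[hconv HL z.1 z.2]_t f t)).
  by apply: cvg_pair => //; exact: cvg_cst.
have : \forall z \near y, a < fine (I z).
  by move/cvgr_gt: (cI y) => /(_ _ aI).
apply: filterS => z /=; rewrite -lte_fin fineK// => /lt_le_trans; apply.
apply: le_integral_measure => //; exact: open_borel.
Qed.

Lemma conv_measurable (x : L) (A : set (borel L)) : measurable A ->
  measurable_fun setT ((fun y => hconv HL x y A) : borel L -> _).
Proof.
move=> mA; apply: (@dynkin_induction _ (borel L) (@open L)
  (fun A => measurable_fun setT ((fun y => hconv HL x y A) : borel L -> _))) => //.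
- by move=> U V; exact: openI.
- rewrite (_ : (fun y => _) = cst 1%E); first exact: measurable_cst.
  by apply/funext => y; rewrite probability_setT.
- by move=> U oU; apply: lsc_borel => a; exact: conv_lsc.
- move=> B mB mfB.
  rewrite (_ : (fun y => _) = (fun y => 1 - hconv HL x y B)%E); last first.
    by apply/funext => y; rewrite probability_setC.
  exact: emeasurable_funB.
- move=> F mF tF mfF.
  rewrite (_ : (fun y => _) = (fun y => \sum_(0 <= i <oo) hconv HL x y (F i))%E); last first.
    by apply/funext => y; apply/esym/cvg_lim => //; apply: measure_sigma_additive.
  by apply: ge0_emeasurable_sum.
Qed.

Variable m : {measure set (borel L) -> \bar R}.
Hypotheses (haarm : is_haar HL m) (m1 : m setT = 1%E).
Local Open Scope ereal_scope.

Let conv_giry x (y : borel L) : giry (borel L) R := hconv HL x y.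

Let measurable_conv_giry x : measurable_fun setT (conv_giry x).
Proof.
by apply: measurable_giry_codensity => // B mB; exact: conv_measurable.
Qed.

(** The total mass being [1], normalising leaves [m] unchanged; it only equips [m] with the
    structure of a probability. *)
Let mg : giry (borel L) R :=
  mnormalize m (dirac (point : borel L) : probability (borel L) R).

Let mgE (A : set (borel L)) : mg A = m A.
Proof.
rewrite /mg/= /mnormalize m1 onee_eq0/=.
by rewrite invr1 mule1.
Qed.

(** The convolution of the point mass at [x] with [m]. Invariance for Borel functions amounts to its
    being equal to [m]. *)
Let nu x : {measure set (borel L) -> \bar R} := giry_bind mg (measurable_conv_giry x).

Let integral_nu x (h : borel L -> \bar R) : measurable_fun setT h -> (forall t, 0 <= h t) ->
  \int[nu x]_t h t = \int[m]_y \int[hconv HL x y]_t h t.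
Proof.
move=> mh h0; transitivity (giry_int mg (fun y => \int[hconv HL x y]_t h t)).
  exact: (giry_int_bind mg (measurable_conv_giry x) mh h0).
by apply: eq_measure_integral => A mA _; rewrite -mgE.
Qed.

Let nuE x (A : set (borel L)) : measurable A -> nu x A = \int[m]_y hconv HL x y A.
Proof.
move=> mA; rewrite -[A in LHS]setIT -(@integral_indic _ _ _ (nu x) _ measurableT)// integral_nu//.
  by apply: eq_integral => y _; rewrite integral_indic// setIT.
exact/measurable_EFinP/measurable_indic.
Qed.

Let nu_fin x : nu x setT < +oo.
Proof.
rewrite nuE//; under eq_integral do rewrite probability_setT.
by rewrite integral_cst// mul1e m1 ltry.
Qed.

Let integral_haar x (f : L -> R) : continuous f -> (forall t, (0 <= f t <= 1)%R) ->
  \int[nu x]_t (f t)%:E = \int[m]_t (f t)%:E.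
Proof.
move=> cf f01; have mf := continuous_borel cf.
rewrite integral_nu//; last 2 first.
  exact/measurable_EFinP.
  by move=> t; rewrite lee_fin; case/andP: (f01 t).
have [_ _ /(_ x f (compact_support cf))] := haarm.
rewrite /Rintegral => h; have {h} := congr1 EFin h.
have If y : \int[hconv HL x y]_t (f t)%:E \is a fin_num.
  by apply: fin_num_integral01 => //; exact: probability_fin.
have -> : \int[m]_y (fine (\int[hconv HL x y]_t (f t)%:E))%:E =
    \int[m]_y \int[hconv HL x y]_t (f t)%:E.
  by apply: eq_integral => y _; rewrite fineK.
rewrite !fineK//; first by apply: fin_num_integral01; rewrite ?m1 ?ltry.
rewrite -integral_nu; last 2 first.
  exact/measurable_EFinP.
  by move=> t; rewrite lee_fin; case/andP: (f01 t).
apply: fin_num_integral01 => //.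
Qed.

(** The mass of [U] under [nu x] is the integral of the mass of [U] under [hconv HL x y]. The open
    sets [V] with closure inside [U] are directed under union, and by normality and inner regularity
    of each [hconv HL x y] their masses have that of [U] as supremum. [tau_additive] takes the
    supremum out of the integral, and the closures are compact. *)
Let inner_regular_nu x : inner_regular (nu x).
Proof.
move=> U oU; apply/le_anti/andP; split; last first.
  apply: ge_ereal_sup => _ [C [cC CU] <-]; rewrite le_measure ?inE//.
    by apply: closed_borel; apply: compact_closed.
  exact: open_borel.
rewrite nuE; last exact: open_borel.
apply/lee_addgt0Pr => e e0.
pose D := [set V : set L | open V /\ closure V `<=` U].
pose g (V : set L) (y : L) : R := fine (hconv HL x y V).
have gE V y : open V -> (g V y)%:E = hconv HL x y V.
  move=> oV; rewrite /g fineK// fin_num_le_measure//.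
    exact: probability_fin.
  exact: open_borel.
have g01 V y : open V -> (0 <= g V y <= 1)%R.
  move=> oV; rewrite -!lee_fin gE// measure_ge0 probability_le1//.
  exact: open_borel.
have g_le V W y : open V -> open W -> V `<=` W -> (g V y <= g W y)%R.
  move=> oV oW VW; rewrite -lee_fin !gE// le_measure ?inE//; exact: open_borel.
have g_lsc V a : open V -> open [set y | (a < g V y)%R].
  move=> oV; rewrite (_ : [set y | _] = [set y | a%:E < hconv HL x y V]).
    exact: conv_lsc.
  by apply/funext => y /=; rewrite -gE// lte_fin.
have [V [oV cVU] Ve] : exists2 V, D V &
    \int[m]_y (g U y)%:E <= \int[m]_y (g V y)%:E + e%:E.
  apply: tau_additive => //.
  - by have [[]] := haarm.
  - by exists set0; split; [exact: open0|rewrite closure0].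
  - by move=> V y [/g01].
  - by move=> y; exact: g01.
  - by move=> V a [/g_lsc].
  - by move=> a; exact: g_lsc.
  - move=> V W [oV VU] [oW WU]; have oVW := openU oV oW.
    exists (V `|` W); split; first by split => //; rewrite closureU subUset.
      by move=> y; apply: g_le => //; exact: subsetUl.
    by move=> y; apply: g_le => //; exact: subsetUr.
  - move=> y a; rewrite -lte_fin gE//.
    have [_ _ ir] := conv_radon HL x y.
    move=> /(inner_regularP ir oU)[C [cC CU aC]].
    have [W + WU] : filter_from (set_nbhs C) closure U.
      apply: (compact_normal hL cL); first exact: compact_closed.
      by apply/set_nbhsP; exists U; split.
    move=> /set_nbhsP[V [oV CV VW]]; exists V.
      by split => //; apply: subset_trans WU; exact: closureS.
    rewrite -lte_fin gE//; apply: lt_le_trans aC _; rewrite le_measure ?inE//.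
      by apply: closed_borel; apply: compact_closed.
    exact: open_borel.
under eq_integral do rewrite -gE//.
apply: le_trans Ve _; rewrite leeD2r//.
apply: (@le_trans _ _ (nu x (closure V))).
  under eq_integral do rewrite gE//.
  rewrite -nuE; last exact: open_borel.
  rewrite le_measure ?inE//; [exact: open_borel| |exact: subset_closure].
  by apply: closed_borel; exact: closed_closure.
apply: ereal_sup_ubound; exists (closure V) => //; split => //.
by apply: subclosed_compact (subsetT _) => //; exact: closed_closure.
Qed.

Let eq_nu x : eq_borel (nu x) m.
Proof.
apply: (eq_borel_continuous hL cL (nu_fin x) (inner_regular_nu x)).
  by have [[_ _]] := haarm.
by move=> f; exact: integral_haar.
Qed.

(** Invariance for continuous functions says that [nu x] and [m] agree on these; inner regularity of
    both makes them equal as Borel measures. *)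
Lemma ge0_integral_haar x (h : L -> \bar R) : measurable_fun setT (h : borel L -> _) ->
  (forall t, 0 <= h t) ->
  \int[m]_y \int[hconv HL x y]_t h t = \int[m]_t h t.
Proof.
move=> mh h0; rewrite -integral_nu//.
by apply: eq_measure_integral => A mA _; exact: eq_nu.
Qed.

Lemma haar_integral_measurable x (h : L -> \bar R) : measurable_fun setT (h : borel L -> _) ->
  (forall t, 0 <= h t) ->
  measurable_fun setT ((fun y => \int[hconv HL x y]_t h t) : borel L -> _).
Proof.
move=> mh h0; apply: (measurable_fun_integral_kernel (l := fun y : borel L => hconv HL x y)) => //.
by move=> U mU; exact: conv_measurable.
Qed.

End compact_hypergroup.

(** * Complex integrals *)

Section integral_mix.
Context {R : realType} d d1 d2 (T : measurableType d) (T1 : measurableType d1)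
  (T2 : measurableType d2).
Variables (mu : {measure set T -> \bar R}) (nu1 : {measure set T1 -> \bar R})
  (nu2 : {measure set T2 -> \bar R}) (phi1 : T1 -> T) (phi2 : T2 -> T) (c : R).
Hypotheses (mphi1 : measurable_fun setT phi1) (mphi2 : measurable_fun setT phi2).
Hypothesis c0 : 0 <= c.
Hypothesis muE : forall A, measurable A ->
  (mu A = c%:E * nu1 (phi1 @^-1` A) + nu2 (phi2 @^-1` A))%E.

(** Measures of this shape arise from [join_conv4]: [c] times the Haar measure of [H], plus the part
    of a product on [J] off the identity. The case [c = 0] covers plain image measures. *)
Lemma ge0_integral_mix (f : T -> \bar R) : measurable_fun setT f ->
  (forall x, 0 <= f x)%E ->
  (\int[mu]_x f x = c%:E * \int[nu1]_x f (phi1 x) + \int[nu2]_x f (phi2 x))%E.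
Proof.
move=> mf f0.
have E A : measurable A -> A `<=` setT ->
    mu A = measure_add (mscale (NngNum c0) (pushforward nu1 phi1))
                       (pushforward nu2 phi2) A.
  by move=> mA _; rewrite measure_addE muE.
rewrite (eq_measure_integral _ (E mphi1 mphi2)) ge0_integral_measure_add//.
congr (_ + _)%E.
  transitivity (c%:E * \int[pushforward nu1 phi1]_x f x)%E.
    exact: (ge0_integral_mscale _ measurableT (NngNum c0)).
  by congr (_ * _)%E; apply: ge0_integral_pushforward.
by apply: ge0_integral_pushforward.
Qed.

Hypothesis nu1fin : (nu1 setT < +oo)%E.
Hypothesis nu2fin : (nu2 setT < +oo)%E.

Lemma Rintegral_mix (f : T -> R) (M : R) : measurable_fun setT f ->
  (forall x, `|f x| <= M) ->
  \int[mu]_x f x = c * \int[nu1]_x f (phi1 x) + \int[nu2]_x f (phi2 x).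
Proof.
move=> mf fM.
have mufin : (mu setT < +oo)%E.
  by rewrite muE// lte_add_pinfty// lte_mul_pinfty.
have int (d' : measure_display) (S : measurableType d') (nu : {measure set S -> \bar R}) (g : S -> R) :
    (nu setT < +oo)%E -> measurable_fun setT g -> (forall x, `|g x| <= M) ->
    nu.-integrable setT (EFin \o g).
  move=> nufin mg gM; apply: measurable_bounded_integrable => //.
  by exists M; split; [exact: num_real|move=> N MN x _; exact: le_trans (gM x) (ltW MN)].
(* Adding the bound [M] makes the integrand nonnegative; the integrals of the constant [M] on the
   two sides cancel because the total masses match. *)
have shift (d' : measure_display) (S : measurableType d') (nu : {measure set S -> \bar R}) (g : S -> R) :
    (nu setT < +oo)%E -> measurable_fun setT g -> (forall x, `|g x| <= M) ->
    (\int[nu]_x (g x + M)%:E = (\int[nu]_x g x + M * fine (nu setT))%:E)%E.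
  move=> nufin mg gM; rewrite -Rintegral_cst// -RintegralD//; last 2 first.
  - exact: int.
  - apply: measurable_bounded_integrable => //; exact: bounded_cst.
  rewrite fineK// ge0_fin_numE; last first.
    apply: integral_ge0 => x _; rewrite lee_fin.
    by have := gM x; rewrite ler_norml => /andP[]; lra.
  apply: le_lt_trans (_ : ((2 * M)%:E * nu setT < +oo)%E).
    rewrite -integral_cst//; apply: ge0_le_integral => //.
    - move=> x _; rewrite lee_fin.
      by have := gM x; rewrite ler_norml => /andP[]; lra.
    - by apply/measurable_EFinP; apply: measurable_funD.
    - by move=> x _; rewrite lee_fin; have := gM x; rewrite ler_norml => /andP[]; lra.
  rewrite lte_mul_pinfty// lee_fin mulr_ge0//; exact: le_trans (normr_ge0 _) (gM point).
have mfM : measurable_fun setT (fun x => (f x + M)%:E).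
  by apply/measurable_EFinP; apply: measurable_funD.
have fM0 x : (0 <= (f x + M)%:E)%E.
  by rewrite lee_fin; have := fM x; rewrite ler_norml => /andP[]; lra.
have := ge0_integral_mix mfM fM0; rewrite !shift//; last 2 first.
- exact: measurableT_comp.
- exact: measurableT_comp.
have -> : fine (mu setT) = c * fine (nu1 setT) + fine (nu2 setT).
  by rewrite muE// !preimage_setT fineD ?fineM// ?fin_numM// ge0_fin_numE.
by rewrite -EFinM -EFinD => -[]; lra.
Qed.

End integral_mix.

Section cplx_norm.
Context {R : realType}.
Implicit Types z : cplx R.

Lemma cplx_le z (M : R) : `|z| <= M%:C%C ->
  `|complex.Re z| <= M /\ `|complex.Im z| <= M.
Proof.
move=> zM; split; rewrite -lecR; apply: le_trans zM; first exact: normc_ge_Re.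
have := normc_ge_Re (z * 'i%C); rewrite ReiNIm normrN normrM.
by rewrite [X in _ * X](_ : _ = 1) ?mulr1// normc_def/= expr0n/= add0r expr1n sqrtr1.
Qed.

(** The factor [2] stands for the sharp square root of two. It is the source of the twos in
    [cintegral_le], in the bound on characters and in the norms of the transported functionals,
    where only finiteness counts. *)
Lemma le_cplx z (M : R) : `|complex.Re z| <= M -> `|complex.Im z| <= M ->
  `|z| <= (2 * M)%:C%C.
Proof.
move=> rM iM; rewrite [z]complexE; apply: le_trans (ler_normD _ _) _.
rewrite normrM [X in _ + X * _](_ : _ = 1) ?mul1r; last first.
  by rewrite normc_def/= expr0n/= add0r expr1n sqrtr1.
have normR (x : R) : `|x%:C%C| = `|x|%:C%C :> R[i].
  by rewrite normc_def/= expr0n/= addr0 sqrtr_sqr.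
rewrite !normR mulr_natl mulr2n rmorphD/=.
by rewrite lerD// lecR.
Qed.

Lemma ReD z1 z2 : complex.Re (z1 + z2 : cplx R) = complex.Re z1 + complex.Re z2.
Proof. by case: z1 z2 => [a b] [a' b']. Qed.
Lemma ImD z1 z2 : complex.Im (z1 + z2 : cplx R) = complex.Im z1 + complex.Im z2.
Proof. by case: z1 z2 => [a b] [a' b']. Qed.
Lemma ReM z1 z2 : complex.Re (z1 * z2 : cplx R) =
  complex.Re z1 * complex.Re z2 - complex.Im z1 * complex.Im z2.
Proof. by case: z1 z2 => [a b] [a' b']. Qed.
Lemma ImM z1 z2 : complex.Im (z1 * z2 : cplx R) =
  complex.Re z1 * complex.Im z2 + complex.Im z1 * complex.Re z2.
Proof. by case: z1 z2 => [a b] [a' b']. Qed.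

Lemma cplx_eq z1 z2 : complex.Re z1 = complex.Re z2 ->
  complex.Im z1 = complex.Im z2 -> z1 = z2.
Proof. by case: z1 z2 => [a b] [a' b'] /= -> ->. Qed.

Lemma cplx_lt z (e : R) : `|z| < e%:C%C ->
  `|complex.Re z| < e /\ `|complex.Im z| < e.
Proof.
move=> ze; split; rewrite -ltcR; apply: le_lt_trans ze; first exact: normc_ge_Re.
have := normc_ge_Re (z * 'i%C); rewrite ReiNIm normrN normrM.
by rewrite [X in _ * X](_ : _ = 1) ?mulr1// normc_def/= expr0n/= add0r expr1n sqrtr1.
Qed.

Lemma ReB z1 z2 : complex.Re (z1 - z2 : cplx R) = complex.Re z1 - complex.Re z2.
Proof. by case: z1 z2 => [a b] [a' b']. Qed.
Lemma ImB z1 z2 : complex.Im (z1 - z2 : cplx R) = complex.Im z1 - complex.Im z2.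
Proof. by case: z1 z2 => [a b] [a' b']. Qed.

Lemma continuous_Re : continuous (fun z : cplx R => complex.Re z).
Proof.
move=> z A /nbhs_ballP[e /= e0 eA]; apply/nbhs_ballP.
exists (e%:C%C) => /=; first by rewrite ltcR.
by move=> t /cplx_lt[zt _]; apply: eA; rewrite /ball/= -ReB.
Qed.

Lemma continuous_Im : continuous (fun z : cplx R => complex.Im z).
Proof.
move=> z A /nbhs_ballP[e /= e0 eA]; apply/nbhs_ballP.
exists (e%:C%C) => /=; first by rewrite ltcR.
by move=> t /cplx_lt[_ zt]; apply: eA; rewrite /ball/= -ImB.
Qed.

End cplx_norm.

Section bounded_borel.
Context {R : realType} {L : ptopologicalType}.
Implicit Types (f g : L -> cplx R).

Lemma bounded_borelP f : bounded_borel_cfun f -> exists2 M : R,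
  forall x, `|complex.Re (f x)| <= M & forall x, `|complex.Im (f x)| <= M.
Proof.
by move=> [_ [M fM]]; exists M => x; have [] := cplx_le (fM x).
Qed.

Lemma bounded_borel_cst (c : cplx R) : bounded_borel_cfun (fun _ : L => c).
Proof.
split; first by split; exact: measurable_cst.
exists (Num.max 0 (complex.Re `|c|)) => x.
rewrite -[leLHS]RRe_real ?lecR ?le_max ?lexx ?orbT//.
Qed.

Lemma bounded_borelD f g : bounded_borel_cfun f -> bounded_borel_cfun g ->
  bounded_borel_cfun (fun x => f x + g x).
Proof.
move=> [[f1 f2] [M fM]] [[g1 g2] [N gN]]; split.
  split.
  - under eq_fun do rewrite ReD; exact: measurable_funD.
  - under eq_fun do rewrite ImD; exact: measurable_funD.
exists (M + N) => x; rewrite rmorphD; apply: le_trans (ler_normD _ _) _.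
exact: lerD.
Qed.

Lemma bounded_borelM f g : bounded_borel_cfun f -> bounded_borel_cfun g ->
  bounded_borel_cfun (fun x => f x * g x).
Proof.
move=> [[f1 f2] [M fM]] [[g1 g2] [N gN]]; split.
  split.
  - under eq_fun do rewrite ReM; apply: measurable_funB; exact: measurable_funM.
  - under eq_fun do rewrite ImM; apply: measurable_funD; exact: measurable_funM.
exists (M * N) => x; rewrite rmorphM normrM; exact: ler_pM.
Qed.

Lemma bounded_borelZ (c : cplx R) f : bounded_borel_cfun f ->
  bounded_borel_cfun (fun x => c * f x).
Proof. by apply: bounded_borelM; exact: bounded_borel_cst. Qed.

Lemma bounded_borel_conj f : bounded_borel_cfun f ->
  bounded_borel_cfun (fun x => (f x)^*).
Proof.
move=> [[f1 f2] [M fM]]; split; last by exists M => x; rewrite norm_conjC.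
split.
- rewrite (_ : (fun x => _) = (fun x => complex.Re (f x)))//.
  by apply/funext => x; case: (f x).
- rewrite (_ : (fun x => _) = (fun x => - complex.Im (f x))).
    exact: measurableT_comp.
  by apply/funext => x; case: (f x).
Qed.

Lemma bounded_borel_comp (L' : ptopologicalType) (phi : L' -> L) f :
  measurable_fun setT (phi : borel L' -> borel L) ->
  bounded_borel_cfun f -> bounded_borel_cfun (fun x => f (phi x)).
Proof.
move=> mphi [[f1 f2] [M fM]]; split; last by exists M.
by split; [apply: (measurableT_comp f1)|apply: (measurableT_comp f2)].
Qed.

Lemma continuous_borel_map (L' : ptopologicalType) (phi : L' -> L) :
  continuous phi -> measurable_fun setT (phi : borel L' -> borel L).
Proof.
move=> cphi; apply: (measurability _ (erefl : @measurable _ (borel L) = <<s @open L >>)).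
move=> _ [U oU <-]; rewrite setTI; apply: open_borel.
by apply: open_comp => // x _; exact: cphi.
Qed.

Lemma bounded_borel_continuous f : continuous f ->
  (exists M : R, forall x, `|f x| <= M%:C%C) -> bounded_borel_cfun f.
Proof.
move=> cf fM; split => //; split; apply: continuous_borel => x.
  by apply: (@continuous_comp _ _ _ f (fun z : cplx R => complex.Re z)); [exact: cf|exact: continuous_Re].
by apply: (@continuous_comp _ _ _ f (fun z : cplx R => complex.Im z)); [exact: cf|exact: continuous_Im].
Qed.

End bounded_borel.

Section cintegral_theory.
Context {R : realType} {L : ptopologicalType}.
Implicit Types (f g : L -> cplx R) (mu : {measure set (borel L) -> \bar R}).

Let integrable mu (h : L -> R) (M : R) : (mu setT < +oo)%E ->
  measurable_fun setT (h : borel L -> _) -> (forall x, `|h x| <= M) ->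
  mu.-integrable setT (EFin \o (h : borel L -> _)).
Proof.
move=> mufin mh hM; apply: measurable_bounded_integrable => //.
by exists M; split; [exact: num_real|move=> N MN x _; exact: le_trans (hM x) (ltW MN)].
Qed.

Lemma eq_cintegral mu f g : f =1 g -> cintegral mu f = cintegral mu g.
Proof. by move=> /funext ->. Qed.

Lemma eq_borel_cintegral mu (nu : {measure set (borel L) -> \bar R}) f : eq_borel mu nu -> cintegral mu f = cintegral nu f.
Proof.
by move=> munu; apply: cplx_eq; congr fine; apply: eq_measure_integral => A mA _; exact: munu.
Qed.

Lemma cintegral_cst mu (c : cplx R) : cintegral mu (fun=> c) = (fine (mu setT))%:C%C * c.
Proof.
rewrite /cintegral !Rintegral_cst//; apply: cplx_eq.
  by rewrite ReM/= mul0r subr0 mulrC.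
by rewrite ImM/= mul0r addr0 mulrC.
Qed.

Lemma cintegralD mu f g : (mu setT < +oo)%E -> bounded_borel_cfun f -> bounded_borel_cfun g ->
  cintegral mu (fun x => f x + g x) = cintegral mu f + cintegral mu g.
Proof.
move=> mufin bf bg; have [M rf if_] := bounded_borelP bf; have [N rg ig] := bounded_borelP bg.
have [[f1 f2] _] := bf; have [[g1 g2] _] := bg.
apply: cplx_eq; rewrite ?ReD ?ImD /=.
  under eq_Rintegral do rewrite ReD; rewrite RintegralD//; exact: integrable.
by under eq_Rintegral do rewrite ImD; rewrite RintegralD//; exact: integrable.
Qed.

Lemma cintegralZ mu (c : cplx R) f : (mu setT < +oo)%E -> bounded_borel_cfun f ->
  cintegral mu (fun x => c * f x) = c * cintegral mu f.
Proof.
move=> mufin bf; have [M rf if_] := bounded_borelP bf; have [[f1 f2] _] := bf.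
have ir := integrable mufin f1 rf; have ii := integrable mufin f2 if_.
have irZ (k : R) : mu.-integrable setT (EFin \o (fun x : borel L => k * complex.Re (f x))).
  exact: (integrableZl measurableT k ir).
have iiZ (k : R) : mu.-integrable setT (EFin \o (fun x : borel L => k * complex.Im (f x))).
  exact: (integrableZl measurableT k ii).
apply: cplx_eq; rewrite ?ReM ?ImM /=.
  by under eq_Rintegral do rewrite ReM; rewrite RintegralB// !RintegralZl.
by under eq_Rintegral do rewrite ImM; rewrite RintegralD// !RintegralZl.
Qed.

Lemma cintegral_le mu f (M : R) : (mu setT < +oo)%E -> bounded_borel_cfun f -> 0 <= M ->
  mu.-negligible [set x : borel L | ~ `|f x| <= M%:C%C] ->
  `|cintegral mu f| <= (2 * (M * fine (mu setT)))%:C%C.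
Proof.
move=> mufin bf M0 fM; have [N rf if_] := bounded_borelP bf; have [[f1 f2] _] := bf.
have aux (h : L -> R) : measurable_fun setT (h : borel L -> _) -> (forall x, `|h x| <= N) ->
    (forall x, `|f x| <= M%:C%C -> `|h x| <= M) ->
    `|\int[mu]_x h x| <= M * fine (mu setT).
  move=> mh hN hM; apply: le_trans (le_normr_Rintegral _ _) _ => //.
    exact: integrable mufin mh hN.
  rewrite -Rintegral_cst//; apply: fine_le.
  - apply: integrable_fin_num => //.
    exact: (integrable_norm (integrable mufin mh hN)).
  - by rewrite integral_cst// fin_numM// ge0_fin_numE.
  apply: ae_ge0_le_integral => //.
  - by apply/measurable_EFinP; apply: measurableT_comp.
  - by move: fM; apply: negligibleS => x /= /not_implyP[_ nh] fx; apply: nh; rewrite lee_fin hM.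
apply: le_cplx => /=.
  by apply: aux => // x /cplx_le[].
by apply: aux => // x /cplx_le[].
Qed.

End cintegral_theory.

Section cintegral_mix.
Context {R : realType} {L L1 L2 : ptopologicalType}.
Variables (mu : {measure set (borel L) -> \bar R}) (nu1 : {measure set (borel L1) -> \bar R})
  (nu2 : {measure set (borel L2) -> \bar R}) (phi1 : L1 -> L) (phi2 : L2 -> L) (c : R).
Hypotheses (mphi1 : measurable_fun setT (phi1 : borel L1 -> borel L))
  (mphi2 : measurable_fun setT (phi2 : borel L2 -> borel L)).
Hypothesis c0 : 0 <= c.
Hypothesis muE : eq_borel mu
  (fun A => c%:E * nu1 (phi1 @^-1` A) + nu2 (phi2 @^-1` A))%E.
Hypotheses (nu1fin : (nu1 setT < +oo)%E) (nu2fin : (nu2 setT < +oo)%E).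

Lemma cintegral_mix (f : L -> cplx R) : bounded_borel_cfun f ->
  cintegral mu f = c%:C%C * cintegral nu1 (fun x => f (phi1 x)) +
                   cintegral nu2 (fun x => f (phi2 x)).
Proof.
move=> bf; have [M rf if_] := bounded_borelP bf; have [[f1 f2] _] := bf.
apply: cplx_eq; rewrite ?ReD ?ReM ?ImD ?ImM /= ?mul0r ?subr0 ?addr0.
  exact: (Rintegral_mix (phi1 := phi1 : borel L1 -> borel L) (phi2 := phi2 : borel L2 -> borel L) mphi1 mphi2 c0 muE nu1fin nu2fin f1 rf).
exact: (Rintegral_mix (phi1 := phi1 : borel L1 -> borel L) (phi2 := phi2 : borel L2 -> borel L) mphi1 mphi2 c0 muE nu1fin nu2fin f2 if_).
Qed.

End cintegral_mix.

Lemma cintegral_pushforward {R : realType} {L L' : ptopologicalType}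
    (mu : {measure set (borel L) -> \bar R}) (nu : {measure set (borel L') -> \bar R})
    (phi : L' -> L) (f : L -> cplx R) :
  measurable_fun setT (phi : borel L' -> borel L) ->
  eq_borel mu (fun A => nu (phi @^-1` A)) -> (nu setT < +oo)%E ->
  bounded_borel_cfun f -> cintegral mu f = cintegral nu (fun x => f (phi x)).
Proof.
move=> mphi muE nufin bf.
rewrite (@cintegral_mix _ _ _ _ mu nu nu phi phi 0 mphi mphi (lexx _) _ nufin nufin _ bf).
  by rewrite mul0r add0r.
by move=> A mA; rewrite mul0e add0e muE.
Qed.

Section cintegral_more.
Context {R : realType} {L : ptopologicalType}.
Implicit Types (mu : {measure set (borel L) -> \bar R}) (f g : L -> cplx R).

Lemma cintegral_ae_eq mu f g (N : set (borel L)) : measurable N -> mu N = 0%E ->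
  bounded_borel_cfun f -> bounded_borel_cfun g ->
  (forall x, ~ N x -> f x = g x) -> cintegral mu f = cintegral mu g.
Proof.
move=> mN N0 [[f1 f2] _] [[g1 g2] _] fg.
apply: cplx_eq; congr fine; apply: ae_eq_integral => //; try exact/measurable_EFinP.
- exists N; split => // x /= h; apply: contrapT => /fg e; apply: h => _ /=.
  by rewrite e.
- exists N; split => // x /= h; apply: contrapT => /fg e; apply: h => _ /=.
  by rewrite e.
Qed.

Lemma cintegral_dirac (x : L) f : bounded_borel_cfun f ->
  cintegral (dirac (x : borel L) : {measure set (borel L) -> \bar R}) f = f x.
Proof.
move=> [[f1 f2] _]; apply: cplx_eq; rewrite /= /Rintegral.
  by rewrite integral_dirac ?diracT ?mul1e//; apply/measurable_EFinP.
by rewrite integral_dirac ?diracT ?mul1e//; apply/measurable_EFinP.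
Qed.

End cintegral_more.

(** * Haar measures *)

Section cintegral_haar.
Context {R : realType} {L : ptopologicalType}.
Variables (HL : hypergroup R L) (m : {measure set (borel L) -> \bar R}).
Hypotheses (cL : compact [set: L]) (haarm : is_haar HL m) (m1 : m setT = 1%E).

Lemma Rintegral_haar x (f : L -> R) (M : R) : measurable_fun setT (f : borel L -> _) ->
  (forall t, `|f t| <= M) ->
  \int[m]_y \int[hconv HL x y]_t f t = \int[m]_t f t.
Proof.
move=> mf fM.
have fM0 t : 0 <= f t + M by have := fM t; rewrite ler_norml => /andP[]; lra.
have int (nu : {measure set (borel L) -> \bar R}) (h : L -> R) : (nu setT < +oo)%E ->
    measurable_fun setT (h : borel L -> _) -> (forall t, `|h t| <= M) ->
    nu.-integrable setT (EFin \o (h : borel L -> _)).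
  move=> nufin mh hM; apply: measurable_bounded_integrable => //.
  by exists M; split; [exact: num_real|move=> N MN t _; exact: le_trans (hM t) (ltW MN)].
have intM (nu : {measure set (borel L) -> \bar R}) : (nu setT < +oo)%E ->
    nu.-integrable setT (EFin \o (fun _ : borel L => M)).
  by move=> nufin; apply: measurable_bounded_integrable => //; exact: bounded_cst.
have shift (nu : {measure set (borel L) -> \bar R}) (h : L -> R) : nu setT = 1%E ->
    measurable_fun setT (h : borel L -> _) -> (forall t, `|h t| <= M) ->
    (\int[nu]_t (h t + M)%:E = (\int[nu]_t h t + M)%:E)%E.
  move=> nu1 mh hM; have nufin : (nu setT < +oo)%E by rewrite nu1 ltry.
  have -> : \int[nu]_t h t + M = \int[nu]_t (h t + M).
    rewrite RintegralD//; [|exact: int|exact: intM].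
    by rewrite Rintegral_cst// nu1 mulr1.
  rewrite fineK//; apply: integrable_fin_num => //.
  have -> : (fun t => (h t + M)%:E) = (EFin \o (h : borel L -> _)) \+ (EFin \o (fun _ => M)) by [].
  by apply: integrableD => //; [exact: int|exact: intM].
have mfM : measurable_fun setT ((fun t => (f t + M)%:E) : borel L -> _).
  by apply/measurable_EFinP; apply: measurable_funD.
have fM0' t : (0 <= (f t + M)%:E)%E by rewrite lee_fin.
have := ge0_integral_haar cL haarm m1 x mfM fM0'.
have bint y : `|\int[hconv HL x y]_t f t| <= M.
  apply: le_trans (le_normr_Rintegral _ _) _ => //.
    by apply: int => //; exact: probability_fin.
  apply: (@le_trans _ _ (\int[hconv HL x y]_t M)).
    apply: le_Rintegral => //.
      exact: (integrable_norm (int _ _ (probability_fin _) mf fM)).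
    exact: (intM _ (probability_fin _)).
  by rewrite Rintegral_cst// [X in fine X](probability_setT (hconv HL x y)) /= mulr1.
have mint : measurable_fun setT ((fun y => \int[hconv HL x y]_t f t) : borel L -> _).
  have := haar_integral_measurable HL cL x mfM fM0'.
  under eq_fun do rewrite (shift (hconv HL x _) f (probability_setT _) mf fM).
  move=> /measurable_EFinP h.
  have -> : (fun y => \int[hconv HL x y]_t f t) = (fun y : borel L => (\int[hconv HL x y]_t f t + M) - M).
    by apply/funext => y; rewrite addrK.
  exact: measurable_funB.
under eq_integral do rewrite (shift (hconv HL x _) f (probability_setT _) mf fM).
rewrite !shift// => -[]; lra.
Qed.

Lemma cintegral_haar x f : bounded_borel_cfun f ->
  cintegral m (fun y => cintegral (hconv HL x y) f) = cintegral m f.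
Proof.
move=> bf; have [M rf if_] := bounded_borelP bf; have [[f1 f2] _] := bf.
by apply: cplx_eq => /=; exact: Rintegral_haar.
Qed.

End cintegral_haar.

(** With inner regularity, this makes an open set null as soon as each of its points has a null open
    neighbourhood. *)
Lemma compact_locally_null {R : realType} {L : ptopologicalType}
    (m : {measure set (borel L) -> \bar R}) (C : set L) : hausdorff_space L ->
  compact C -> (forall x, C x -> exists U : set L, [/\ open U, U x & m U = 0%E]) ->
  m C = 0%E.
Proof.
move=> hL cC null; move: (cC); rewrite compact_cover.
move=> /(_ _ [set U : set L | open U /\ m U = 0%E] id)[|x /null[U [oU Ux U0]]|D' D'D CD'].
- by move=> U [].
- by exists U.
have [W [oW W0 D'W]] : exists W : set L, [/\ open W, m W = 0%E &
    forall U : set L, U \in finmap.enum_fset D' -> U `<=` W].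
  have : forall U, U \in finmap.enum_fset D' -> open U /\ m U = 0%E.
    by move=> U /D'D; rewrite inE.
  elim: (finmap.enum_fset D') => [|U s IH] sP.
    by exists set0; split => //; exact: open0.
  have [|W [oW W0 sW]] := IH; first by move=> U' U's; apply: sP; rewrite inE U's orbT.
  have [oU U0] := sP U (mem_head _ _).
  exists (W `|` U); split; first exact: openU.
    by rewrite measureU0//; exact: open_borel.
  by move=> U'; rewrite inE => /predU1P[->|/sW h]; [exact: subsetUr|exact: subset_trans h (@subsetUl _ _ _)].
apply: subset_measure0 W0; [|exact: open_borel|].
  by apply: closed_borel; exact: compact_closed.
by move=> x /CD'[U UD' Ux]; exact: D'W UD' _ Ux.
Qed.

(** * Haar measure near a compact open set such as [H] in a join *)

Section haar_clopen.
Context {R : realType} {L : ptopologicalType}.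
Variables (HL : hypergroup R L) (m : {measure set (borel L) -> \bar R}) (V : set L).
Hypotheses (haarm : is_haar HL m) (oV : open V) (cV : compact V).
Hypothesis Ve : V (hid HL).
Hypothesis Vinv : forall x, V x -> V (hinv HL x).
(** The model is the copy of [H] in a join: a product of two points charges it only when they are
    inverse to each other or both lie in it. The identity alone, in a discrete hypergroup, is
    another instance. *)
Hypothesis Vconv : forall x y, hconv HL x y V != 0%E -> y = hinv HL x \/ V x /\ V y.
Let hL := hypergroup_hausdorff HL.
Let clV : closed V. Proof. exact: compact_closed. Qed.

Lemma conv_inv_open_pos (x : L) (U : set L) : open U -> U (hid HL) ->
  (0 < hconv HL x (hinv HL x) U)%E.
Proof. by move=> oU Ue; have /hid_supp := erefl (hinv HL x); exact. Qed.

Lemma continuous_indic_clopen : continuous (\1_V : L -> R).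
Proof.
move=> x; apply: cvg_near_cst; have [Vx|nVx] := pselect (V x).
  have : nbhs x V by exact: open_nbhs_nbhs.
  by apply: filterS => y Vy; rewrite !indicE !mem_set.
have : nbhs x (~` V) by apply: open_nbhs_nbhs; split => //; exact: closed_openC.
by apply: filterS => y nVy; rewrite !indicE !memNset.
Qed.

Lemma supported_clopen (f : L -> R) : continuous f -> (forall x, ~ V x -> f x = 0) ->
  continuous_compact_support f.
Proof.
move=> cf f0; split => //; apply: subclosed_compact cV _; first exact: closed_closure.
rewrite [X in _ `<=` X](closure_id V).1//; apply: closureS => x /= fx.
by apply: contrapT => /f0.
Qed.

Let supp_compact x : exists2 C : set L, compact C &
  forall y, hconv HL x y V != 0%E -> C y.
Proof.
exists (V `|` [set hinv HL x]); first by apply: compactU => //; exact: compact_set1.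
by move=> y /Vconv[->|[_ Vy]]; [right|left].
Qed.

Let mV : measurable (V : set (borel L)). Proof. exact: open_borel. Qed.

Let fine_convE x y : (fine (hconv HL x y V))%:E = hconv HL x y V.
Proof. by rewrite fineK// fin_num_le_measure//; exact: probability_fin. Qed.

Let continuous_conv x : continuous (fun y => fine (hconv HL x y V)).
Proof.
have c1 := continuous_indic_clopen.
have cs : continuous_compact_support (\1_V : L -> R).
  by apply: supported_clopen => // y nVy; rewrite indicE memNset.
have E y : fine (hconv HL x y V) = \int[hconv HL x y]_t (\1_V t : R).
  by rewrite /Rintegral integral_indic// setIT.
move=> y; have := @conv_continuous _ _ HL _ cs (x, y).
have -> : (fun y => fine (hconv HL x y V)) = (fun z : L * L => \int[hconv HL z.1 z.2]_t (\1_V t : R)) \o (fun y => (x, y)).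
  by apply/funext => z /=; exact: E.
apply: continuous_comp.
by apply: cvg_pair => //; exact: cvg_cst.
Qed.

(** If [V] were null, invariance would make the integral over [y] of the mass of [V] under the
    product of [hinv HL x] and [y] vanish. That mass is continuous in [y], and positive at [y = x]
    because the identity lies in the support there. So every point [x] would have a null open
    neighbourhood, and [m] would be zero. *)
Lemma haar_clopen_pos : (0 < m V)%E.
Proof.
rewrite lt0e measure_ge0 andbT; apply/negP => /eqP mV0.
have [[mfin _ ir] mT inv] := haarm.
have null x : exists U : set L, [/\ open U, U x & m U = 0%E].
  have [C cC CP] := supp_compact (hinv HL x).
  pose g y := fine (hconv HL (hinv HL x) y V).
  have mg : measurable_fun setT (g : borel L -> _) by apply: continuous_borel; exact: continuous_conv.
  have mC : measurable (C : set (borel L)) by apply: closed_borel; exact: compact_closed.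
  have g0 y : 0 <= g y by rewrite fine_ge0.
  (* A real integral reads an infinite value as [0], so the vanishing derived next means something
     only because [g] lives on a compact set and has a finite integral. *)
  have gC : (\int[m]_y (g y)%:E <= m C)%E.
    apply: le_integral_measure => //.
      move=> y; rewrite g0/= -lee_fin fine_convE probability_le1//.
    move=> y nCy; rewrite /g; have [->//|/CP//] := eqVneq (hconv HL (hinv HL x) y V) 0%E.
  have : (\int[m]_y (g y)%:E = 0)%E.
    have := inv (hinv HL x) (\1_V) (supported_clopen continuous_indic_clopen _).
    have -> : (fun y => \int[hconv HL (hinv HL x) y]_z (\1_V z : R)) = g.
      by apply/funext => y; rewrite /Rintegral integral_indic// setIT.
    rewrite /Rintegral integral_indic// setIT mV0/= => h.
    rewrite -[LHS]fineK; last first.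
      rewrite ge0_fin_numE; first exact: le_lt_trans gC (mfin _ cC).
      by apply: integral_ge0 => y _; rewrite lee_fin.
    by rewrite h// => y nVy; rewrite indicE memNset.
  move=> g_int0; exists [set y | 0 < g y]; split.
  - by apply: (@open_comp _ _ g [set r | 0 < r]); [move=> y _; exact: continuous_conv|exact: open_gt].
  - rewrite /= -lte_fin fine_convE -{2}[x](hinvK HL); exact: conv_inv_open_pos.
  - have : (\int[m]_y `|(g y)%:E| = 0)%E.
      by under eq_integral do rewrite gee0_abs ?lee_fin//.
    move/ae_eq_integral_abs => /(_ measurableT _)[].
      exact/measurable_EFinP.
    move=> N [mN N0 sN]; apply: subset_measure0 N0 => //.
      apply: open_borel.
      by apply: (@open_comp _ _ g [set r | 0 < r]); [move=> y _; exact: continuous_conv|exact: open_gt].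
    by move=> y /= gy; apply: sN => /= /(_ I)[] g00; rewrite g00 ltxx in gy.
have : (m setT <= 0)%E.
  rewrite ir; last exact: openT.
  by apply: ge_ereal_sup => _ [C [cC _] <-]; rewrite (compact_locally_null hL).
by rewrite measure_le0 => /eqP.
Qed.

(** Translate [f] by the inverse of [b]: the product of [hinv HL b] with [k] charges [V] only for
    [k = b], since [b] lies outside [V]. The translated function is therefore a multiple of the
    indicator of [b]. *)
Lemma haar_clopen_integral (b : L) (f : L -> R) : ~ V b -> continuous f ->
  (forall x, ~ V x -> f x = 0) ->
  \int[m]_x f x = fine (m [set b]) * \int[hconv HL (hinv HL b) b]_x f x.
Proof.
move=> nVb cf f0; have [_ _ inv] := haarm.
rewrite -(inv (hinv HL b) f); last exact: supported_clopen.
have E k : \int[hconv HL (hinv HL b) k]_x f x =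
    \int[hconv HL (hinv HL b) b]_x f x * (\1_[set b] k : R).
  rewrite indicE; have [->|kb] := eqVneq k b; first by rewrite mem_set// mulr1.
  rewrite memNset ?mulr0; last by move/eqP: kb.
  have V0 : hconv HL (hinv HL b) k V = 0%E.
    apply/eqP/negP => /negP /Vconv[]; rewrite ?hinvK; first by move/eqP: kb.
    by move=> [/Vinv]; rewrite hinvK.
  rewrite /Rintegral; have -> : (\int[hconv HL (hinv HL b) k]_x (f x)%:E = \int[hconv HL (hinv HL b) k]_x (cst 0 x))%E.
    apply: ae_eq_integral => //; first by apply/measurable_EFinP; apply: continuous_borel.
    exists V; split => // x /= h; apply: contrapT => /f0 fx; apply: h => _.
    by rewrite fx.
  by rewrite integral0.
under eq_Rintegral do rewrite E.
rewrite /Rintegral; under eq_integral do rewrite EFinM.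
have mb : measurable ([set b] : set (borel L)).
  by apply: closed_borel; apply: compact_closed => //; exact: compact_set1.
rewrite integralZl//; last first.
  apply/integrableP; split; first by apply/measurable_EFinP; exact: measurable_indic.
  under eq_integral do rewrite gee0_abs ?lee_fin//.
  rewrite integral_indic// setIT.
  by have [[+ _ _] _ _] := haarm; apply; exact: compact_set1.
rewrite integral_indic// setIT fineM//; first by rewrite mulrC.
by rewrite ge0_fin_numE//; have [[+ _ _] _ _] := haarm; apply; exact: compact_set1.
Qed.

(** For the indicator of [V], the preceding identity makes [m V] a multiple of the mass of [b]. *)
Lemma haar_point_pos (b : L) : ~ V b -> (0 < m [set b])%E.
Proof.
move=> nVb; have := haar_clopen_integral nVb continuous_indic_clopen.
rewrite lt0e measure_ge0 andbT => h; apply/negP => /eqP b0; move: h.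
rewrite b0 mul0r /Rintegral integral_indic// setIT => h.
have : m V = 0%E.
  rewrite -[LHS]fineK; last by rewrite ge0_fin_numE//; have [[+ _ _] _ _] := haarm; apply.
  by rewrite h// => x nVx; rewrite indicE memNset.
by move=> V0; have := haar_clopen_pos; rewrite V0 ltxx.
Qed.

End haar_clopen.

Lemma mrestr_setC0 d (T : measurableType d) (R : realType)
    (mu : {measure set T -> \bar R}) (A : set T) (mA : measurable (~` A)) :
  mrestr mu mA A = 0%E.
Proof. by rewrite /mrestr setICr measure0. Qed.

(** * Amenability of joins *)

Section extend_theory.
Context {A X Y : Type} {i : A -> X} (i_inj : injective i).
Implicit Types (c : Y) (f : A -> Y).

Lemma extendE c f a : extend i c f (i a) = f a.
Proof.
rewrite /extend; case: pselect => [ex|]; last by case; exists a.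
by congr f; apply: i_inj; case: (cid ex).
Qed.

Lemma extend_out c f x : (forall a, i a <> x) -> extend i c f x = c.
Proof. by move=> ix; rewrite /extend; case: pselect => [ex|//]; case: (ex) => a ia; case: (ix a ia). Qed.

End extend_theory.

Lemma conv_isolated_id {R : realType} {L : ptopologicalType} (HL : hypergroup R L) x y :
  open [set hid HL] -> x <> hinv HL y -> hconv HL x y [set hid HL] = 0%E.
Proof.
move=> oe xy; have nsupp : ~ supp (hconv HL x y) (hid HL).
  by move/hid_supp => yx; apply: xy; rewrite yx hinvK.
apply: contrapT => /eqP p0; apply: nsupp => U oU Ue.
apply: (@lt_le_trans _ _ (hconv HL x y [set hid HL])); first by rewrite lt0e p0 measure_ge0.
by rewrite le_measure ?inE//; [exact: open_borel..|move=> _ ->].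
Qed.

Section join_amenability.
Context {R : realType} {H J K : ptopologicalType}.
Variables (HH : hypergroup R H) (HJ : hypergroup R J) (HK : hypergroup R K).
Variables (mH : {measure set (borel H) -> \bar R}) (iH : H -> K) (iJ : J -> K).
Hypotheses (compactH : compact [set: H]) (haarH : is_haar HH mH)
  (mH1 : mH setT = 1%E) (joinK : is_join HH HJ mH HK iH iJ)
  (openJ : forall A : set J, open A).
Variables (mJ : {measure set (borel J) -> \bar R}) (mK : {measure set (borel K) -> \bar R}).
Hypothesis mJ_pos : forall y, mJ [set y] <> 0%E.
Hypothesis mK_pos : forall y, y <> hid HJ -> mK [set iJ y] <> 0%E.
Hypothesis mHK : forall A : set (borel K), measurable A -> mK A = 0%E ->
  mH (iH @^-1` A) = 0%E.
Let eJ := hid HJ.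

Let iH_inj := join_injl joinK.
Let iJ_inj := join_injr joinK.

Lemma join_id : iJ eJ = iH (hid HH).
Proof. by apply/esym/(join_meet joinK). Qed.

Lemma join_meet_id h y : iJ y = iH h -> y = eJ.
Proof. by move=> /esym/(join_meet joinK)[]. Qed.

Lemma join_cases k : (exists h, k = iH h) \/ (exists2 y, y <> eJ & k = iJ y).
Proof.
have [[h <-]|[y <-]] := join_cover joinK k; first by left; exists h.
by have [->|ye] := pselect (y = eJ); [left; rewrite join_id; exists (hid HH)|right; exists y].
Qed.

Lemma join_range_open : open (range iH).
Proof.
rewrite -[range iH]setCK; apply: closed_openC.
rewrite (_ : ~` range iH = iJ @` [set y | y <> eJ]).
  by apply: (join_closedr joinK); rewrite -openC; exact: openJ.
apply/seteqP; split => k.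
  move=> nk; have [[h hk]|[y ye yk]] := join_cases k; first by case: nk; exists h.
  by exists y.
by move=> [y ye <-] [h _ /esym/join_meet_id].
Qed.

Lemma join_range_compact : compact (range iH).
Proof.
exact: (continuous_compact (continuous_subspaceT (join_continuousl joinK)) compactH).
Qed.

Let measurableJ (A : set (borel J)) : measurable A.
Proof. exact: open_borel. Qed.

Let measurable_iH : measurable_fun setT (iH : borel H -> borel K).
Proof. by apply: continuous_borel_map; exact: join_continuousl joinK. Qed.

Let measurable_iJ : measurable_fun setT (iJ : borel J -> borel K).
Proof. by move=> _ B _; exact: measurableJ. Qed.

Let bounded_borelJ (f : J -> cplx R) (M : R) : (forall y, `|f y| <= M%:C%C) -> bounded_borel_cfun f.
Proof. by move=> fM; split; [split => _ B _; exact: measurableJ|exists M]. Qed.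

Let mHfin : (mH setT < +oo)%E. Proof. by rewrite mH1 ltry. Qed.

Definition join_hat (f : K -> cplx R) (y : J) : cplx R :=
  if y == eJ then cintegral mH (fun h => f (iH h)) else f (iJ y).

Lemma join_hat_id f : join_hat f eJ = cintegral mH (fun h => f (iH h)).
Proof. by rewrite /join_hat eqxx. Qed.

Lemma join_hat_ne f y : y <> eJ -> join_hat f y = f (iJ y).
Proof. by move/eqP => ye; rewrite /join_hat (negbTE ye). Qed.

Let bounded_borel_iH (f : K -> cplx R) : bounded_borel_cfun f -> bounded_borel_cfun (fun h => f (iH h)).
Proof. exact: bounded_borel_comp measurable_iH. Qed.

Let hat_le f (M : R) : bounded_borel_cfun f -> 0 <= M ->
  (forall y, y <> eJ -> `|f (iJ y)| <= M%:C%C) ->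
  mH.-negligible [set h : borel H | ~ `|f (iH h)| <= M%:C%C] ->
  forall y, `|join_hat f y| <= (2 * M)%:C%C.
Proof.
move=> bf M0 fJ fH y; have [->|ye] := pselect (y = eJ).
  rewrite join_hat_id; have := cintegral_le mHfin (bounded_borel_iH bf) M0 fH.
  by rewrite [X in fine X]mH1 /= mulr1.
rewrite join_hat_ne//; apply: le_trans (fJ _ ye) _; rewrite lecR; lra.
Qed.

Let bounded_hat f : bounded_borel_cfun f -> bounded_borel_cfun (join_hat f).
Proof.
move=> bf; have [_ [M fM]] := bf.
have fM' k : `|f k| <= `|M|%:C%C by apply: le_trans (fM k) _; rewrite lecR ler_norm.
apply: (@bounded_borelJ _ (2 * `|M|)); apply: hat_le => //.
rewrite (_ : [set _ | _] = set0); first exact: negligible_set0.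
by rewrite -subset0 => h /=; exact.
Qed.

Lemma join_translateHH f x y : bounded_borel_cfun f ->
  translate HK (iH x) f (iH y) = translate HH x (fun h => f (iH h)) y.
Proof.
move=> bf; apply: cintegral_pushforward => //; first exact: join_conv1 joinK x y.
exact: probability_fin.
Qed.

Lemma join_translateHJ f h y : bounded_borel_cfun f -> y <> eJ -> translate HK (iH h) f (iJ y) = f (iJ y).
Proof.
move=> bf ye; rewrite /translate (eq_borel_cintegral _ (join_conv3l joinK h ye)).
exact: cintegral_dirac.
Qed.

Lemma join_translateJH f h y : bounded_borel_cfun f -> y <> eJ -> translate HK (iJ y) f (iH h) = f (iJ y).
Proof.
move=> bf ye; rewrite /translate (eq_borel_cintegral _ (join_conv3r joinK h ye)).
exact: cintegral_dirac.
Qed.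

(** If [x] and [y] are not inverse, their product in [J] does not charge [e], the only point where
    [join_hat f] differs from [f] on [J]. If they are inverse, [join_conv4] replaces the atom at [e]
    by [mH], and averaging over [H] does the same to the function. *)
Lemma join_translateJJ f x y : bounded_borel_cfun f -> y <> eJ ->
  translate HK (iJ x) f (iJ y) = translate HJ x (join_hat f) y.
Proof.
move=> bf ye; have bhf := bounded_hat bf.
have bfJ : bounded_borel_cfun (fun j => f (iJ j)) by exact: bounded_borel_comp.
have [xy|xy] := pselect (x = hinv HJ y); last first.
  transitivity (cintegral (hconv HJ x y) (fun j => f (iJ j))).
    apply: cintegral_pushforward => //; first exact: join_conv2 joinK x y xy.
    exact: probability_fin.
  apply: (@cintegral_ae_eq _ _ _ _ _ [set eJ]) => //; first exact: conv_isolated_id.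
  by move=> j je; rewrite join_hat_ne.
rewrite {x}xy; pose p := hconv HJ (hinv HJ y) y; pose c := fine (p [set eJ]).
have cE : c%:E = p [set eJ].
  by rewrite fineK// fin_num_le_measure//; exact: probability_fin.
have c0 : 0 <= c by rewrite fine_ge0.
have mD : measurable (~` [set eJ] : set (borel J)) by exact: measurableJ.
pose q := mrestr p mD.
have qfin : (q setT < +oo)%E.
  by rewrite /q /mrestr setTI; apply: le_lt_trans (probability_fin p); rewrite le_measure ?inE.
have -> : translate HK (iJ (hinv HJ y)) f (iJ y) =
    c%:C%C * cintegral mH (fun h => f (iH h)) + cintegral q (fun j => f (iJ j)).
  apply: cintegral_mix => // A mA.
  by apply: etrans (join_conv4 joinK ye mA) _; rewrite cE.
have -> : translate HJ (hinv HJ y) (join_hat f) y =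
    c%:C%C * cintegral (dirac (eJ : borel J) : {measure set (borel J) -> \bar R}) (join_hat f) +
    cintegral q (join_hat f).
  apply: (cintegral_mix (phi1 := id) (phi2 := id)) => //.
  - move=> A mA; rewrite cE -/p /q /mrestr /= diracE.
    have -> : p A = (p (A `&` [set eJ]) + p (A `&` ~` [set eJ]))%E.
      rewrite -measureU; [by rewrite -setIUr setUv setIT|exact: measurableJ..|].
      by rewrite setIACA setICr setI0.
    congr (_ + _)%E; have [Ae|nAe] := pselect (A eJ).
      by rewrite mem_set// mule1; congr (p _); apply/seteqP; split => [j []//|j ->].
    rewrite memNset// mule0 -(measure0 p); congr (p _).
    by rewrite -subset0 => j [Aj je]; apply: nAe; rewrite -je.
  - by rewrite /= diracE mem_set//= ltry.
rewrite cintegral_dirac// join_hat_id; congr (_ + _).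
apply: (@cintegral_ae_eq _ _ _ _ _ [set eJ]) => //.
  exact: mrestr_setC0.
by move=> j je; rewrite join_hat_ne.
Qed.

Let hat_translateJ f x : bounded_borel_cfun f -> x <> eJ ->
  join_hat (translate HK (iJ x) f) = translate HJ x (join_hat f).
Proof.
move=> bf xe; apply/funext => y; have [->|ye] := pselect (y = eJ); last first.
  by rewrite join_hat_ne// join_translateJJ.
rewrite join_hat_id; under eq_cintegral do rewrite join_translateJH//.
rewrite cintegral_cst [X in fine X]mH1 mul1r /translate.
rewrite (eq_borel_cintegral _ (conv_idr HJ x)) cintegral_dirac ?join_hat_ne//.
exact: bounded_hat.
Qed.

(** Off [e] translation by [H] changes nothing on [J]; at [e] the claim is the invariance of [mH],
    for a function that is merely bounded Borel. *)
Let hat_translateH f x : bounded_borel_cfun f -> join_hat (translate HK (iH x) f) = join_hat f.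
Proof.
move=> bf; apply/funext => y; have [->|ye] := pselect (y = eJ); last first.
  by rewrite !join_hat_ne// join_translateHJ.
rewrite !join_hat_id; under eq_cintegral do rewrite join_translateHH//.
by apply: cintegral_haar => //; exact: bounded_borel_iH.
Qed.

Let locally_null0 (L : ptopologicalType) (m : {measure set (borel L) -> \bar R}) (P : set L) :
  (forall x, ~ P x) -> locally_null m P.
Proof.
move=> P0 C _; rewrite (_ : P `&` C = set0); first exact: negligible_set0.
by rewrite -subset0 => x [/P0].
Qed.

Variable alpha : J -> cplx R.
Hypothesis alpha_e : alpha eJ = 1.
Let alphaK := extend iJ (1 : cplx R) alpha.

Let alphaKJ y : alphaK (iJ y) = alpha y.
Proof. exact: extendE. Qed.

Let alphaKH h : alphaK (iH h) = 1.
Proof.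
have [[y yh]|nh] := pselect (exists y, iJ y = iH h).
  by rewrite -yh alphaKJ (join_meet_id yh).
by rewrite /alphaK extend_out// => y yh; apply: nh; exists y.
Qed.

Lemma amenable_join_of_discrete : amenable HJ mJ alpha -> amenable HK mK alphaK.
Proof.
move=> [m [[mD mZ [N mN]] ma mT]]; exists (fun f => m (join_hat f)); split; first split.
- move=> f g bf bg; rewrite -mD; [|exact: bounded_hat..].
  congr m; apply/funext => y; rewrite /join_hat; case: eqP => // _.
  by rewrite cintegralD//; exact: bounded_borel_iH.
- move=> c f bf; rewrite -mZ; last exact: bounded_hat.
  congr m; apply/funext => y; rewrite /join_hat; case: eqP => // _.
  by rewrite cintegralZ//; exact: bounded_borel_iH.
- exists (N * 2) => f M bf M0 fM; rewrite -mulrA; apply: mN.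
  + exact: bounded_hat.
  + by rewrite mulr_ge0.
  (* The bound on [f] holds off a locally null set. Points of [J] other than [e] have positive mass,
     so there it holds everywhere. The image of [H] is compact, so the exceptional set inside it is
     null for [mK], hence its preimage is null for [mH] and the mean over [H] is controlled. *)
  apply: locally_null0 => y; apply; apply: hat_le => //.
    move=> {}y ye; apply: contrapT => nfy.
    have [A [mA A0 sA]] := fM _ (@compact_set1 _ (iJ y)).
    apply: (mK_pos ye); apply: subset_measure0 A0 => //.
      apply: closed_borel; rewrite -(image_set1 iJ); apply: (join_closedr joinK).
      by rewrite -openC; exact: openJ.
    by move=> _ ->; apply: sA.
  have [A [mA A0 sA]] := fM _ (continuous_compact (continuous_subspaceT (join_continuousl joinK)) compactH).
  exists (iH @^-1` A); split.
  + by rewrite -[X in measurable X]setTI; exact: measurable_iH.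
  + exact: mHK.
  + by move=> h /= nfh; apply: sA; split => //; exists h.
- rewrite -ma; congr m; apply/funext => y; have [->|ye] := pselect (y = eJ).
    rewrite join_hat_id; under eq_cintegral do rewrite alphaKH.
    by rewrite cintegral_cst [X in fine X]mH1 mul1r alpha_e.
  by rewrite join_hat_ne.
- move=> f k bf; have [[h ->]|[y ye ->]] := join_cases k.
    by rewrite hat_translateH// alphaKH mul1r.
  by rewrite hat_translateJ// alphaKJ mT//; exact: bounded_hat.
Qed.

Let tilde (f : J -> cplx R) : K -> cplx R := extend iJ (f eJ) f.

Let tildeJ f y : tilde f (iJ y) = f y. Proof. exact: extendE. Qed.

Let tildeH f h : tilde f (iH h) = f eJ.
Proof.
have [[y yh]|nh] := pselect (exists y, iJ y = iH h).
  by rewrite -yh tildeJ (join_meet_id yh).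
by rewrite /tilde extend_out// => y yh; apply: nh; exists y.
Qed.

Let tilde_all f (P : cplx R -> Prop) : (forall y, P (f y)) -> forall k, P (tilde f k).
Proof. by move=> Pf k; have [[h ->]|[y _ ->]] := join_cases k; rewrite ?tildeH ?tildeJ. Qed.

(** As [J] is discrete, each of its subsets has a closed image in [K], so a preimage is a union of
    at most two closed sets. *)
Let tilde_borel f (g : cplx R -> R) :
  measurable_fun setT ((fun k => g (tilde f k)) : borel K -> _).
Proof.
move=> _ B mB; rewrite setTI.
rewrite (_ : _ @^-1` _ = iJ @` [set y | B (g (f y))] `|`
    (if `[< B (g (f eJ)) >] then range iH else set0)).
  apply: measurableU.
    by apply: closed_borel; apply: (join_closedr joinK); rewrite -openC; exact: openJ.
  case: asboolP => _; last exact: measurable0.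
  by apply: closed_borel; apply: (join_closedl joinK); exact: closedT.
apply/seteqP; split => k.
  have [[h ->]|[y _ ->]] := join_cases k; rewrite /= ?tildeH ?tildeJ => Bk.
    by right; case: asboolP => // _; exists h.
  by left; exists y.
case=> [[y By <-]|]; first by rewrite /= tildeJ.
by case: asboolP => // Be [h _ <-]; rewrite /= tildeH.
Qed.

Let bounded_tilde f : bounded_borel_cfun f -> bounded_borel_cfun (tilde f).
Proof.
move=> [_ [M fM]]; split; first by split; exact: tilde_borel.
by exists M; exact: (@tilde_all f (fun z => `|z| <= M%:C%C)).
Qed.

Let hat_tilde f : join_hat (tilde f) = f.
Proof.
apply/funext => y; have [->|ye] := pselect (y = eJ); last by rewrite join_hat_ne// tildeJ.
rewrite join_hat_id; under eq_cintegral do rewrite tildeH.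
by rewrite cintegral_cst [X in fine X]mH1 mul1r.
Qed.

Let tilde_translate f x : bounded_borel_cfun f ->
  tilde (translate HJ x f) = translate HK (iJ x) (tilde f).
Proof.
move=> bf; have btf := bounded_tilde bf; apply/funext => k.
(* The identity is treated apart: [iJ eJ] lies in [H], where [join_translateJH] does not apply. *)
have [->|xe] := pselect (x = eJ).
  have -> : translate HJ eJ f = f.
    apply/funext => y; rewrite /translate (eq_borel_cintegral _ (conv_idl HJ y)).
    exact: cintegral_dirac.
  rewrite join_id -(join_hidl joinK) /translate (eq_borel_cintegral _ (conv_idl HK k)).
  by rewrite cintegral_dirac.
have [[h ->]|[y ye ->]] := join_cases k.
  rewrite tildeH join_translateJH// tildeJ /translate (eq_borel_cintegral _ (conv_idr HJ x)).
  exact: cintegral_dirac.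
by rewrite tildeJ join_translateJJ// hat_tilde.
Qed.

Lemma amenable_discrete_of_join : amenable HK mK alphaK -> amenable HJ mJ alpha.
Proof.
move=> [m [[mD mZ [N mN]] ma mT]]; exists (fun f => m (tilde f)); split; first split.
- move=> f g bf bg; rewrite -mD; [|exact: bounded_tilde..].
  congr m; apply/funext => k.
  by have [[h ->]|[y _ ->]] := join_cases k; rewrite ?tildeH ?tildeJ.
- move=> c f bf; rewrite -mZ; last exact: bounded_tilde.
  congr m; apply/funext => k.
  by have [[h ->]|[y _ ->]] := join_cases k; rewrite ?tildeH ?tildeJ.
- exists N => f M bf M0 fM; apply: mN => //; first exact: bounded_tilde.
  (* Points of [J] have positive mass, so an essential bound on [f] is a bound everywhere. *)
  apply: locally_null0 => k; apply; apply: (@tilde_all f (fun z => `|z| <= M%:C%C)) => y.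
  apply: contrapT => nfy; have [A [mA A0 sA]] := fM _ (@compact_set1 _ y).
  apply: (mJ_pos (y := y)); apply: subset_measure0 A0 => //.
  by move=> _ ->; apply: sA.
- rewrite -ma; congr m; apply/funext => k.
  by have [[h ->]|[y _ ->]] := join_cases k; rewrite ?tildeH ?tildeJ ?alphaKH ?alphaKJ.
- move=> f x bf; rewrite tilde_translate// mT ?alphaKJ//; exact: bounded_tilde.
Qed.

End join_amenability.

Lemma continuous_extend {A X Y : topologicalType} (i : A -> X) (c : Y) (f : A -> Y) :
  injective i -> (forall B : set A, closed B -> closed (i @` B)) -> open (range i) ->
  continuous f -> continuous (extend i c f).
Proof.
move=> i_inj i_closed i_open /continuous_closedP cf; apply/continuous_closedP => B cB.
rewrite (_ : _ @^-1` _ = i @` (f @^-1` B) `|` (if `[< B c >] then ~` range i else set0)).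
  apply: closedU; first by apply: i_closed; exact: cf.
  by case: asboolP => _; [exact: open_closedC|exact: closed0].
apply/seteqP; split => x /=.
  have [[a _ <-]|nx] := pselect (range i x); first by rewrite extendE// => Ba; left; exists a.
  rewrite extend_out => [Bc|a ax]; last by apply: nx; exists a.
  by right; rewrite asboolT.
case=> [[a Ba <-]|]; first by rewrite extendE.
case: asboolP => // Bc nx; rewrite extend_out// => a ax; apply: nx; by exists a.
Qed.

Lemma hinv_id {R : realType} {L : ptopologicalType} (HL : hypergroup R L) :
  hinv HL (hid HL) = hid HL.
Proof.
have /hid_supp// : supp (hconv HL (hid HL) (hid HL)) (hid HL).
move=> U oU Ue; rewrite (conv_idl HL (hid HL)); last exact: open_borel.
by rewrite diracE mem_set.
Qed.

(** The positivity results for a compact open set, applied to [[set hid HL]]. *)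
Lemma haar_discrete_pos {R : realType} {L : ptopologicalType} (HL : hypergroup R L)
    (m : {measure set (borel L) -> \bar R}) y :
  is_haar HL m -> open [set hid HL] -> (0 < m [set y])%E.
Proof.
move=> haarm oe.
have ce : compact [set hid HL] by exact: (@compact_set1 _ (hid HL)).
have eP : [set hid HL] (hid HL) by [].
have invP x : [set hid HL] x -> [set hid HL] (hinv HL x) by move=> ->; exact: hinv_id.
have convP x z : hconv HL x z [set hid HL] != 0%E ->
    z = hinv HL x \/ [set hid HL] x /\ [set hid HL] z.
  move=> xz; left; apply: contrapT => zx; move/eqP: xz; apply.
  by apply: conv_isolated_id => // xz; apply: zx; rewrite xz hinvK.
have [->|ye] := pselect (y = hid HL); first exact: (haar_clopen_pos haarm oe ce eP convP).
by apply: (haar_point_pos haarm oe ce eP invP convP).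
Qed.

Section haar_domination.
Context {R : realType} {H K : ptopologicalType}.
Variables (mH : {measure set (borel H) -> \bar R}) (mK : {measure set (borel K) -> \bar R}).
Variables (iH : H -> K) (k : R).
Hypotheses (hH : hausdorff_space H) (cH : compact [set: H]) (irH : inner_regular mH).
Hypothesis mHfin : (mH setT < +oo)%E.
Hypothesis orK : forall A : set (borel K), measurable A ->
  mK A = ereal_inf [set mK U | U in [set U : set K | open U /\ A `<=` U]].
Hypotheses (iH_inj : injective iH) (iHc : continuous iH)
  (iH_closed : forall B : set H, closed B -> closed (iH @` B)) (iH_open : open (range iH)).
Hypothesis mKfin : (mK (range iH) < +oo)%E.
Hypothesis k0 : 0 < k.
Hypothesis kE : forall f : H -> R, continuous f ->
  \int[mK]_x extend iH 0 f x = k * \int[mH]_x f x.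

(** Outer regularity of [mK] encloses [A] in an open [U] with [mK U < k * e]. For a compact [C]
    inside the preimage of [U], a Urysohn function on [H], extended by zero, gives
    [k * mH C <= mK U], so [mH C] is at most [e]; inner regularity of [mH] passes this on to the
    whole preimage. *)
Lemma dominated_by_haar (A : set (borel K)) : measurable A -> mK A = 0%E ->
  mH (iH @^-1` A) = 0%E.
Proof.
move=> mA mA0; apply/eqP; rewrite -measure_le0; apply/lee_addgt0Pr => e e0; rewrite add0e.
have [U [oU AU] Ue] : exists2 U : set K, open U /\ A `<=` U & (mK U < (k * e)%:E)%E.
  have : (mK A < (k * e)%:E)%E by rewrite mA0 lte_fin mulr_gt0.
  by rewrite orK// => /ereal_inf_lt[_ [U UP <-] Ue]; exists U.
have oiU : open (iH @^-1` U) by apply: open_comp => // x _; exact: iHc.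
apply: (@le_trans _ _ (mH (iH @^-1` U))).
  rewrite le_measure ?inE//; last exact: preimage_subset.
    by rewrite -[X in measurable X]setTI; exact: continuous_borel_map.
  exact: open_borel.
rewrite irH//; apply: ge_ereal_sup => _ [C [cC CU] <-].
have [f [cf f01 f1 f0]] := compact_separation (R := R) hH cH cC oiU CU.
have cef := continuous_extend (c := 0) iH_inj iH_closed iH_open cf.
have ef01 x : 0 <= extend iH 0 f x <= 1.
  have [[h _ <-]|nx] := pselect (range iH x); first by rewrite extendE.
  by rewrite extend_out ?lexx ?ler01// => h hx; apply: nx; exists h.
have efU x : ~ (U `&` range iH) x -> extend iH 0 f x = 0.
  have [[h _ <-]|nx] := pselect (range iH x).
    by move=> nU; rewrite extendE// f0// => Uh; apply: nU; split => //; exists h.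
  by rewrite extend_out// => h hx; apply: nx; exists h.
have mef := continuous_borel cef; have mf := continuous_borel cf.
have mU : measurable (U : set (borel K)) by exact: open_borel.
have mV : measurable (range iH : set (borel K)) by exact: open_borel.
have le1 : (\int[mK]_x (extend iH 0 f x)%:E <= mK (U `&` range iH))%E.
  by apply: le_integral_measure => //; exact: measurableI.
have le2 : (mH C <= \int[mH]_x (f x)%:E)%E.
  apply: le_measure_integral => //.
  - by apply: closed_borel; apply: compact_closed.
  - by move=> x; case/andP: (f01 x).
  - by move=> x /f1 ->.
apply: le_trans le2 _.
have ffin := fin_num_integral01 mHfin mf f01.
have effin : (\int[mK]_x (extend iH 0 f x)%:E)%E \is a fin_num.
  rewrite ge0_fin_numE; last by apply: integral_ge0 => x _; rewrite lee_fin; case/andP: (ef01 x).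
  apply: le_lt_trans le1 _; apply: le_lt_trans mKfin.
  by rewrite le_measure ?inE//; exact: measurableI.
have := kE cf; rewrite /Rintegral => E.
rewrite -(fineK ffin) lee_fin -(ler_pM2l k0) -E -lee_fin fineK//.
apply: (le_trans le1); apply: le_trans (ltW Ue).
by rewrite le_measure ?inE//; exact: measurableI.
Qed.

End haar_domination.

(** * The first equivalence: null sets of a Haar measure of the join *)

Section join_first_part.
Context {R : realType} {H J K : ptopologicalType}.
Variables (HH : hypergroup R H) (HJ : hypergroup R J) (HK : hypergroup R K).
Variables (mH : {measure set (borel H) -> \bar R}) (iH : H -> K) (iJ : J -> K).
Hypotheses (compactH : compact [set: H]) (haarH : is_haar HH mH)
  (mH1 : mH setT = 1%E) (joinK : is_join HH HJ mH HK iH iJ)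
  (openJ : forall A : set J, open A).
Variables (mJ : {measure set (borel J) -> \bar R}) (mK : {measure set (borel K) -> \bar R}).
Hypotheses (haarJ : is_haar HJ mJ) (haarK : is_haar HK mK).
Hypothesis J2 : exists y : J, y <> hid HJ.
Let iH_inj := join_injl joinK.
Let iJ_inj := join_injr joinK.
Let V := range iH.

Let oV : open V. Proof. exact: join_range_open joinK openJ. Qed.

Let cV : compact V. Proof. exact: join_range_compact compactH joinK. Qed.

Let cases := join_cases joinK.

Let VJ y : y <> hid HJ -> ~ V (iJ y).
Proof. by move=> ye [h _ /(join_meet joinK)[_ /ye]]. Qed.

Let Ve : V (hid HK). Proof. by rewrite (join_hidl joinK); exists (hid HH). Qed.

Let Vinv x : V x -> V (hinv HK x).
Proof. by move=> [h _ <-]; rewrite (join_invl joinK); exists (hinv HH h). Qed.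

Let mV : measurable (V : set (borel K)). Proof. exact: open_borel. Qed.

Let Vconv x y : hconv HK x y V != 0%E -> y = hinv HK x \/ V x /\ V y.
Proof.
have [[h ->]|[a ae ->]] := cases x; have [[h' ->]|[b be ->]] := cases y.
- by right; split; [exists h|exists h'].
- by rewrite (join_conv3l joinK h be)// diracE memNset ?eqxx//; exact: VJ.
- by rewrite (join_conv3r joinK h' ae)// diracE memNset ?eqxx//; exact: VJ.
- move=> abV; left; rewrite (join_invr joinK); congr iJ.
  apply: contrapT => ba; have ab : a <> hinv HJ b by move=> ab; apply: ba; rewrite ab hinvK.
  move/eqP: abV; apply; rewrite (join_conv2 joinK ab)//.
  rewrite -[RHS](conv_isolated_id (openJ _) ab); congr (hconv HJ a b _).
  apply/seteqP; split => [j [h _ /(join_meet joinK)[]]//|_ ->].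
  by rewrite /= (join_id joinK); exists (hid HH).
Qed.

Lemma join_haar_point_pos y : y <> hid HJ -> (0 < mK [set iJ y])%E.
Proof. by move=> ye; apply: (haar_point_pos haarK oV cV Ve Vinv Vconv); exact: VJ. Qed.

(** A point [y] of [J] other than the identity supplies the constant of proportionality. By
    [haar_clopen_integral], [mK] on the copy of [H] is [mK [set iJ y]] times the part on [H] of the
    product of [y] with its inverse, and by [join_conv4] that part is [c] times [mH]. Here [c] is
    positive because the identity is isolated and lies in the support of that product. *)
Lemma join_haar_dominates (A : set (borel K)) : measurable A -> mK A = 0%E ->
  mH (iH @^-1` A) = 0%E.
Proof.
have [y ye] := J2; have [rK mKT _] := haarK; have [cmK orK irK] := rK.
have [[_ _ irH] _ _] := haarH.
have mHfin : (mH setT < +oo)%E by rewrite mH1 ltry.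
have by_ := VJ ye.
have mKy := join_haar_point_pos ye.
have mKyfin : mK [set iJ y] \is a fin_num.
  by rewrite ge0_fin_numE//; apply: cmK; exact: (@compact_set1 _ (iJ y)).
pose p := hconv HJ (hinv HJ y) y; pose c := fine (p [set hid HJ]).
have mJa (B : set (borel J)) : measurable B by exact: open_borel.
have cE : c%:E = p [set hid HJ] by rewrite fineK// fin_num_le_measure//; exact: probability_fin.
have c0 : 0 < c.
  by rewrite -lte_fin cE; have := @conv_inv_open_pos _ _ HJ (hinv HJ y) [set hid HJ]; rewrite hinvK; apply.
have kpos : 0 < fine (mK [set iJ y]) * c by rewrite mulr_gt0// -lte_fin fineK.
apply: (@dominated_by_haar _ _ _ mH mK iH (fine (mK [set iJ y]) * c)) => //.
- exact: hypergroup_hausdorff HH.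
- exact: join_continuousl joinK.
- exact: join_closedl joinK.
- exact: cmK.
move=> f cf.
have ef0 x : ~ V x -> extend iH 0 f x = 0.
  by move=> nx; rewrite extend_out// => h hx; apply: nx; exists h.
have cef := continuous_extend (c := 0) iH_inj (join_closedl joinK) oV cf.
rewrite (haar_clopen_integral haarK oV cV Vinv Vconv by_ cef ef0) (join_invr joinK) -mulrA.
congr (_ * _).
have [M fM] : exists M : R, forall h, `|f h| <= M.
  have := compact_bounded (continuous_compact (continuous_subspaceT cf) compactH).
  move=> [M [_ /(_ (M + 1))h]]; exists (M + 1) => x; apply: h; first by rewrite ltrDl.
  by exists x.
have efM x : `|extend iH 0 f x| <= M.
  have [[h _ <-]|nx] := pselect (V x); first by rewrite extendE.
  by rewrite ef0// normr0; exact: le_trans (normr_ge0 _) (fM point).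
have mD : measurable (~` [set hid HJ] : set (borel J)) by exact: mJa.
pose q := mrestr p mD.
have qfin : (q setT < +oo)%E.
  by rewrite /q /mrestr setTI; apply: le_lt_trans (probability_fin p); rewrite le_measure ?inE.
have := @Rintegral_mix _ _ _ _ (borel K) (borel H) (borel J) (hconv HK (iJ (hinv HJ y)) (iJ y)) mH q iH iJ c.
move=> /(_ _ _ (ltW c0) _ mHfin qfin _ M (continuous_borel cef) efM) ->.
- have -> : \int[q]_x extend iH 0 f (iJ x) = 0.
    rewrite /Rintegral; have -> : (\int[q]_x (extend iH 0 f (iJ x))%:E = \int[q]_x (cst 0 x))%E.
      apply: ae_eq_integral => //.
      exists [set hid HJ]; split => //; first by exact: mrestr_setC0.
      move=> x /= h; apply: contrapT => xe; apply: h => _.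
      by rewrite ef0//; exact: VJ.
    by rewrite integral0.
  by rewrite addr0; congr (_ * _); apply: eq_Rintegral => x _; rewrite extendE.
- by apply: continuous_borel_map; exact: join_continuousl joinK.
- by move=> _ B _; exact: mJa.
- by move=> B mB; apply: etrans (join_conv4 joinK ye mB) _; rewrite cE.
Qed.

Lemma join_amenable (alpha : J -> cplx R) : alpha (hid HJ) = 1 ->
  amenable HJ mJ alpha <-> amenable HK mK (extend iJ (1 : cplx R) alpha).
Proof.
move=> alpha_e.
have mJ_pos y : mJ [set y] <> 0%E.
  by move=> y0; have := haar_discrete_pos y haarJ (openJ _); rewrite y0 ltxx.
have mK_pos y : y <> hid HJ -> mK [set iJ y] <> 0%E.
  by move=> ye y0; have := join_haar_point_pos ye; rewrite y0 ltxx.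
split.
- exact: (amenable_join_of_discrete compactH haarH mH1 joinK openJ mK_pos join_haar_dominates).
- exact: (amenable_discrete_of_join mH1 joinK openJ mJ_pos).
Qed.

End join_first_part.

(** * The topology of the dual *)

Lemma discrete_continuous {X Y : topologicalType} (f : X -> Y) :
  (forall A : set X, open A) -> continuous f.
Proof. by move=> oX; apply/continuousP => A _; exact: oX. Qed.

Lemma cvg_cplx {R : realType} (T : Type) (F : set_system T) (FF : Filter F)
    (f : T -> cplx R) (l : cplx R) :
  (fun t => complex.Re (f t)) @ F --> complex.Re l ->
  (fun t => complex.Im (f t)) @ F --> complex.Im l -> f @ F --> l.
Proof.
move=> fr fi A /nbhs_ballP[e /= e0 eA].
have eE : e = (complex.Re e)%:C%C by rewrite RRe_real// gtr0_real.
have r0 : 0 < complex.Re e by rewrite -ltcR -eE.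
have r40 : 0 < complex.Re e / 4 by rewrite divr_gt0.
move/cvgrPdist_lt : fr => /(_ _ r40) fr; move/cvgrPdist_lt : fi => /(_ _ r40) fi.
near=> t; apply: eA; rewrite /ball /= eE.
apply: (@le_lt_trans _ _ (2 * (complex.Re e / 4))%:C%C); last by rewrite ltcR; lra.
by apply: le_cplx; rewrite ?ReB ?ImB; apply: ltW; near: t.
Unshelve. all: by end_near. Qed.

Lemma ultra_cvg (T : Type) (X : topologicalType) (F : set_system T) (f : T -> X) (C : set X) :
  UltraFilter F -> compact C -> F (f @^-1` C) -> exists a : X, f @ F --> a.
Proof.
move=> UF cC FC; have [a [Ca clA]] := cC (f @ F) _ FC.
exists a => U Ua; have [//|FU] := in_ultra_setVsetC (f @^-1` U) UF.
by have [x [nUx Ux]] := clA (~` U) U FU Ua.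
Qed.

Lemma continuous_conj {R : realType} : continuous (fun z : cplx R => z^*).
Proof.
move=> z A /nbhs_ballP[e /= e0 eA]; apply/nbhs_ballP; exists e => //= t zt.
by apply: eA; rewrite /ball /= -rmorphB norm_conjC.
Qed.

Section hermitian_characters.
Context {R : realType} {L : ptopologicalType} (HL : hypergroup R L).
Implicit Types (alpha : L -> cplx R).

(** With [s] the supremum of the absolute value of [alpha], the square of [alpha y] is the mean of
    [alpha] over the product of [y] with itself, so [s ^+ 2 <= 2 * s]. The sharp bound is [1]; the
    factor two is lost in [cintegral_le], and a bound uniform in [alpha] is what is wanted. *)
Lemma character_le2 alpha x : hermitian_character HL alpha -> `|alpha x| <= 2%:C%C.
Proof.
move=> [ca [M aM] ae am _].
have ba : bounded_borel_cfun alpha by apply: bounded_borel_continuous => //; exists M.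
pose r y := complex.Re `|alpha y|.
have rE y : `|alpha y| = (r y)%:C%C by rewrite RRe_real// normr_real.
have r0 y : 0 <= r y by rewrite -ler0c -rE.
pose s := sup (range r).
have hs : has_sup (range r).
  split; first by exists (r x); exists x.
  by exists M => _ [y _ <-]; rewrite -lecR -rE.
have rs y : r y <= s by apply: ub_le_sup; [case: hs|exists y].
have s0 : 0 <= s := le_trans (r0 x) (rs x).
have rr y : r y ^+ 2 <= 2 * s.
  rewrite -lecR rmorphXn /= -rE -normrX expr2 -am.
  have := @cintegral_le _ _ (hconv HL y y) alpha s (probability_fin _) ba s0.
  rewrite [X in fine X](probability_setT (hconv HL y y)) /= mulr1; apply.
  rewrite (_ : [set _ | _] = set0); first exact: negligible_set0.
  by rewrite -subset0 => z /=; apply; rewrite rE lecR.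
rewrite rE lecR; apply: le_trans (rs x) _; rewrite leNgt; apply/negP => s2.
have : s <= Num.sqrt (2 * s).
  apply: ge_sup; first by exists (r x); exists x.
  by move=> _ [y _ <-]; rewrite -[r y]ger0_norm// -sqrtr_sqr ler_sqrt ?mulr_ge0.
rewrite -(@ler_pXn2r _ 2) ?nnegrE ?sqrtr_ge0// sqr_sqrtr ?mulr_ge0//; nra.
Qed.

Lemma character_bounded_borel alpha : hermitian_character HL alpha -> bounded_borel_cfun alpha.
Proof. by move=> [ca aM *]; exact: bounded_borel_continuous. Qed.

End hermitian_characters.

Section dual_topology.
Context {R : realType} {L : ptopologicalType} {HL : hypergroup R L}.
Implicit Types (alpha gamma : dual HL).

Lemma dual_character gamma : hermitian_character HL gamma.
Proof. by case: gamma => a ha; exact: set_mem ha. Qed.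

Lemma dual_eq alpha gamma : (forall x, alpha x = gamma x) -> alpha = gamma.
Proof.
case: alpha gamma => [a ha] [b hb] /= ab; apply: eq_exist.
by apply/funext => x; exact: ab.
Qed.

Definition mk_dual (a : L -> cplx R) (ha : hermitian_character HL a) : dual HL :=
  exist _ a (mem_set ha).

Lemma dual_bounded_borel gamma : bounded_borel_cfun gamma.
Proof. exact: character_bounded_borel (dual_character gamma). Qed.

Lemma dual_continuous gamma : continuous gamma.
Proof. by have [] := dual_character gamma. Qed.

Lemma dual_conv gamma x y : cintegral (hconv HL x y) gamma = gamma x * gamma y.
Proof. by have [_ _ _ /(_ x y)] := dual_character gamma. Qed.

Lemma dual_id gamma : gamma (hid HL) = 1.
Proof. by have [] := dual_character gamma. Qed.

Lemma dual_inv gamma x : gamma (hinv HL x) = (gamma x)^*.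
Proof. by have [_ _ _ _] := dual_character gamma; apply. Qed.

(** On continuous functions the compact-open topology is that of uniform convergence on compact
    sets; with [nbhs_dualP] these sets form a base of neighbourhoods. *)
Lemma nbhs_dual_ball alpha (C : set L) (r : R) : compact C -> 0 < r ->
  nbhs alpha [set gamma : dual HL | forall x, C x -> `|gamma x - alpha x| < r%:C%C].
Proof.
move=> cC r0.
have cvgid : {compact-open, nbhs ((alpha : L -> cplx R) : {compact-open, L -> cplx R}) --> (alpha : L -> cplx R)} by [].
have FF := @nbhs_filter {compact-open, L -> cplx R} (alpha : L -> cplx R).
have h := (compact_open_fam_compactP (@dual_continuous alpha) FF).1 cvgid.
have E : entourage [set zw : cplx R * cplx R | `|zw.2 - zw.1| < r%:C%C].
  rewrite -entourage_ballE; exists (r%:C%C) => /=; first by rewrite ltcR.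
  by move=> [z w] /=; rewrite /ball /= distrC.
have Fb := h _ (@fam_nbhs _ _ _ _ _ (alpha : L -> cplx R) E cC).
exact: (@initial_continuous _ {compact-open, L -> cplx R} set_val alpha _ Fb).
Qed.

(** The filter generated by the uniform balls over compact sets converges to [alpha] in the
    compact-open topology, so it contains every open neighbourhood of [alpha]. *)
Lemma nbhs_dualP alpha (U : set (dual HL)) : nbhs alpha U ->
  exists C : set L, exists2 r : R, compact C /\ 0 < r &
    [set gamma : dual HL | forall x, C x -> `|gamma x - alpha x| < r%:C%C] `<=` U.
Proof.
case=> _ /= [] [W oW <- /= Wx sWU].
pose B := [set Cr : set L * R | compact Cr.1 /\ 0 < Cr.2].
pose G (Cr : set L * R) := [set g : L -> cplx R | forall x, Cr.1 x -> `|g x - alpha x| < (Cr.2)%:C%C].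
pose F := filter_from B G.
have FF : Filter F.
  apply: filter_from_filter.
    by exists (set0, 1); split => //; exact: compact0.
  move=> [C r] [C' r'] /= [/= cC r0] [/= cC' r0']; exists (C `|` C', Num.min r r').
    by split => /=; [exact: compactU|rewrite lt_min r0].
  move=> g gP; split=> x Cx; have := gP x.
    by move=> /(_ (or_introl Cx))/lt_le_trans; apply; rewrite lecR ge_min lexx.
  by move=> /(_ (or_intror Cx))/lt_le_trans; apply; rewrite lecR ge_min lexx orbT.
have : {compact-open, F --> (alpha : L -> cplx R)}.
  apply/compact_open_fam_compactP; first exact: dual_continuous.
  apply/fam_cvgP => C cC P /uniform_nbhs[E [entE EP]].
  move: entE; rewrite -entourage_ballE => -[e /= e0 eE].
  have eC : e = (complex.Re e)%:C%C by rewrite RRe_real// gtr0_real.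
  have r0 : 0 < complex.Re e by rewrite -ltcR -eC.
  exists (C, complex.Re e) => // g gP; apply: EP => y Cy; apply: eE.
  by rewrite /ball /= distrC eC; exact: gP.
move=> /(_ W) []; first exact: open_nbhs_nbhs.
move=> [C r] [/= cC r0] GW; exists C, r => // gamma gP; apply: sWU => /=.
exact: GW.
Qed.

Lemma eval_continuous (x : L) : continuous (fun gamma : dual HL => gamma x).
Proof.
move=> alpha A /nbhs_ballP[e /= e0 eA].
have eC : e = (complex.Re e)%:C%C by rewrite RRe_real// gtr0_real.
have r0 : 0 < complex.Re e by rewrite -ltcR -eC.
have := nbhs_dual_ball alpha (@compact_set1 _ x) r0; apply: filterS => gamma gP /=.
by apply: eA; rewrite /ball /= distrC eC; exact: gP.
Qed.

Lemma eval_bounded_borel (x : L) : bounded_borel_cfun (fun gamma : dual HL => gamma x).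
Proof.
apply: bounded_borel_continuous; first exact: eval_continuous.
by exists 2 => gamma; exact: character_le2 (dual_character gamma).
Qed.

End dual_topology.

Section finite_support.
Context {R : realType} {L : ptopologicalType}.
Implicit Types (mu : {measure set (borel L) -> \bar R}) (f : L -> cplx R).

Lemma bounded_borel_indic (A : set (borel L)) : measurable A ->
  bounded_borel_cfun (fun x : L => (\1_A x)%:C%C : cplx R).
Proof.
move=> mA; split; first split => /=.
- exact: measurable_indic.
- exact: measurable_cst.
exists 1 => x; rewrite indicE; case: (x \in A); first by rewrite normr1.
by rewrite normr0 lecR ler01.
Qed.

Lemma cintegral_indic mu (A : set (borel L)) : measurable A ->
  cintegral mu (fun x => (\1_A x)%:C%C : cplx R) = (fine (mu A))%:C%C.
Proof.
move=> mA; apply: cplx_eq => /=; last by rewrite /Rintegral integral0.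
by rewrite /Rintegral integral_indic// setIT.
Qed.

Lemma cintegral_sum mu (I : Type) (s : seq I) (g : I -> L -> cplx R) :
  (mu setT < +oo)%E -> (forall i, bounded_borel_cfun (g i)) ->
  bounded_borel_cfun (fun x => \sum_(i <- s) g i x) /\
  cintegral mu (fun x => \sum_(i <- s) g i x) = \sum_(i <- s) cintegral mu (g i).
Proof.
move=> mufin bg; elim: s => [|i s [IH1 IH2]].
  have -> : (fun x => \sum_(i <- [::]) g i x) = (fun=> 0) by apply/funext => x; rewrite big_nil.
  by rewrite big_nil cintegral_cst mulr0; split => //; exact: bounded_borel_cst.
have -> : (fun x => \sum_(j <- i :: s) g j x) = (fun x => g i x + \sum_(j <- s) g j x).
  by apply/funext => x; rewrite big_cons.
by rewrite big_cons cintegralD// IH2; split => //; exact: bounded_borelD.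
Qed.

Lemma cintegral_finite mu (s : seq L) f : hausdorff_space L -> (mu setT < +oo)%E ->
  uniq s -> mu (~` [set` s]) = 0%E -> bounded_borel_cfun f ->
  cintegral mu f = \sum_(w <- s) (fine (mu [set w]))%:C%C * f w.
Proof.
move=> hL mufin us mus bf.
have m1 (w : L) : measurable ([set w] : set (borel L)).
  by apply: closed_borel; apply: compact_closed => //; exact: compact_set1.
pose g (w x : L) : cplx R := f w * (\1_[set w] x)%:C%C.
have bg w : bounded_borel_cfun (g w) by apply/bounded_borelZ/bounded_borel_indic.
have [b1 b2] := cintegral_sum s mufin bg.
transitivity (cintegral mu (fun x => \sum_(w <- s) g w x)).
  apply: (cintegral_ae_eq _ mus) => //.
    apply: measurableC; rewrite (_ : [set` s] = \big[setU/set0]_(w <- s) [set w]).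
      by apply: bigsetU_measurable => w _; exact: m1.
    by rewrite -bigcup_seq; apply/seteqP; split => [x xs|x [w /= ws ->]//]; exists x.
  move=> x /contrapT /= xs; rewrite (bigD1_seq x)//= /g indicE mem_set// mulr1.
  rewrite big1 ?addr0// => w wx; rewrite indicE memNset ?mulr0//=.
  by move=> xw; rewrite xw eqxx in wx.
rewrite b2; apply: eq_bigr => w _; rewrite cintegralZ//; last exact: bounded_borel_indic.
by rewrite cintegral_indic// mulrC.
Qed.

Lemma compact_discrete_seq (C : set L) : (forall A : set L, open A) -> compact C ->
  exists2 s : seq L, uniq s & C = [set` s].
Proof.
move=> oL; rewrite compact_cover => /(_ _ C (fun x => [set x]))[|x Cx|D DC CD].
- by move=> x _; exact: oL.
- by exists x.
exists (undup (finmap.enum_fset D)); first exact: undup_uniq.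
apply/seteqP; split => x /=; rewrite mem_undup; first by move=> /CD[y yD /= ->].
by move=> /DC; rewrite inE.
Qed.

End finite_support.

Section conv_support.
Context {R : realType} {L : ptopologicalType} (HL : hypergroup R L).

(** Each point off the support has a null open neighbourhood; inner regularity turns this into
    nullity of the whole open complement. *)
Lemma conv_suppC x y : hconv HL x y (~` supp (hconv HL x y)) = 0%E.
Proof.
have null z : (~` supp (hconv HL x y)) z ->
    exists U : set L, [/\ open U, U z & hconv HL x y U = 0%E].
  move=> nz; apply: contrapT => nU; apply: nz => U oU Uz.
  rewrite lt0e measure_ge0 andbT; apply/negP => /eqP U0; apply: nU.
  by exists U.
have oS : open (~` supp (hconv HL x y)).
  apply: open_near => z /null[U [oU Uz U0]].
  have : nbhs z U by exact: open_nbhs_nbhs.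
  by apply: filterS => t Ut /(_ U oU Ut); rewrite U0 ltxx.
have [_ _ ir] := conv_radon HL x y.
apply/eqP; rewrite -measure_le0; apply: (eq_ind_r (fun z => z <= 0)%E _ (ir _ oS)).
apply: ge_ereal_sup => _ [C [cC CS] <-].
rewrite (compact_locally_null (hypergroup_hausdorff HL) cC)// => z Cz.
by apply: null; exact: CS.
Qed.

Lemma conv_finite_support x y : (forall A : set L, open A) ->
  exists2 s : seq L, uniq s & hconv HL x y (~` [set` s]) = 0%E.
Proof.
move=> oL; have [s us sE] := compact_discrete_seq oL (@conv_compact_supp _ _ HL x y).
by exists s => //; rewrite -sE conv_suppC.
Qed.

End conv_support.

Section dual_of_discrete.
Context {R : realType} {L : ptopologicalType} (HL : hypergroup R L).
Hypothesis oL : forall A : set L, open A.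

(** An ultrafilter of characters converges pointwise, the values staying in a compact square. The
    limit is multiplicative because products of points are finitely supported, and convergence is
    uniform on compact sets because these are finite. *)
Lemma dual_discrete_compact : compact [set: dual HL].
Proof.
rewrite compact_ultra => F UF _.
have le2 (gamma : dual HL) x := cplx_le (character_le2 x (dual_character gamma)).
have in2 (r : R) : `|r| <= 2 -> r \in `[(-2), 2] by rewrite ler_norml in_itv.
have /choice[a aP] x : exists z : cplx R, (fun gamma : dual HL => gamma x) @ F --> z.
  have c2 := @segment_compact R (-2) 2.
  have [|b bP] := @ultra_cvg _ _ F (fun gamma : dual HL => complex.Re (gamma x)) _ UF c2.
    by apply: filterE => gamma /=; apply: in2; have [] := le2 gamma x.
  have [|c cP] := @ultra_cvg _ _ F (fun gamma : dual HL => complex.Im (gamma x)) _ UF c2.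
    by apply: filterE => gamma /=; apply: in2; have [] := le2 gamma x.
  by exists (Complex b c); exact: cvg_cplx.
have near_a x (e : R[i]) : 0 < e -> F [set gamma : dual HL | `|gamma x - a x| < e].
  move=> e0; have h : F [set gamma : dual HL | ball (a x) e (gamma x)].
    exact: (aP x _ (@nbhsx_ballx _ (cplx R) (a x) _ e0)).
  by apply: filterS h => gamma; rewrite /ball /= distrC.
have hC : hausdorff_space (cplx R) by exact: norm_hausdorff.
have ha : hermitian_character HL a.
  have a3 x : `|a x| <= 3%:C%C.
    have [gamma ag] : exists gamma : dual HL, `|a x - gamma x| < 1.
      have [gamma] := filter_ex (near_a x _ ltr01).
      by rewrite /= distrC; exists gamma.
    rewrite -[a x](subrK (gamma x)); apply: le_trans (ler_normD _ _) _.
    have -> : (3%:C = 1 + 2%:C :> R[i])%C by rewrite -rmorphD/=; congr (_%:C)%C; lra.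
    by apply: lerD; [exact: ltW|exact: character_le2 (dual_character gamma)].
  have ba : bounded_borel_cfun a.
    by apply: bounded_borel_continuous; [exact: discrete_continuous|exists 3].
  split.
  - exact: discrete_continuous.
  - by exists 3.
  - apply: (@cvg_unique _ hC ((fun gamma : dual HL => gamma (hid HL)) @ F)); first exact: aP.
    rewrite (_ : (fun gamma : dual HL => _) = (fun=> 1)); first exact: cvg_cst.
    by apply/funext => gamma; exact: dual_id.
  - move=> x y; have [s us s0] := conv_finite_support HL x y oL.
    have hL := hypergroup_hausdorff HL.
    apply: (@cvg_unique _ hC ((fun gamma : dual HL => gamma x * gamma y) @ F)); last first.
      exact: cvgM (aP x) (aP y).
    rewrite (cintegral_finite hL (probability_fin _) us s0 ba).
    have -> : (fun gamma : dual HL => gamma x * gamma y) =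
        (fun gamma : dual HL => \sum_(w <- s) (fine (hconv HL x y [set w]))%:C%C * gamma w).
      apply/funext => gamma; rewrite -dual_conv.
      exact: cintegral_finite hL (probability_fin _) us s0 (dual_bounded_borel gamma).
    apply: cvg_big => [|w _]; first exact: add_continuous.
     apply: cvgM; [exact: cvg_cst|exact: aP].
  - move=> x; apply: (@cvg_unique _ hC ((fun gamma : dual HL => gamma (hinv HL x)) @ F)); first exact: aP.
    rewrite (_ : (fun gamma : dual HL => _) = (fun gamma : dual HL => (gamma x)^*)); last first.
      by apply/funext => gamma; exact: dual_inv.
    by apply: (@continuous_cvg _ _ _ F _ (fun gamma : dual HL => gamma x) (fun z : cplx R => z^*)); [exact: continuous_conj|exact: aP].
exists (mk_dual ha); split => // U /nbhs_dualP[C [r [cC r0] CU]].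
have [s us sE] := compact_discrete_seq oL cC.
rewrite nbhs_filterE; apply: filterS CU _; rewrite sE.
elim: s {us sE} => [|x s IH]; first by apply: filterE => gamma y.
have hx : F [set gamma : dual HL | `|gamma x - a x| < r%:C%C].
  by apply: near_a; rewrite ltcR.
apply: filterS2 hx IH => gamma h1 h2 y /=; rewrite inE => /predU1P[->//|ys].
exact: h2.
Qed.

End dual_of_discrete.

(** * The dual of a compact hypergroup *)

Lemma continuous_pairl {X Y : topologicalType} (x : X) : continuous (fun y : Y => (x, y)).
Proof. by move=> y; apply: cvg_pair => //; exact: cvg_cst. Qed.

Section dual_of_compact.
Context {R : realType} {L : ptopologicalType} (HL : hypergroup R L).
Variable m : {measure set (borel L) -> \bar R}.
Hypotheses (cL : compact [set: L]) (haarm : is_haar HL m) (m1 : m setT = 1%E).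
Let mfin : (m setT < +oo)%E. Proof. by rewrite m1 ltry. Qed.

(** Invariance under translation by [x] multiplies the integral of [gamma] by [gamma x], and some
    [gamma x] differs from [1]. *)
Lemma cintegral_nontrivial_character (gamma : dual HL) : gamma <> dual1 HL -> cintegral m gamma = 0.
Proof.
move=> g1; have [x gx] : exists x, gamma x <> 1.
  by apply: contrapT => nx; apply: g1; apply: dual_eq => x; apply: contrapT => gx; apply: nx; exists x.
have := cintegral_haar cL haarm m1 x (dual_bounded_borel gamma).
rewrite (eq_cintegral _ (dual_conv gamma x)) cintegralZ//; last exact: dual_bounded_borel.
move=> /eqP; rewrite -subr_eq0 -{2}[cintegral m gamma]mul1r -mulrBl mulf_eq0 subr_eq0.
by move=> /orP[/eqP//|/eqP].
Qed.

Lemma cintegral_trivial_character : cintegral m (dual1 HL) = 1.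
Proof. by rewrite (cintegral_cst m 1) [X in fine X]m1 mulr1. Qed.

(** A character uniformly within [4^-1] of [1] differs from it in mean by at most one half, given
    the factor two of [cintegral_le], whereas a nontrivial character has mean [0]. *)
Lemma dual1_open : open [set dual1 HL].
Proof.
apply: open_near => _ ->.
have r0 : 0 < 4^-1 :> R by rewrite invr_gt0.
apply: filterS (nbhs_dual_ball (dual1 HL) cL r0) => gamma gP /=.
apply: contrapT => /cintegral_nontrivial_character g0.
have b1 : bounded_borel_cfun (fun x => gamma x + -1).
  by apply: bounded_borelD; [exact: dual_bounded_borel|exact: bounded_borel_cst].
have : `|cintegral m (fun x => gamma x + -1)| <= (2 * (4^-1 * fine (m setT)))%:C%C.
  apply: (cintegral_le mfin b1 (ltW r0)).
  rewrite (_ : [set _ | _] = set0); first exact: negligible_set0.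
  by rewrite -subset0 => x /=; apply; exact: ltW (gP x I).
rewrite cintegralD//; [|exact: dual_bounded_borel|exact: bounded_borel_cst].
rewrite g0 add0r cintegral_cst [X in fine X]m1 mul1r normrN1.
rewrite mulr1 (lecR 1); lra.
Qed.

Variables (DL : hypergroup R (dual HL)).
Hypothesis dualD : is_dual_hypergroup DL.

Lemma hid_dual : hid DL = dual1 HL.
Proof. by have [_ _ h] := dualD; apply: dual_eq => x; exact: h. Qed.

Lemma hinv_dual (gamma : dual HL) x : (hinv DL gamma : dual HL) x = (gamma x)^*.
Proof. by have [_ h _] := dualD; exact: h. Qed.

(** Continuity of supports spreads openness from the trivial character to every [gamma]: the support
    of the product of [hinv DL gamma] with [z] contains the identity exactly when [z = gamma], and
    meeting an open set is an open condition on [z]. *)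
Lemma dual_compact_discrete (A : set (dual HL)) : open A.
Proof.
have open1 (gamma : dual HL) : open [set gamma].
  have oT := @conv_supp_continuous _ _ DL [set dual1 HL] setT dual1_open (@openT _).
  rewrite (_ : [set gamma] = (fun z => (hinv DL gamma, z)) @^-1`
    [set z : dual HL * dual HL | supp (hconv DL z.1 z.2) `&` [set dual1 HL] !=set0 /\
                          supp (hconv DL z.1 z.2) `<=` setT]).
    by apply: open_comp oT => z _; exact: continuous_pairl.
  apply/seteqP; split => [_ ->|z /= [[w [+ w1]] _]] /=.
    by split => //; exists (dual1 HL); split => //; rewrite -hid_dual; apply/hid_supp; rewrite hinvK.
  by rewrite w1 -hid_dual => /hid_supp; rewrite hinvK.
rewrite (_ : A = \bigcup_(x in A) [set x]); first exact: bigcup_open.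
by apply/seteqP; split => [x Ax|x [y Ay ->]//]; exists x.
Qed.

(** The product of [gamma] with the conjugate of [gamma'] is a finite combination of characters,
    weighted by their convolution in the dual; integration keeps only the weight of the trivial
    character. *)
Lemma character_orthogonal (gamma gamma' : dual HL) :
  cintegral m (fun x => gamma x * (gamma' x)^*) =
  (fine (hconv DL gamma (hinv DL gamma') [set dual1 HL]))%:C%C.
Proof.
have hD := hypergroup_hausdorff DL; have [hc _ _] := dualD.
have [s us s0] := conv_finite_support DL gamma (hinv DL gamma') dual_compact_discrete.
set p := hconv DL _ _ in s0 *; pose c w := (fine (p [set w]))%:C%C : cplx R.
have E x : gamma x * (gamma' x)^* = \sum_(w <- s) c w * (w : dual HL) x.
  rewrite -hinv_dual -hc; apply: cintegral_finite => //; first exact: probability_fin.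
  exact: eval_bounded_borel.
rewrite (eq_cintegral _ E).
have [_ ->] := cintegral_sum (g := fun w x => c w * (w : dual HL) x) s mfin
  (fun w => bounded_borelZ (c w) (dual_bounded_borel w)).
have I w : cintegral m (fun x => c w * (w : dual HL) x) = if w == dual1 HL then c w else 0.
  rewrite cintegralZ//; last exact: dual_bounded_borel.
  case: eqP => [->|/cintegral_nontrivial_character ->]; last by rewrite mulr0.
  by rewrite cintegral_trivial_character mulr1.
under eq_bigr do rewrite I.
have [s1|ns1] := boolP (dual1 HL \in s).
  by rewrite (bigD1_seq (dual1 HL))//= eqxx big1 ?addr0// => w /negbTE ->.
rewrite big1_seq; last by move=> w /= ws; case: eqP => // w1; rewrite -w1 ws in ns1.
have -> : p [set dual1 HL] = 0%E.
  apply: subset_measure0 s0; [exact: open_borel (dual_compact_discrete _)..|].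
  by move=> _ -> /=; apply/negP.
by [].
Qed.

Lemma character_orthogonal_neq (gamma gamma' : dual HL) : gamma <> gamma' ->
  cintegral m (fun x => gamma x * (gamma' x)^*) = 0.
Proof.
move=> gg; rewrite character_orthogonal -hid_dual conv_isolated_id//.
  by rewrite hid_dual; exact: dual1_open.
by rewrite hinvK.
Qed.

Lemma character_orthogonal_eq (gamma : dual HL) :
  cintegral m (fun x => gamma x * (gamma x)^*) != 0.
Proof.
rewrite character_orthogonal -hid_dual.
have := @conv_inv_open_pos _ _ DL gamma _ (dual_compact_discrete [set hid DL]) erefl.
rewrite -(@fineK _ (hconv _ _ _ _)); last first.
  by apply: fin_num_le_measure; [exact: probability_fin|exact: open_borel (dual_compact_discrete _)].
by rewrite lte_fin => /lt0r_neq0 h; apply/eqP => -[/eqP]; rewrite (negbTE h).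
Qed.

(** Integrating the common transform against the conjugate of a character [g] isolates the mass at
    [g], times a nonzero constant that depends on [g] alone. *)
Lemma finite_dual_measure_unique (mu nu : {measure set (borel (dual HL)) -> \bar R})
    (s t : seq (dual HL)) : (mu setT < +oo)%E -> (nu setT < +oo)%E ->
  mu (~` [set` s]) = 0%E -> nu (~` [set` t]) = 0%E ->
  (forall x, cintegral mu (fun gamma : dual HL => gamma x) =
             cintegral nu (fun gamma : dual HL => gamma x)) ->
  forall A, mu A = nu A.
Proof.
move=> mufin nufin mus nut tr A.
have mb (B : set (borel (dual HL))) : measurable B by exact: open_borel (dual_compact_discrete _).
have hD := hypergroup_hausdorff DL.
pose u := undup (s ++ t); have uu : uniq u := undup_uniq _.
have muu : mu (~` [set` u]) = 0%E.
  apply: subset_measure0 mus => // x /=; rewrite mem_undup mem_cat => nu_ xs.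
  by apply: nu_; rewrite xs.
have nuu : nu (~` [set` u]) = 0%E.
  apply: subset_measure0 nut => // x /=; rewrite mem_undup mem_cat => nu_ xs.
  by apply: nu_; rewrite xs orbT.
have key (k : {measure set (borel (dual HL)) -> \bar R}) (g : dual HL) : (k setT < +oo)%E ->
    k (~` [set` u]) = 0%E -> g \in u ->
    cintegral m (fun x => cintegral k (fun gamma : dual HL => gamma x) * ((g : dual HL) x)^*) =
    (fine (k [set g]))%:C%C * cintegral m (fun x => g x * (g x)^*).
  move=> kfin ku gu.
  have E x : cintegral k (fun gamma : dual HL => gamma x) * (g x)^* =
      \sum_(w <- u) (fine (k [set w]))%:C%C * ((w : dual HL) x * (g x)^*).
    rewrite (cintegral_finite hD kfin uu ku (eval_bounded_borel x)) mulr_suml.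
    by apply: eq_bigr => w _; rewrite mulrA.
  have bw w : bounded_borel_cfun (fun x => (w : dual HL) x * (g x)^*).
    apply: bounded_borelM; first exact: dual_bounded_borel.
    by apply: bounded_borel_conj; exact: dual_bounded_borel.
  rewrite (eq_cintegral _ E).
  have [_ ->] := cintegral_sum (g := fun w x => (fine (k [set w]))%:C%C * ((w : dual HL) x * (g x)^*)) u mfin
    (fun w => bounded_borelZ _ (bw w)).
  rewrite (bigD1_seq g)//= big1 ?addr0; first by rewrite cintegralZ.
  by move=> w /eqP wg; rewrite cintegralZ// character_orthogonal_neq// mulr0.
have mass (g : dual HL) : g \in u -> fine (mu [set g]) = fine (nu [set g]).
  move=> gu; have := key mu g mufin muu gu.
  have -> : (fun x => cintegral mu (fun gamma : dual HL => gamma x) * (g x)^*) =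
      (fun x => cintegral nu (fun gamma : dual HL => gamma x) * (g x)^*).
    by apply/funext => x; rewrite tr.
  by rewrite (key nu g nufin nuu gu) => /(mulIf (character_orthogonal_eq g)) [].
have : cintegral mu (fun x => (\1_A x)%:C%C : cplx R) = cintegral nu (fun x => (\1_A x)%:C%C : cplx R).
  rewrite !(cintegral_finite hD _ uu)//; try exact: bounded_borel_indic.
  by apply: eq_big_seq => w wu; rewrite mass.
rewrite !cintegral_indic// => -[] E.
by rewrite -[LHS]fineK ?E ?fineK//; apply: fin_num_le_measure.
Qed.

End dual_of_compact.

(** * Uniqueness of measures on the dual of a discrete hypergroup *)

Section step_polynomial.
Context {R : realType}.
Implicit Types (s t : R).

Lemma bernoulli_ge s n : 0 <= s -> 1 + n%:R * s <= (1 + s) ^+ n.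
Proof.
move=> s0; elim: n => [|n IH]; first by rewrite mul0r addr0 expr0.
rewrite exprS; apply: (@le_trans _ _ ((1 + s) * (1 + n%:R * s))).
  have n0 : 0 <= n%:R * s ^+ 2 by rewrite mulr_ge0 ?sqr_ge0.
  rewrite -natr1; nra.
by rewrite ler_wpM2l// addr_ge0.
Qed.

Lemma bernoulli_le s n : 0 <= s <= 1 -> 1 - n%:R * s <= (1 - s) ^+ n.
Proof.
move=> /andP[s0 s1]; elim: n => [|n IH]; first by rewrite mul0r subr0 expr0.
rewrite exprS; apply: (@le_trans _ _ ((1 - s) * (1 - n%:R * s))).
  have n0 : 0 <= n%:R * s ^+ 2 by rewrite mulr_ge0 ?sqr_ge0.
  rewrite -natr1; nra.
by rewrite ler_wpM2l// subr_ge0.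
Qed.

(* The polynomial 1 - (1 - t^n)^(2^n) of Brosowski and Deutsch. *)
Lemma step_polynomial (eta e : R) : 0 < eta -> 0 < e -> exists n : nat,
  forall t, 0 <= t <= 1 -> let q := 1 - (1 - t ^+ n) ^+ (2 ^ n) in
  [/\ 0 <= q <= 1, 2^-1 + eta <= t -> 1 - e <= q & t <= 2^-1 - eta -> q <= e].
Proof.
move=> eta0 e0; pose n := (Num.truncn (2 * eta * e)^-1).+1.
have ee0 : 0 < 2 * eta * e by rewrite !mulr_gt0.
have ne : 1 <= n%:R * (2 * eta * e).
  rewrite -ler_pdivrMr// mul1r ltW//; exact: truncnS_gt.
exists n => t /andP[t0 t1] q.
have tn0 : 0 <= t ^+ n by rewrite exprn_ge0.
have tn1 : t ^+ n <= 1 by rewrite exprn_ile1.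
have N0 : 0 <= (1 - t ^+ n) ^+ (2 ^ n) by rewrite exprn_ge0// subr_ge0.
have N1 : (1 - t ^+ n) ^+ (2 ^ n) <= 1 by rewrite exprn_ile1 ?subr_ge0// gerBl.
(* The exponents [n] and [2 ^ n] combine into powers of [2 * t], which lies above or below [1] by at
   least [2 * eta]. Bernoulli's inequality then bounds the error on either side by the inverse of
   [n%:R * (2 * eta)], and [n] is chosen to bring this below [e]. *)
have nat2 : (2 ^ n)%:R * t ^+ n = (2 * t) ^+ n by rewrite natrX exprMn.
have e2 : 0 <= 2 * eta by rewrite mulr_ge0// ltW.
split.
- by rewrite /q; apply/andP; split; lra.
- move=> ht; have h1 : (1 - t ^+ n) ^+ (2 ^ n) * (1 + (2 * t) ^+ n) <= 1.
    apply: (@le_trans _ _ ((1 - t ^+ n) ^+ (2 ^ n) * (1 + t ^+ n) ^+ (2 ^ n))).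
      by rewrite ler_wpM2l// -nat2; exact: bernoulli_ge.
    rewrite -exprMn exprn_ile1//; nra.
  have h2 : 1 + n%:R * (2 * eta) <= (2 * t) ^+ n.
    apply: le_trans (bernoulli_ge n e2) _.
    by rewrite lerXn2r ?nnegrE; lra.
  rewrite /q; set N := (1 - _) ^+ _ in h1 N0 N1 *.
  have : N * (n%:R * (2 * eta)) <= 1 by apply: le_trans h1; rewrite ler_wpM2l//; lra.
  have n0 : 0 < n%:R * (2 * eta) by rewrite mulr_gt0 ?ltr0n// mulr_gt0.
  by move=> hN; rewrite lerD2l lerN2 -(ler_pM2r n0); lra.
- move=> ht; have h1 : q <= (2 * t) ^+ n.
    rewrite /q -nat2; have := @bernoulli_le (t ^+ n) (2 ^ n); rewrite tn0 tn1 => /(_ isT); lra.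
  apply: (le_trans h1).
  have h2 : (2 * t) ^+ n * (1 + n%:R * (2 * eta)) <= 1.
    apply: (@le_trans _ _ ((2 * t) ^+ n * (1 + 2 * eta) ^+ n)).
      by rewrite ler_wpM2l ?exprn_ge0 ?mulr_ge0//; exact: bernoulli_ge.
    rewrite -exprMn exprn_ile1//; first by rewrite !mulr_ge0 ?addr_ge0.
    nra.
  have u0 : 0 <= (2 * t) ^+ n by rewrite exprn_ge0// mulr_ge0.
  move: u0 h2; set u := (2 * t) ^+ n => u0 h2.
  have n0 : 0 < n%:R * (2 * eta) by rewrite mulr_gt0 ?ltr0n// mulr_gt0.
  have : u * (n%:R * (2 * eta)) <= 1 by apply: le_trans h2; rewrite ler_wpM2l//; lra.
  by move=> hu; rewrite -(ler_pM2r n0); lra.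
Qed.

End step_polynomial.

(** * Trigonometric polynomials on the dual and Stone-Weierstrass separation *)

Section trigonometric_polynomials.
Context {R : realType} {L : ptopologicalType} (HL : hypergroup R L).
Hypothesis oL : forall A : set L, open A.
Implicit Types F G : dual HL -> cplx R.

(** These are the Fourier transforms of finitely supported complex measures on [L]; two finite
    measures on the dual with the same transform integrate them alike. *)
Inductive trig_poly : (dual HL -> cplx R) -> Prop :=
| trig_eval (c : cplx R) (x : L) : trig_poly (fun gamma => c * gamma x)
| trig_add F G : trig_poly F -> trig_poly G -> trig_poly (fun gamma => F gamma + G gamma).

Lemma trig_cst (c : cplx R) : trig_poly (fun=> c).
Proof.
rewrite (_ : (fun=> c) = (fun gamma : dual HL => c * gamma (hid HL))); first exact: trig_eval.
by apply/funext => gamma; rewrite dual_id mulr1.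
Qed.

Lemma trig_sum (I : Type) (s : seq I) (F : I -> dual HL -> cplx R) :
  (forall i, trig_poly (F i)) -> trig_poly (fun gamma => \sum_(i <- s) F i gamma).
Proof.
move=> tF; elim: s => [|i s IH].
  by under eq_fun do rewrite big_nil; exact: trig_cst.
by under eq_fun do rewrite big_cons; exact: trig_add.
Qed.

(** The values of a character at [x] and [y] multiply to its mean over the product of [x] and [y], a
    finite sum of evaluations because [L] is discrete. *)
Lemma trig_mul F G : trig_poly F -> trig_poly G -> trig_poly (fun gamma => F gamma * G gamma).
Proof.
move=> tF; elim: tF G => {F} [c x|F1 F2 _ IH1 _ IH2] G tG; last first.
  by under eq_fun do rewrite mulrDl; apply: trig_add; [exact: IH1|exact: IH2].
elim: tG => {G} [d y|G1 G2 _ IH1 _ IH2]; last first.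
  by under eq_fun do rewrite mulrDr; exact: trig_add.
have [s us s0] := conv_finite_support HL x y oL.
rewrite (_ : (fun _ => _) = (fun gamma : dual HL =>
    \sum_(w <- s) (c * d * (fine (hconv HL x y [set w]))%:C%C) * gamma w)).
  by apply: trig_sum => w; exact: trig_eval.
apply/funext => gamma; rewrite mulrACA -dual_conv.
rewrite (cintegral_finite (hypergroup_hausdorff HL) (probability_fin _) us s0 (dual_bounded_borel gamma)).
by rewrite mulr_sumr; apply: eq_bigr => w _; rewrite mulrA.
Qed.

Lemma trig_conj F : trig_poly F -> trig_poly (fun gamma => (F gamma)^*).
Proof.
elim=> {F} [c x|F G _ tF _ tG].
  rewrite (_ : (fun _ => _) = (fun gamma : dual HL => c^* * gamma (hinv HL x))).
    exact: trig_eval.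
  by apply/funext => gamma; rewrite rmorphM dual_inv.
by under eq_fun do rewrite rmorphD; exact: trig_add.
Qed.

Lemma trig_continuous F : trig_poly F -> continuous F.
Proof.
elim=> {F} [c x|F G _ cF _ cG] gamma.
  exact: cvgM (cvg_cst c) (@eval_continuous _ _ _ x gamma).
exact: cvgD (cF gamma) (cG gamma).
Qed.

Lemma trig_bounded_borel F : trig_poly F -> bounded_borel_cfun F.
Proof.
elim=> {F} [c x|F G _ bF _ bG]; last exact: bounded_borelD.
by apply: bounded_borelZ; exact: eval_bounded_borel.
Qed.

Lemma trig_cintegral (mu nu : {measure set (borel (dual HL)) -> \bar R}) F :
  (mu setT < +oo)%E -> (nu setT < +oo)%E ->
  (forall x, cintegral mu (fun gamma : dual HL => gamma x) =
             cintegral nu (fun gamma : dual HL => gamma x)) ->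
  trig_poly F -> cintegral mu F = cintegral nu F.
Proof.
move=> mufin nufin tr; elim=> {F} [c x|F G tF IF tG IG].
  by rewrite !cintegralZ//; try exact: eval_bounded_borel; rewrite tr.
by rewrite !cintegralD ?IF ?IG//; exact: trig_bounded_borel.
Qed.

Definition real_trig (f : dual HL -> R) := trig_poly (fun gamma => (f gamma)%:C%C).

Lemma real_trig_cst (a : R) : real_trig (fun=> a).
Proof. exact: trig_cst. Qed.

Lemma real_trigD f g : real_trig f -> real_trig g -> real_trig (fun gamma => f gamma + g gamma).
Proof. by rewrite /real_trig => tf tg; under eq_fun do rewrite rmorphD; exact: trig_add. Qed.

Lemma real_trigM f g : real_trig f -> real_trig g -> real_trig (fun gamma => f gamma * g gamma).
Proof. by rewrite /real_trig => tf tg; under eq_fun do rewrite rmorphM; exact: trig_mul. Qed.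

Lemma real_trigB f g : real_trig f -> real_trig g -> real_trig (fun gamma => f gamma - g gamma).
Proof.
move=> tf tg; under eq_fun do rewrite -mulN1r.
by apply: real_trigD tf _; apply: real_trigM tg; exact: real_trig_cst.
Qed.

Lemma real_trigX f n : real_trig f -> real_trig (fun gamma => f gamma ^+ n).
Proof.
move=> tf; elim: n => [|n IH]; first by under eq_fun do rewrite expr0; exact: real_trig_cst.
by under eq_fun do rewrite exprS; exact: real_trigM.
Qed.

Lemma real_trig_sum (I : Type) (s : seq I) (f : I -> dual HL -> R) :
  (forall i, real_trig (f i)) -> real_trig (fun gamma => \sum_(i <- s) f i gamma).
Proof.
move=> tf; elim: s => [|i s IH]; first by under eq_fun do rewrite big_nil; exact: real_trig_cst.
by under eq_fun do rewrite big_cons; exact: real_trigD.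
Qed.

Definition sqr_norm (z : cplx R) : R := complex.Re z ^+ 2 + complex.Im z ^+ 2.

Lemma mulr_conj_sqr_norm (z : cplx R) : z * z^* = (sqr_norm z)%:C%C.
Proof.
apply: cplx_eq; rewrite ?ReM ?ImM; case: z => a b; first by rewrite /sqr_norm /= mulrN opprK !expr2.
by rewrite /= mulrN mulrC addNr.
Qed.

Lemma real_trig_sqr_norm (x : L) (z : cplx R) :
  real_trig (fun gamma : dual HL => sqr_norm (gamma x - z)).
Proof.
have tx : trig_poly (fun gamma : dual HL => gamma x - z).
  apply: trig_add; last exact: trig_cst.
  rewrite (_ : (fun _ => _) = (fun gamma : dual HL => 1 * gamma x)); first exact: trig_eval.
  by apply/funext => gamma; rewrite mul1r.
rewrite /real_trig (_ : (fun _ => _) = (fun gamma : dual HL => (gamma x - z) * (gamma x - z)^*)).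
  by apply: trig_mul => //; exact: trig_conj.
by apply/funext => gamma; rewrite mulr_conj_sqr_norm.
Qed.

Lemma real_trig_continuous f : real_trig f -> continuous f.
Proof.
move=> /trig_continuous cf gamma.
by apply: (@continuous_comp _ _ _ (fun gamma => (f gamma)%:C%C : cplx R) (fun z : cplx R => complex.Re z));
  [exact: cf|exact: continuous_Re].
Qed.

(** A Urysohn function up to error [e]. Keeping the values in the unit interval lets such functions
    be multiplied and compared with indicators under any finite measure. *)
Definition trig_separated (C U : set (dual HL)) := forall e : R, 0 < e ->
  exists f : dual HL -> R, [/\ real_trig f, forall gamma, 0 <= f gamma <= 1,
    forall gamma, C gamma -> 1 - e <= f gamma & forall gamma, ~ U gamma -> f gamma <= e].

Lemma trig_separatedU C D U : trig_separated C U -> trig_separated D U ->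
  trig_separated (C `|` D) U.
Proof.
move=> sC sD e e0; have e20 : 0 < e / 2 by rewrite divr_gt0.
have [f [tf f01 f1 f0]] := sC _ e20; have [g [tg g01 g1 g0]] := sD _ e20.
(* The product of the complements is small as soon as one factor is, and off [U] the two errors of
   [e / 2] add up. *)
exists (fun gamma => 1 - (1 - f gamma) * (1 - g gamma)); split.
- apply: real_trigB; first exact: real_trig_cst.
  by apply: real_trigM; apply: real_trigB => //; exact: real_trig_cst.
- by move=> gamma; case/andP: (f01 gamma) (g01 gamma) => ? ? /andP[? ?]; apply/andP; split; nra.
- move=> gamma Cg; case/andP: (f01 gamma) (g01 gamma) => ? ? /andP[? ?].
  by case: Cg => [/f1|/g1] ?; nra.
- move=> gamma Ug; case/andP: (f01 gamma) (g01 gamma) => ? ? /andP[? ?].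
  by have := f0 _ Ug; have := g0 _ Ug => ? ?; nra.
Qed.

Lemma sqr_norm_le (z : cplx R) (M : R) : `|z| <= M%:C%C -> sqr_norm z <= 2 * M ^+ 2.
Proof.
move=> /cplx_le[]; rewrite !ler_norml => /andP[? ?] /andP[? ?]; rewrite /sqr_norm; nra.
Qed.

Lemma sqr_norm_ge (z : cplx R) (r : R) : 0 < r -> ~ `|z| < r%:C%C -> r ^+ 2 <= 4 * sqr_norm z.
Proof.
move=> r0 zr; rewrite leNgt; apply/negP => h; apply: zr.
apply: (@le_lt_trans _ _ (2 * Num.sqrt (sqr_norm z))%:C%C).
  apply: le_cplx; rewrite -sqrtr_sqr ler_wsqrtr// /sqr_norm; [rewrite lerDl|rewrite lerDr]; exact: sqr_ge0.
rewrite ltcR -(ltr_pXn2r (_ : (0 < 2)%N)) ?nnegrE ?mulr_ge0 ?sqrtr_ge0 ?(ltW r0)//.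
by rewrite exprMn sqr_sqrtr ?addr_ge0 ?sqr_ge0//; lra.
Qed.

(** The sum [g] of squared distances over a finite set vanishes at [alpha] and stays away from zero
    off [U]. An affine change of [g] takes values in the unit interval, above one half near [alpha]
    and below it off [U], with a gap that [step_polynomial] widens to almost [1] and almost [0]. *)
Lemma trig_separated_point (alpha : dual HL) (U : set (dual HL)) : nbhs alpha U ->
  exists N : set (dual HL), [/\ open N, N alpha & trig_separated N U].
Proof.
move=> /nbhs_dualP[C [r [cC r0] CU]].
have [s us sE] := compact_discrete_seq oL cC.
pose g (gamma : dual HL) := \sum_(x <- s) sqr_norm (gamma x - alpha x).
have tg : real_trig g by apply: real_trig_sum => x; exact: real_trig_sqr_norm.
have sq0 (z : cplx R) : 0 <= sqr_norm z by rewrite addr_ge0 ?sqr_ge0.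
have g0 gamma : 0 <= g gamma by apply: sumr_ge0.
have gN gamma : ~ U gamma -> r ^+ 2 / 4 <= g gamma.
  move=> nU; have [x xs xr] : exists2 x, x \in s & ~ `|gamma x - alpha x| < r%:C%C.
    apply: contrapT => nx; apply: nU; apply: CU => x; rewrite sE /= => xs.
    by apply: contrapT => xr; apply: nx; exists x.
  rewrite /g (bigD1_seq x)//=; have := sqr_norm_ge r0 xr.
  have : 0 <= \sum_(i <- s | i != x) sqr_norm (gamma i - alpha i) by apply: sumr_ge0.
  by lra.
(* Values of two characters differ by at most [4], and [sqr_norm_le] turns this into
   [2 * 4 ^+ 2 = 32] for each term. The extra [1] makes room for [d], so that [d - g gamma] is at
   most [M] in absolute value. *)
pose M : R := 1 + (size s)%:R * 32.
have gM gamma : g gamma <= M - 1.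
  rewrite /M addrAC subrr add0r /g -sum1_size natr_sum mulr_suml; apply: ler_sum => x _.
  rewrite mul1r; have h : `|gamma x - alpha x| <= 4%:C%C.
    have -> : (4%:C = 2%:C + 2%:C :> R[i])%C by rewrite -rmorphD/=; congr (_%:C)%C; lra.
    apply: le_trans (ler_normB _ _) _.
    by apply: lerD; exact: character_le2 (dual_character _).
  by have := sqr_norm_le h; lra.
have M0 : 1 <= M by rewrite /M lerDl mulr_ge0.
(* With this choice [g] is at least [2 * d] off [U] and below [d / 2] on the neighbourhood taken, so
   [f] lies at least [k * (d / 2)] away from one half on both sides. *)
pose d := Num.min (r ^+ 2 / 8) 1.
have d0 : 0 < d by rewrite lt_min divr_gt0 ?exprn_gt0//= ltr01.
have d1 : d <= 1 by rewrite ge_min lexx orbT.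
have dr : 2 * d <= r ^+ 2 / 4.
  have : d <= r ^+ 2 / 8 by rewrite ge_min lexx.
  lra.
pose k : R := (2 * M)^-1.
have k0 : 0 < k by rewrite invr_gt0; lra.
have kM : k * M = 2^-1 by rewrite /k invfM -mulrA mulVf ?mulr1//; lra.
pose f gamma := 2^-1 + k * (d - g gamma).
have tf : real_trig f.
  apply: real_trigD; first exact: real_trig_cst.
  apply: real_trigM; first exact: real_trig_cst.
  by apply: real_trigB => //; exact: real_trig_cst.
have f01 gamma : 0 <= f gamma <= 1.
  by have := g0 gamma; have := gM gamma => ? ?; apply/andP; split; rewrite /f; nra.
have fU gamma : ~ U gamma -> f gamma <= 2^-1 - k * (d / 2).
  by move=> /gN ?; rewrite /f; nra.
exists [set gamma | g gamma < d / 2]; split.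
- by apply: (@open_comp _ _ g [set t | t < d / 2]); [move=> ? _; exact: real_trig_continuous|exact: open_lt].
- rewrite /= /g big1 ?divr_gt0// => x _; rewrite subrr /sqr_norm /=.
  by rewrite expr0n/= addr0.
- move=> e e0; have kd : 0 < k * (d / 2) by rewrite mulr_gt0 ?divr_gt0.
  have [n nP] := step_polynomial kd e0.
  exists (fun gamma => 1 - (1 - f gamma ^+ n) ^+ (2 ^ n)); split.
  + apply: real_trigB; first exact: real_trig_cst.
    apply: real_trigX; apply: real_trigB; first exact: real_trig_cst.
    exact: real_trigX.
  + by move=> gamma; have [] := nP _ (f01 gamma).
  + move=> gamma /= gd; have [_ + _] := nP _ (f01 gamma); apply.
    by rewrite /f; nra.
  + by move=> gamma /fU; have [_ _] := nP _ (f01 gamma); apply.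
Qed.

Lemma trig_separated_compact (C U : set (dual HL)) : compact C -> open U -> C `<=` U ->
  trig_separated C U.
Proof.
move=> + oU CU; rewrite compact_cover.
move=> /(_ _ [set N : set (dual HL) | open N /\ trig_separated N U] id)[|gamma Cg|D' D'D CD'].
- by move=> N [].
- have [|N [oN Ng sN]] := @trig_separated_point gamma U; last by exists N.
  by apply: open_nbhs_nbhs; split => //; exact: CU.
have : forall N, N \in finmap.enum_fset D' -> trig_separated N U.
  by move=> N /D'D; rewrite inE => -[].
have CD : forall gamma, C gamma -> exists2 N, N \in finmap.enum_fset D' & N gamma.
  by move=> gamma /CD'[N ND Ng]; exists N.
move: (finmap.enum_fset D') CD => s CD sD.
(* The induction runs over sets covered by a list of neighbourhoods, compact or not, since removing
   one neighbourhood from [C] need not leave a compact set. *)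
elim: s C {CU CD'} CD sD => [|N s IH] C CD sD e e0.
  exists (fun=> 0); split => //; first exact: real_trig_cst.
  - by move=> gamma; rewrite lexx ler01.
  - by move=> gamma /CD[].
  - by move=> gamma _; exact: ltW.
have sN := sD N (mem_head _ _).
have ss : trig_separated (C `\` N) U.
  apply: IH => [gamma [Cg nN]|N' N's]; last by apply: sD; rewrite inE N's orbT.
  by have [N'] := CD _ Cg; rewrite inE => /predU1P[->//|N's N'g]; exists N'.
have [f [f1 f2 f3 f4]] := trig_separatedU sN ss e0.
exists f; split => // gamma Cg; apply: f3.
by have [Ng|nN] := pselect (N gamma); [left|right].
Qed.

Lemma dual_measure_unique (mu nu : {measure set (borel (dual HL)) -> \bar R}) :
  (mu setT < +oo)%E -> (nu setT < +oo)%E -> inner_regular mu -> inner_regular nu ->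
  hausdorff_space (dual HL) ->
  (forall x, cintegral mu (fun gamma : dual HL => gamma x) =
             cintegral nu (fun gamma : dual HL => gamma x)) ->
  eq_borel mu nu.
Proof.
move=> mufin nufin irmu irnu hD tr; apply: eq_borel_inner_regular => // C U cC oU CU.
have mC : measurable (C : set (borel (dual HL))) by apply: closed_borel; exact: compact_closed.
have mU : measurable (U : set (borel (dual HL))) by exact: open_borel.
have key (k l : {measure set (borel (dual HL)) -> \bar R}) : (k setT < +oo)%E -> (l setT < +oo)%E ->
    (forall x, cintegral k (fun gamma : dual HL => gamma x) =
               cintegral l (fun gamma : dual HL => gamma x)) ->
    (k C <= l U)%E.
  move=> kfin lfin kl; apply/lee_addgt0Pr => e e0.
  (* The error [e'] is paid once on the total mass of each measure; the summand [1] keeps the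
     denominator positive. *)
  pose e' := e / (1 + fine (k setT) + fine (l setT)).
  have k0 : 0 <= fine (k setT) by rewrite fine_ge0.
  have l0 : 0 <= fine (l setT) by rewrite fine_ge0.
  have e'0 : 0 < e' by rewrite divr_gt0//; lra.
  have [f [tf f01 f1 f0]] := trig_separated_compact cC oU CU e'0.
  have mf := continuous_borel (real_trig_continuous tf).
  have fk := fin_num_integral01 kfin mf f01.
  have fl := fin_num_integral01 lfin mf f01.
  have E : (\int[k]_x (f x)%:E = \int[l]_x (f x)%:E)%E.
    rewrite -(fineK fk) -(fineK fl).
    exact: (congr1 (fun z : cplx R => (complex.Re z)%:E) (trig_cintegral kfin lfin kl tf)).
  have f0' x : (0 <= f x)%R by case/andP: (f01 x).
  have int_e' (m : {measure set (borel (dual HL)) -> \bar R}) : (m setT < +oo)%E ->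
      (\int[m]_x e'%:E = (e' * fine (m setT))%:E)%E.
    by move=> mfin; rewrite integral_cst// (EFinM e') fineK// ge0_fin_numE.
  have up : (k C <= \int[k]_x (f x)%:E + (e' * fine (k setT))%:E)%E.
    apply: (@le_trans _ _ (\int[k]_x (f x + e')%:E)%E).
      apply: le_measure_integral => //.
      - exact: measurable_funD.
      - by move=> x; rewrite addr_ge0// ltW.
      - by move=> x /f1; lra.
    under eq_integral do rewrite EFinD.
    rewrite ge0_integralD//; last 3 first.
    - by move=> x _; rewrite lee_fin.
    - exact/measurable_EFinP.
    - by move=> x _; rewrite lee_fin ltW.
    by rewrite int_e'.
  have low : (\int[l]_x (f x)%:E <= l U + (e' * fine (l setT))%:E)%E.
    have -> : (l U + (e' * fine (l setT))%:E = \int[l]_x ((\1_U x)%:E + e'%:E))%E.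
      rewrite ge0_integralD//; last 2 first.
      - exact/measurable_EFinP/measurable_indic.
      - by move=> x _; rewrite lee_fin ltW.
      by rewrite integral_indic// setIT int_e'.
    apply: ge0_le_integral => //.
    - by move=> x _; rewrite lee_fin.
    - exact/measurable_EFinP.
    - by apply: emeasurable_funD => //; apply/measurable_EFinP; exact: measurable_indic.
    - move=> x _; rewrite -EFinD lee_fin indicE.
      have [Ux|nU] := pselect (U x); first by rewrite mem_set//=; case/andP: (f01 x); lra.
      by rewrite memNset//= add0r; exact: f0.
  apply: (le_trans up); rewrite E; apply: le_trans (leeD2r _ low) _.
  rewrite -addeA -EFinD leeD2l// lee_fin -mulrDr.
  apply: (@le_trans _ _ (e' * (1 + fine (k setT) + fine (l setT)))).
    by rewrite ler_wpM2l ?(ltW e'0)//; lra.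
  by rewrite /e' mulfVK//; lra.
by split; apply: key.
Qed.

End trigonometric_polynomials.

(** * The dual of a join *)

Section dual_of_join.
Context {R : realType} {H J K : ptopologicalType}.
Variables (HH : hypergroup R H) (HJ : hypergroup R J) (HK : hypergroup R K).
Variables (mH : {measure set (borel H) -> \bar R}) (iH : H -> K) (iJ : J -> K).
Hypotheses (compactH : compact [set: H]) (haarH : is_haar HH mH)
  (mH1 : mH setT = 1%E) (joinK : is_join HH HJ mH HK iH iJ)
  (openJ : forall A : set J, open A).
Let eJ := hid HJ.
Let iH_inj := join_injl joinK.
Let iJ_inj := join_injr joinK.
Let cases := join_cases joinK.

(** The quotient map of [K] by [H]. Extending a character of [J] by [1] on [H] is composing with
    it. *)
Definition join_retract : K -> J := extend iJ eJ id.

Lemma join_retractJ y : join_retract (iJ y) = y.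
Proof. exact: extendE. Qed.

Lemma join_retractH h : join_retract (iH h) = eJ.
Proof.
have [[y yh]|nh] := pselect (exists y, iJ y = iH h).
  by rewrite -yh join_retractJ; exact: join_meet_id joinK _ _ yh.
by rewrite /join_retract extend_out// => y yh; apply: nh; exists y.
Qed.

Lemma join_retract_continuous : continuous join_retract.
Proof.
apply/continuous_closedP => B _.
rewrite (_ : _ @^-1` _ = iJ @` B `|` (if `[< B eJ >] then range iH else set0)).
  apply: closedU; first by apply: (join_closedr joinK); rewrite -openC; exact: openJ.
  by case: asboolP => _; [apply: (join_closedl joinK); exact: closedT|exact: closed0].
apply/seteqP; split => k.
  have [[h ->]|[y _ ->]] := cases k; rewrite /= ?join_retractH ?join_retractJ => Bk.
    by right; rewrite asboolT//; exists h.
  by left; exists y.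
case=> [[y By <-]|]; first by rewrite /= join_retractJ.
by case: asboolP => // Be [h _ <-]; rewrite /= join_retractH.
Qed.

Let mHfin : (mH setT < +oo)%E. Proof. by rewrite mH1 ltry. Qed.

Let char_conv (chi : dual HK) k l : translate HK k chi l = chi k * chi l.
Proof. exact: dual_conv. Qed.

Lemma dual_join_extend_hermitian (a : dual HJ) :
  hermitian_character HK (fun k => a (join_retract k)).
Proof.
have bound k : `|a (join_retract k)| <= 2%:C%C by exact: character_le2 (dual_character a).
have cf : continuous (fun k => a (join_retract k)).
  by move=> k; apply: continuous_comp; [exact: join_retract_continuous|exact: dual_continuous].
have bf : bounded_borel_cfun (fun k => a (join_retract k)).
  by apply: bounded_borel_continuous => //; exists 2.
have hat y : join_hat HJ mH iH iJ (fun k => a (join_retract k)) y = a y.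
  have [->|ye] := pselect (y = eJ); last by rewrite join_hat_ne// join_retractJ.
  rewrite join_hat_id; under eq_cintegral do rewrite join_retractH dual_id.
  by rewrite cintegral_cst [X in fine X]mH1 mul1r dual_id.
split=> //.
- by exists 2.
- by rewrite (join_hidl joinK) join_retractH dual_id.
- move=> k l; rewrite -[LHS]/(translate HK k (fun k => a (join_retract k)) l).
  have [[h ->]|[x xe ->]] := cases k; have [[h' ->]|[y ye ->]] := cases l.
  + rewrite (join_translateHH joinK)// !join_retractH dual_id mulr1 /translate.
    under eq_cintegral do rewrite join_retractH dual_id.
    by rewrite cintegral_cst [X in fine X](probability_setT (hconv HH h h')) mul1r.
  + by rewrite (join_translateHJ joinK)// join_retractH dual_id mul1r.
  + by rewrite (join_translateJH joinK)// join_retractH dual_id mulr1.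
  + rewrite (join_translateJJ mH1 joinK openJ)// /translate.
    by under eq_cintegral do rewrite hat; rewrite dual_conv !join_retractJ.
- move=> k; have [[h ->]|[x xe ->]] := cases k.
  + by rewrite (join_invl joinK) !join_retractH dual_id conjC1.
  + by rewrite (join_invr joinK) !join_retractJ dual_inv.
Qed.

Definition dual_join_extend (a : dual HJ) : dual HK := mk_dual (dual_join_extend_hermitian a).

Lemma dual_join_extendE a k : dual_join_extend a k = a (join_retract k).
Proof. by []. Qed.

Lemma dual_join_restrict_hermitian (chi : dual HK) :
  hermitian_character HH (fun h => chi (iH h)).
Proof.
split.
- move=> h; apply: continuous_comp; [exact: (join_continuousl joinK)|exact: dual_continuous].
- by exists 2 => h; exact: character_le2 (dual_character chi).
- by rewrite -(join_hidl joinK) dual_id.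
- move=> x y; rewrite -char_conv (join_translateHH joinK)//; exact: dual_bounded_borel.
- by move=> h; rewrite -(join_invl joinK) dual_inv.
Qed.

Definition dual_join_restrict (chi : dual HK) : dual HH :=
  mk_dual (dual_join_restrict_hermitian chi).

Lemma dual_join_restrictE chi h : dual_join_restrict chi h = chi (iH h).
Proof. by []. Qed.

Let extendJ0 (g : H -> cplx R) y : y <> eJ -> extend iH 0 g (iJ y) = 0.
Proof.
by move=> ye; rewrite extend_out// => h hy; apply: ye; exact: join_meet_id joinK _ _ (esym hy).
Qed.

(** A nontrivial character of [H] has mean zero, so the average over [H] of its extension vanishes
    identically on [J]. Products of points of [J], including inverse ones whose product spreads over
    [H], thus integrate the extension to zero. *)
Lemma dual_join_zero_hermitian (eta : dual HH) : eta <> dual1 HH ->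
  hermitian_character HK (extend iH (0 : cplx R) eta).
Proof.
move=> eta1; set chi := extend iH 0 eta.
have chiH h : chi (iH h) = eta h by exact: extendE.
have chiJ y : y <> eJ -> chi (iJ y) = 0 by exact: extendJ0.
have bound k : `|chi k| <= 2%:C%C.
  have [[h ->]|[y ye ->]] := cases k; first by rewrite chiH; exact: character_le2 (dual_character eta).
  by rewrite chiJ// normr0 lecR.
have cf : continuous chi.
  apply: continuous_extend => //; [exact: (join_closedl joinK)|exact: (join_range_open joinK openJ)|].
  exact: dual_continuous.
have bf : bounded_borel_cfun chi by apply: bounded_borel_continuous => //; exists 2.
have hat y : join_hat HJ mH iH iJ chi y = 0.
  have [->|ye] := pselect (y = eJ); last by rewrite join_hat_ne// chiJ.
  rewrite join_hat_id; under eq_cintegral do rewrite chiH.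
  exact: cintegral_nontrivial_character.
split=> //.
- by exists 2.
- by rewrite (join_hidl joinK) chiH dual_id.
- move=> k l; rewrite -[LHS]/(translate HK k chi l).
  have [[h ->]|[x xe ->]] := cases k; have [[h' ->]|[y ye ->]] := cases l.
  + rewrite (join_translateHH joinK)// !chiH /translate.
    by under eq_cintegral do rewrite chiH; rewrite dual_conv.
  + by rewrite (join_translateHJ joinK)// chiJ// mulr0.
  + by rewrite (join_translateJH joinK)// chiJ// mul0r.
  + rewrite (join_translateJJ mH1 joinK openJ)// chiJ// mul0r /translate.
    by under eq_cintegral do rewrite hat; rewrite cintegral_cst mulr0.
- move=> k; have [[h ->]|[x xe ->]] := cases k.
  + by rewrite (join_invl joinK) !chiH dual_inv.
  + rewrite (join_invr joinK) !chiJ ?conjC0// => xe'; apply: xe.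
    by rewrite -[x](hinvK HJ) xe' hinv_id.
Qed.

(** The trivial character goes to the identity of the dual of [K], the point shared by the two parts
    of the join, and not to its extension by zero. *)
Definition dual_join_zero (eta : dual HH) : dual HK :=
  if pselect (eta = dual1 HH) is right ne then mk_dual (dual_join_zero_hermitian ne)
  else dual1 HK.

Lemma dual_join_zero1 : dual_join_zero (dual1 HH) = dual1 HK.
Proof. by rewrite /dual_join_zero; case: pselect. Qed.

Lemma dual_join_zeroE eta : eta <> dual1 HH -> char_fun (dual_join_zero eta) = extend iH 0 eta.
Proof. by rewrite /dual_join_zero; case: pselect. Qed.

Lemma dual_join_restrict_zero eta : dual_join_restrict (dual_join_zero eta) = eta.
Proof.
apply: dual_eq => h; rewrite dual_join_restrictE.
have [->|ne] := pselect (eta = dual1 HH); first by rewrite dual_join_zero1.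
by rewrite dual_join_zeroE// extendE.
Qed.

Lemma dual_join_restrict_extend a : dual_join_restrict (dual_join_extend a) = dual1 HH.
Proof. by apply: dual_eq => h; rewrite dual_join_restrictE dual_join_extendE join_retractH dual_id. Qed.

(** Being constant on [H], [chi] coincides on [J] with its own average, so [join_translateJJ] turns
    multiplicativity on [K] into multiplicativity on [J]. *)
Lemma dual_join_trivial chi : dual_join_restrict chi = dual1 HH ->
  exists a, chi = dual_join_extend a.
Proof.
move=> r1; have chiH h : chi (iH h) = 1 by rewrite -dual_join_restrictE r1.
have bchi := dual_bounded_borel chi.
have hat y : join_hat HJ mH iH iJ chi y = chi (iJ y).
  have [->|ye] := pselect (y = eJ); last by rewrite join_hat_ne.
  rewrite join_hat_id; under eq_cintegral do rewrite chiH.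
  by rewrite cintegral_cst [X in fine X]mH1 mul1r (join_id joinK) chiH.
have ha : hermitian_character HJ (fun y => chi (iJ y)).
  split.
  - exact: discrete_continuous.
  - by exists 2 => y; exact: character_le2 (dual_character chi).
  - by rewrite (join_id joinK) chiH.
  - move=> x y; have [->|ye] := pselect (y = eJ).
      rewrite (eq_borel_cintegral _ (conv_idr HJ x)) cintegral_dirac; last first.
        by apply: bounded_borel_comp bchi; apply: continuous_borel_map; exact: (join_continuousr joinK).
      by rewrite (join_id joinK) chiH mulr1.
    rewrite -char_conv (join_translateJJ mH1 joinK openJ)// /translate.
    by apply: eq_cintegral => t; rewrite hat.
  - by move=> y; rewrite -(join_invr joinK) dual_inv.
exists (mk_dual ha); apply: dual_eq => k; rewrite dual_join_extendE.
have [[h ->]|[y ye ->]] := cases k; last by rewrite join_retractJ.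
by rewrite join_retractH dual_id chiH.
Qed.

(** A point [h] of [H] absorbs into any [y] of [J] off the identity, so [chi] at [y] is unchanged by
    the factor [chi (iH h)]; where that factor is not [1], the value at [y] must be zero. *)
Lemma dual_join_nontrivial chi : dual_join_restrict chi <> dual1 HH ->
  chi = dual_join_zero (dual_join_restrict chi).
Proof.
move=> r1; apply: dual_eq => k; rewrite dual_join_zeroE//.
have [[h ->]|[y ye ->]] := cases k; first by rewrite extendE.
rewrite extendJ0//; have [h chih] : exists h, chi (iH h) <> 1.
  apply: contrapT => nh; apply: r1; apply: dual_eq => h; rewrite dual_join_restrictE.
  by apply: contrapT => chih; apply: nh; exists h.
have := char_conv chi (iH h) (iJ y); rewrite (join_translateHJ joinK)//; last exact: dual_bounded_borel.
move=> /eqP; rewrite -subr_eq0 -{1}[chi (iJ y)]mul1r -mulrBl mulf_eq0 subr_eq0.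
by move=> /orP[/eqP/esym//|/eqP].
Qed.

Lemma dual_join_zero_restrict chi eta : eta <> dual1 HH ->
  dual_join_restrict chi = eta -> chi = dual_join_zero eta.
Proof. by move=> ne re; rewrite -re; apply: dual_join_nontrivial; rewrite re. Qed.

Lemma dual_join_extend_inj : injective dual_join_extend.
Proof.
move=> a b ab; apply: dual_eq => y.
by rewrite -(join_retractJ y) -[LHS]dual_join_extendE ab.
Qed.

Lemma dual_join_zero_inj : injective dual_join_zero.
Proof. by move=> a b /(congr1 dual_join_restrict); rewrite !dual_join_restrict_zero. Qed.

Lemma dual_join_extend1 : dual_join_extend (dual1 HJ) = dual1 HK.
Proof. exact: dual_eq. Qed.

Lemma dual_join_restrict_continuous : continuous dual_join_restrict.
Proof.
move=> chi U /nbhs_dualP[C [r [cC r0] CU]].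
have cC' : compact (iH @` C).
  exact: (continuous_compact (continuous_subspaceT (join_continuousl joinK)) cC).
apply: filterS (nbhs_dual_ball chi cC' r0) => gamma gP; apply: CU => h Ch.
by rewrite !dual_join_restrictE; apply: gP; exists h.
Qed.

Lemma dual_join_extend_continuous : continuous dual_join_extend.
Proof.
move=> a U /nbhs_dualP[C [r [cC r0] CU]].
have cC' : compact (join_retract @` C).
  exact: (continuous_compact (continuous_subspaceT join_retract_continuous) cC).
apply: filterS (nbhs_dual_ball a cC' r0) => gamma gP; apply: CU => k Ck.
by rewrite !dual_join_extendE; apply: gP; exists k.
Qed.

Lemma range_dual_join_extend : range dual_join_extend = dual_join_restrict @^-1` [set dual1 HH].
Proof.
apply/seteqP; split => [_ [a _ <-]|chi /= /dual_join_trivial[a ->]].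
  exact: dual_join_restrict_extend.
by exists a.
Qed.

End dual_of_join.

(** * Images, restrictions and multiples of inner regular measures *)

Section image_measures.
Context {R : realType} {X Y : ptopologicalType}.
Implicit Types mu : {measure set (borel X) -> \bar R}.

Lemma inner_regularI mu : hausdorff_space X ->
  (forall (U : set X) (e : \bar R), open U -> (e < mu U)%E ->
    exists C : set X, [/\ compact C, C `<=` U & (e < mu C)%E]) -> inner_regular mu.
Proof.
move=> hX h U oU; apply/le_anti/andP; split; last first.
  apply: ge_ereal_sup => _ [C [cC CU] <-]; rewrite le_measure ?inE//.
    by apply: closed_borel; exact: compact_closed.
  exact: open_borel.
rewrite leNgt; apply/negP => /(h U _ oU)[C [cC CU]]; rewrite ltNge => /negP; apply.
by apply: ereal_sup_ubound; exists C.
Qed.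

Lemma inner_regular_mrestr mu (V : set (borel X)) (mV : measurable V) : hausdorff_space X ->
  open (V : set X) -> inner_regular mu -> inner_regular (mrestr mu mV).
Proof.
move=> hX oV ir; apply: inner_regularI => // U e oU eU.
have [C [cC CU eC]] := inner_regularP ir (openI oU oV) eU.
exists C; split => //; first by move=> x /CU[].
by apply: lt_le_trans eC _; rewrite -[leRHS]/(mu (C `&` V)) setIidl// => x /CU[].
Qed.

Lemma inner_regular_mscale mu (c : R) (c0 : 0 <= c) : hausdorff_space X -> 0 < c ->
  inner_regular mu -> inner_regular (mscale (NngNum c0) mu : {measure set (borel X) -> \bar R}).
Proof.
set nu : {measure set (borel X) -> \bar R} := mscale (NngNum c0) mu => hX cpos ir.
have E A : nu A = (c%:E * mu A)%E by [].
apply: inner_regularI => // U e oU; rewrite E => eU.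
have [C [cC CU eC]] : exists C : set X, [/\ compact C, C `<=` U & (c^-1%:E * e < mu C)%E].
  apply: (inner_regularP ir oU); rewrite -(@lte_pmul2l _ c%:E)//.
  by rewrite muleA -EFinM divff ?mul1e// gt_eqF.
exists C; split => //; rewrite E -(@lte_pmul2l _ c^-1%:E)//; last by rewrite lte_fin invr_gt0.
by rewrite muleA -EFinM mulVf ?mul1e// gt_eqF.
Qed.

Variable f : X -> Y.
Hypothesis mf : measurable_fun setT (f : borel X -> borel Y).

Definition borel_image mu : {measure set (borel Y) -> \bar R}.
Proof. by refine (pushforward mu (f : borel X -> borel Y) : {measure set (borel Y) -> \bar R}); exact mf. Defined.

Lemma borel_imageE mu A : borel_image mu A = mu (f @^-1` A).
Proof. by []. Qed.

End image_measures.

Lemma inner_regular_image {R : realType} {X Y : ptopologicalType} (f : X -> Y)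
    (mf : measurable_fun setT (f : borel X -> borel Y)) (mu : {measure set (borel X) -> \bar R}) :
  hausdorff_space X -> hausdorff_space Y -> continuous f ->
  inner_regular mu -> inner_regular (borel_image mf mu).
Proof.
move=> hX hY cf ir; apply: inner_regularI => // U e oU eU.
have oV : open (f @^-1` U) by apply: open_comp => // x _; exact: cf.
have [C [cC CU eC]] := inner_regularP ir oV eU.
have cfC : compact (f @` C) by exact: (continuous_compact (continuous_subspaceT cf) cC).
exists (f @` C); split => //; first by move=> _ [x /CU ? <-].
apply: lt_le_trans eC _; rewrite borel_imageE le_measure ?inE//.
- by apply: closed_borel; exact: compact_closed.
- have := mf measurableT _ (closed_borel (compact_closed hY cfC)).
  by rewrite setTI.
- by move=> x Cx; exists x.
Qed.

Lemma Rintegral_mrestr {R : realType} {X : ptopologicalType}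
    (mu : {measure set (borel X) -> \bar R}) (V : set (borel X)) (mV : measurable V) (f : X -> R) :
  measurable_fun setT (f : borel X -> _) -> (forall x, ~ V x -> f x = 0) ->
  \int[mu]_x f x = \int[mrestr mu mV]_x f x.
Proof.
move=> mf f0; have mVc := measurableC mV.
have ge0 (g : X -> \bar R) : measurable_fun setT (g : borel X -> _) -> (forall x, 0 <= g x)%E ->
    (forall x, ~ V x -> g x = 0%E) -> (\int[mu]_x g x = \int[mrestr mu mV]_x g x)%E.
  move=> mg g0 gV.
  have := @ge0_integral_mix _ _ _ _ (borel X) (borel X) (borel X) mu (mrestr mu mV) (mrestr mu mVc) id id 1.
  move=> /(_ (@measurable_id _ _ _) (@measurable_id _ _ _) ler01 _ _ mg g0) ->; last first.
    move=> A mA; rewrite mul1e -[RHS]/(mu (A `&` V) + mu (A `&` ~` V))%E -measureU; [|exact: measurableI..|].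
      by rewrite -setIUr setUv setIT.
    by rewrite setIACA setICr setI0.
  rewrite mul1e [X in (_ + X)%E](_ : _ = 0%E) ?adde0//.
  rewrite (_ : (\int[mrestr mu mVc]_x g x = \int[mrestr mu mVc]_x cst 0 x)%E); first by rewrite integral0.
  apply: ae_eq_integral => //; exists V; split => //.
    exact: mrestr_setC0.
  by move=> x /= h; apply: contrapT => /gV gx; apply: h => _.
rewrite /Rintegral; congr fine; rewrite integralE [RHS]integralE; congr (_ - _)%E.
  apply: ge0 => //.
  - by apply: measurable_funepos; exact/measurable_EFinP.
  - by move=> x /f0 fx; rewrite funeposE fx maxxx.
apply: ge0 => //.
- by apply: measurable_funeneg; exact/measurable_EFinP.
- by move=> x /f0 fx; rewrite funenegE fx oppe0 maxxx.
Qed.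

(* [r] plays the role of the quotient map of [K] by the compact subhypergroup
   [iH @` H]: all of its other fibres are points. *)
Section join_recognition.
Context {R : realType} {H J K : ptopologicalType}.
Variables (HH : hypergroup R H) (HJ : hypergroup R J) (HK : hypergroup R K).
Variables (iH : H -> K) (iJ : J -> K) (r : K -> J).
Hypotheses (compactH : compact [set: H]) (openJ : forall A : set J, open A).
Hypotheses (iH_inj : injective iH) (iHc : continuous iH) (rc : continuous r).
Hypothesis rH : forall h, r (iH h) = hid HJ.
Hypothesis rJ : forall y, r (iJ y) = y.
Hypothesis fibre_id : forall k, r k = hid HJ -> exists h, iH h = k.
Hypothesis fibre_ne : forall k y, y <> hid HJ -> r k = y -> k = iJ y.
Hypothesis iJ_id : iJ (hid HJ) = iH (hid HH).
Hypothesis idK : hid HK = iH (hid HH).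
Hypothesis invH : forall h, hinv HK (iH h) = iH (hinv HH h).
Hypothesis invJ : forall y, hinv HK (iJ y) = iJ (hinv HJ y).
Hypothesis conv_r : forall k l B, hconv HK k l (r @^-1` B) = hconv HJ (r k) (r l) B.
Hypothesis conv_H : forall x y,
  eq_borel (hconv HK (iH x) (iH y)) (fun A => hconv HH x y (iH @^-1` A)).
Variable mK : {measure set (borel K) -> \bar R}.
Hypothesis haarK : is_haar HK mK.
Let eJ := hid HJ.
Let V : set K := range iH.
Let hH := hypergroup_hausdorff HH.
Let hK := hypergroup_hausdorff HK.

Let V_r : V = r @^-1` [set eJ].
Proof. by apply/seteqP; split => [_ [h _ <-]|k /= /fibre_id[h <-]]; [exact: rH|exists h]. Qed.

Let closedJ (B : set J) : closed B. Proof. by rewrite -openC; exact: openJ. Qed.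

Let oV : open V.
Proof. by rewrite V_r; apply: open_comp => // k _; exact: rc. Qed.

Let cV : compact V.
Proof. exact: (continuous_compact (continuous_subspaceT iHc) compactH). Qed.

Let mV : measurable (V : set (borel K)). Proof. exact: open_borel. Qed.

Let VJ y : y <> eJ -> ~ V (iJ y). Proof. by move=> ye; rewrite V_r /= rJ. Qed.

Let iJ_inj : injective iJ. Proof. by move=> a b /(congr1 r); rewrite !rJ. Qed.

Let iH_closed (B : set H) : closed B -> closed (iH @` B).
Proof.
move=> cB; apply: compact_closed => //.
apply: (continuous_compact (continuous_subspaceT iHc)).
exact: subclosed_compact cB compactH (@subsetT _ _).
Qed.

Let iJ_image (B : set J) :
  iJ @` B = r @^-1` (B `\ eJ) `|` (if `[< B eJ >] then [set hid HK] else set0).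
Proof.
have eE : hid HK = iJ eJ by rewrite iJ_id.
apply/seteqP; split => k.
  move=> [y By <-]; have [ye|ye] := pselect (y = eJ).
    by right; rewrite -ye asboolT// eE ye.
  by left; rewrite /= rJ.
case=> [[Bk ke]|]; first by exists (r k) => //; exact/esym/fibre_ne.
by case: asboolP => // Be ->; exists eJ.
Qed.

Let iJ_closed (B : set J) : closed (iJ @` B).
Proof.
rewrite iJ_image; apply: closedU.
  by move: rc => /continuous_closedP; apply.
case: asboolP => _; last exact: closed0.
by apply: compact_closed => //; exact: compact_set1.
Qed.

Let Ve : V (hid HK). Proof. by rewrite idK; exists (hid HH). Qed.

Let Vinv x : V x -> V (hinv HK x).
Proof. by move=> [h _ <-]; rewrite invH; exists (hinv HH h). Qed.

Let hinv_ne y : y <> eJ -> hinv HJ y <> eJ.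
Proof. by move=> ye he; apply: ye; rewrite -[y](hinvK HJ) he hinv_id. Qed.

Let conv_V k l : hconv HK k l V = hconv HJ (r k) (r l) [set eJ].
Proof. by rewrite V_r conv_r. Qed.

Let Vconv k l : hconv HK k l V != 0%E -> l = hinv HK k \/ V k /\ V l.
Proof.
move=> klV; have rk : r k = hinv HJ (r l).
  by apply: contrapT => rkl; move/eqP: klV; apply; rewrite conv_V conv_isolated_id.
have [le|le] := pselect (r l = eJ).
  by right; rewrite V_r /= rk le; split => //; exact: hinv_id.
left; rewrite (fibre_ne le erefl) (fibre_ne (hinv_ne le) rk) invJ.
by rewrite hinvK.
Qed.

(** Points off [V] are sent to the identity only to have a continuous map on all of [K]; measures
    are cut down to [V] before being transported along it. *)
Let retr : K -> H := extend iH (hid HH) id.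

Let retrH h : retr (iH h) = h. Proof. exact: extendE. Qed.

Let retr_V k : V k -> iH (retr k) = k.
Proof. by move=> [h _ <-]; rewrite retrH. Qed.

Let retr_continuous : continuous retr.
Proof. by apply: continuous_extend => // x; exact: cvg_id. Qed.

Let retr_borel : measurable_fun setT (retr : borel K -> borel H).
Proof. exact: continuous_borel_map. Qed.

Let iH_borel : measurable_fun setT (iH : borel H -> borel K).
Proof. exact: continuous_borel_map. Qed.

Let restr (mu : {measure set (borel K) -> \bar R}) := borel_image retr_borel (mrestr mu mV).

Let restrE mu A : restr mu A = mu (retr @^-1` A `&` V). Proof. by []. Qed.

Let restr_fin (mu : {measure set (borel K) -> \bar R}) : (mu V < +oo)%E -> (restr mu setT < +oo)%E.
Proof. by rewrite restrE preimage_setT setTI. Qed.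

Let restr_inner_regular (mu : {measure set (borel K) -> \bar R}) : inner_regular mu -> inner_regular (restr mu).
Proof. by move=> ir; apply: inner_regular_image => //; exact: inner_regular_mrestr. Qed.

Let ext0 (f : H -> R) : K -> R := extend iH 0 f.

Let ext0_out f k : ~ V k -> ext0 f k = 0.
Proof. by move=> nk; rewrite /ext0 extend_out// => h hk; apply: nk; exists h. Qed.

Let ext0_continuous f : continuous f -> continuous (ext0 f).
Proof. by move=> cf; apply: continuous_extend. Qed.

Let continuous_bounded (f : H -> R) : continuous f -> exists M : R, forall h, `|f h| <= M.
Proof.
move=> cf; have := compact_bounded (continuous_compact (continuous_subspaceT cf) compactH).
move=> [M [_ /(_ (M + 1))h]]; exists (M + 1) => x; apply: h; first by rewrite ltrDl.
by exists x.
Qed.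

Let restr_integral (mu : {measure set (borel K) -> \bar R}) (f : H -> R) : (mu V < +oo)%E -> continuous f ->
  \int[restr mu]_h f h = \int[mu]_k ext0 f k.
Proof.
move=> mufin cf; have [M fM] := continuous_bounded cf.
have mu'fin : (mrestr mu mV setT < +oo)%E by rewrite /mrestr setTI.
have mf := continuous_borel cf.
have mcomp : measurable_fun setT ((fun k => f (retr k)) : borel K -> _).
  exact: measurableT_comp mf retr_borel.
have mext : measurable_fun setT (ext0 f : borel K -> _).
  by apply: continuous_borel; exact: ext0_continuous.
rewrite (Rintegral_mrestr mu mV mext (@ext0_out f)).
have := @Rintegral_mix _ _ _ _ (borel H) (borel K) (borel K) (restr mu) (mrestr mu mV) (mrestr mu mV) retr retr 0.
move=> /(_ retr_borel retr_borel (lexx _) _ mu'fin mu'fin f M mf fM) ->; last first.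
  by move=> A mA; rewrite mul0e add0e.
rewrite mul0r add0r /Rintegral; congr fine; apply: ae_eq_integral => //.
- exact/measurable_EFinP.
- exact/measurable_EFinP.
exists (~` V); split.
- exact: measurableC.
- by rewrite -[LHS]/(mu (~` V `&` V)) setICl measure0.
- move=> k /= h nV; apply: h => _; congr (_%:E).
  by rewrite -(retr_V nV) retrH /ext0 extendE.
Qed.

Let mKV0 : (0 < mK V)%E. Proof. exact: (haar_clopen_pos haarK oV cV Ve Vconv). Qed.

Let mKVfin : (mK V < +oo)%E. Proof. by have [[+ _ _] _ _] := haarK; apply. Qed.

Let mKVE : (fine (mK V))%:E = mK V. Proof. by rewrite fineK// ge0_fin_numE. Qed.

Let w : R := (fine (mK V))^-1.

Let fineV0 : 0 < fine (mK V). Proof. by rewrite -lte_fin mKVE. Qed.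

Let w0 : 0 <= w. Proof. by rewrite invr_ge0 ltW. Qed.

(** The Haar measure of [H] is manufactured from that of [K]: restricted to the compact open set
    [V], which has positive finite measure, transported to [H] and normalised. Its null sets are
    then controlled by those of [mK] from the start. *)
Let mH : {measure set (borel H) -> \bar R} := mscale (NngNum w0) (restr mK).

Let mHE A : mH A = (w%:E * mK (retr @^-1` A `&` V))%E. Proof. by []. Qed.

Let mH1 : mH setT = 1%E.
Proof. by rewrite mHE preimage_setT setTI -mKVE -EFinM mulVf// gt_eqF. Qed.

Let mH_integral (f : H -> R) : continuous f -> \int[mH]_h f h = w * \int[mK]_k ext0 f k.
Proof.
move=> cf; rewrite -restr_integral//.
have [M fM] := continuous_bounded cf; have mf := continuous_borel cf.
have := @Rintegral_mix _ _ _ _ (borel H) (borel H) (borel H) mH (restr mK) mzero id id w.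
move=> /(_ (@measurable_id _ _ _) (@measurable_id _ _ _) w0 _ (restr_fin mKVfin) (ltry 0) f M mf fM) ->.
  by rewrite /Rintegral integral_measure_zero addr0.
by move=> A mA; rewrite adde0.
Qed.

Let rK : inner_regular mK. Proof. by have [[]] := haarK. Qed.

Let measurable_retr (A : set (borel H)) : measurable A ->
  measurable (retr @^-1` A : set (borel K)).
Proof. by move=> mA; rewrite -[X in measurable X]setTI; exact: retr_borel. Qed.

Let measurable_pre (A : set (borel K)) : measurable A ->
  measurable (iH @^-1` A : set (borel H)).
Proof. by move=> mA; rewrite -[X in measurable X]setTI; exact: iH_borel. Qed.

Let mH_radon : radon mH.
Proof.
have mHle A : measurable A -> (mH A <= 1)%E.
  by move=> mA; rewrite -mH1 le_measure ?inE.
split.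
- move=> C cC; apply: (@le_lt_trans _ _ 1%E); last exact: ltry.
  by apply: mHle; apply: closed_borel; exact: compact_closed.
- move=> A mA; apply/le_anti/andP; split.
    apply: le_ereal_inf_tmp => _ [U [oU AU] <-]; rewrite le_measure ?inE//.
    exact: open_borel.
  apply/lee_addgt0Pr => e e0.
  have mB : measurable (retr @^-1` A `&` V : set (borel K)).
    by apply: measurableI => //; exact: measurable_retr.
  have Bfin : mK (retr @^-1` A `&` V) \is a fin_num.
    rewrite ge0_fin_numE//; apply: le_lt_trans mKVfin; rewrite le_measure ?inE//.
  have [_ orK _] := (let: And3 a _ _ := haarK in a).
  (* The tolerance in [K] is multiplied by the measure of [V], to become [e] after normalisation. *)
  have d0 : 0 < fine (mK V) * e by rewrite mulr_gt0.
  have [U [oU BU] Ue] : exists2 U : set K, open U /\ retr @^-1` A `&` V `<=` U &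
      (mK U < mK (retr @^-1` A `&` V) + (fine (mK V) * e)%:E)%E.
    have : (mK (retr @^-1` A `&` V) < mK (retr @^-1` A `&` V) + (fine (mK V) * e)%:E)%E.
      by rewrite lteDl// lte_fin.
    by rewrite {1}(orK _ mB) => /ereal_inf_lt[_ [U UP <-] Ue]; exists U.
  have oU' : open (iH @^-1` U) by apply: open_comp => // h _; exact: iHc.
  apply: (@le_trans _ _ (mH (iH @^-1` U))).
    apply: ereal_inf_lbound; exists (iH @^-1` U) => //; split => // h Ah.
    by apply: BU; split; [rewrite /= retrH|exists h].
  rewrite !mHE; apply: (@le_trans _ _ (w%:E * (mK (retr @^-1` A `&` V) + (fine (mK V) * e)%:E))%E).
    rewrite lee_wpmul2l ?lee_fin//; apply: le_trans (ltW Ue); rewrite le_measure ?inE//.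
    + apply: measurableI => //; apply: measurable_retr; exact: open_borel.
    + exact: open_borel.
    + by move=> k [/= Uk Vk]; rewrite -(retr_V Vk).
  rewrite muleDr//; last by rewrite fin_num_adde_defl.
  by rewrite -EFinM mulrA mulVf ?mul1r// gt_eqF.
- by apply: inner_regular_mscale; rewrite ?invr_gt0//; exact: restr_inner_regular.
Qed.

(** Invariance of [mK] is applied to the extension of [f] by zero and the point [iH x]. The
    translate is again an extension by zero, because the product of [iH x] with a point off [V] does
    not charge [V]. *)
Let haarH : is_haar HH mH.
Proof.
split; [exact: mH_radon|by rewrite mH1; exact/eqP/onee_neq0|].
move=> x f [cf _]; have cef := ext0_continuous cf.
have [_ _ inv] := haarK.
have conv_cont : continuous (fun y => \int[hconv HH x y]_z f z).
  move=> y; have := @conv_continuous _ _ HH f (compact_support compactH cf) (x, y).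
  apply: (@continuous_comp _ _ _ (fun y => (x, y)) (fun z : H * H => \int[hconv HH z.1 z.2]_t f t)).
  by apply: cvg_pair => //; exact: cvg_cst.
rewrite mH_integral// mH_integral//; congr (_ * _).
rewrite -(inv (iH x) (ext0 f)); last by apply: (supported_clopen HK cV cef) => //; exact: ext0_out.
apply: eq_Rintegral => k _; have [Vk|nVk] := pselect (V k).
  case: Vk => y _ <-; rewrite /ext0 extendE//.
  have [M fM] := continuous_bounded cf.
  have efM t : `|ext0 f t| <= M.
    have [[h _ <-]|nt] := pselect (V t); first by rewrite /ext0 extendE.
    by rewrite ext0_out// normr0; exact: le_trans (normr_ge0 _) (fM point).
  have := @Rintegral_mix _ _ _ _ (borel K) (borel H) (borel H) (hconv HK (iH x) (iH y)) (hconv HH x y) (hconv HH x y) iH iH 0.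
  move=> /(_ iH_borel iH_borel (lexx _) _ (probability_fin _) (probability_fin _) (ext0 f) M (continuous_borel cef) efM) ->.
    by rewrite mul0r add0r; apply: eq_Rintegral => t _; rewrite /ext0 extendE.
  by move=> A mA; rewrite mul0e add0e; exact: conv_H.
rewrite [LHS]ext0_out//.
rewrite /Rintegral (_ : (\int[_]_t _ = \int[hconv HK (iH x) k]_t cst 0 t)%E); first by rewrite integral0.
apply: ae_eq_integral => //; first by apply/measurable_EFinP; exact: continuous_borel.
exists V; split => //.
  apply/eqP/negP => /negP/Vconv[kE|[//]]; apply: nVk; rewrite kE; apply: Vinv; by exists x.
by move=> t /= h; apply: contrapT => nt; apply: h => _; rewrite ext0_out.
Qed.

(** The fibre of [r] over [y] is a single point off the identity, so the mass of the fibre, known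
    from [J], sits at [iJ y]. *)
Let conv_dirac k l y : y <> eJ -> eq_borel (hconv HJ (r k) (r l)) (dirac (y : borel J)) ->
  eq_borel (hconv HK k l) (dirac (iJ y : borel K)).
Proof.
move=> ye rkl.
have m1 : measurable ([set iJ y] : set (borel K)).
  by apply: closed_borel; apply: compact_closed => //; exact: compact_set1.
have p1 : hconv HK k l [set iJ y] = 1%E.
  rewrite (_ : [set iJ y] = r @^-1` [set y]).
    by rewrite conv_r rkl ?diracE ?mem_set//; exact: open_borel.
  by apply/seteqP; split => [_ ->|t /= /(fibre_ne ye)]; [exact: rJ|].
have p0 : hconv HK k l (~` [set iJ y]) = 0%E by rewrite probability_setC// p1 subee.
move=> A mA; rewrite diracE; have [Ay|nAy] := pselect (A (iJ y)).
  rewrite mem_set//; apply/le_anti; rewrite probability_le1//= -{1}p1.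
  by rewrite le_measure ?inE// => _ ->.
rewrite memNset//; apply: subset_measure0 p0 => //; first exact: measurableC.
by move=> t At /= ty; apply: nAy; rewrite -ty.
Qed.

Let outV A : A `\` V = r @^-1` (iJ @^-1` A `\ eJ).
Proof.
rewrite V_r; apply/seteqP; split => k /= [Ak ke]; split => //.
  by rewrite -(fibre_ne ke erefl).
by rewrite (fibre_ne ke erefl).
Qed.

Let measJ (B : set (borel J)) : measurable B. Proof. exact: open_borel. Qed.

Let splitV (mu : {measure set (borel K) -> \bar R}) A : measurable A ->
  mu A = (mu (A `&` V) + mu (A `\` V))%E.
Proof.
move=> mA; rewrite -measureU; [by rewrite setUIDK|exact: measurableI|exact: measurableD|].
by rewrite setDE setIACA setICr setI0.
Qed.

(** [conv_r] settles the part off [V] and gives the total mass [c] of the part inside. For the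
    distribution inside [V], [haar_clopen_integral] says that [mK] on [V] is a multiple of that
    part, which is therefore [c] times the normalised measure [mH]. *)
Let conv4 y : y <> eJ ->
  eq_borel (hconv HK (iJ (hinv HJ y)) (iJ y))
    (fun A => hconv HJ (hinv HJ y) y [set eJ] * mH (iH @^-1` A) +
              hconv HJ (hinv HJ y) y (iJ @^-1` A `\ eJ))%E.
Proof.
move=> ye A mA; set p := hconv HK (iJ (hinv HJ y)) (iJ y).
apply: etrans (splitV p mA) _; congr (_ + _)%E; last first.
  by rewrite -[LHS]/(p (A `\` V)) outV /p conv_r !rJ.
pose c := fine (hconv HJ (hinv HJ y) y [set eJ]).
have cE : c%:E = hconv HJ (hinv HJ y) y [set eJ].
  by rewrite fineK// fin_num_le_measure//; exact: probability_fin.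
have pV : p V = c%:E by rewrite conv_V !rJ cE.
have c0 : 0 < c.
  by rewrite -lte_fin cE; have := @conv_inv_open_pos _ _ HJ (hinv HJ y) [set eJ]; rewrite hinvK; apply.
have key f : continuous f -> \int[mK]_k ext0 f k = fine (mK [set iJ y]) * \int[p]_k ext0 f k.
  move=> cf; rewrite (haar_clopen_integral haarK oV cV Vinv Vconv (VJ ye) (ext0_continuous cf)).
    by rewrite invJ.
  exact: ext0_out.
(* The constant function [1] in [key] fixes the factor of proportionality. *)
have cVE : fine (mK V) = fine (mK [set iJ y]) * c.
  have c1 : continuous (fun _ : H => 1 : R) by move=> x; exact: cvg_cst.
  have pVfin : (p V < +oo)%E by rewrite pV ltry.
  have := key _ c1; rewrite -!restr_integral// !Rintegral_cst// !mul1r !restrE.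
  by rewrite !preimage_setT !setTI => ->; congr (_ * _); exact: (congr1 fine pV).
have E : eq_borel (restr p) (mscale (NngNum (ltW c0)) mH).
  have pVfin : (p V < +oo)%E by rewrite pV ltry.
  have mHfin : (mH setT < +oo)%E by rewrite mH1 ltry.
  apply: eq_borel_continuous => //; first exact: restr_fin.
  - by apply: restr_inner_regular; have [] := conv_radon HK (iJ (hinv HJ y)) (iJ y).
  - by have [_ _ ir] := mH_radon; exact: inner_regular_mscale.
  move=> f cf f01; have mf := continuous_borel cf.
  rewrite [RHS](ge0_integral_mscale _ measurableT (NngNum (ltW c0)))//=; last 2 first.
    exact/measurable_EFinP.
    by move=> x _; rewrite lee_fin; case/andP: (f01 x).
  rewrite -[LHS]fineK; last by apply: fin_num_integral01 => //; exact: restr_fin.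
  rewrite -[in RHS](fineK (fin_num_integral01 mHfin mf f01)) -EFinM; congr (_%:E).
  transitivity (\int[p]_k ext0 f k); first exact: restr_integral.
  rewrite -[fine _]/(\int[mH]_h f h) mH_integral// key// /w cVE.
  have k0 : fine (mK [set iJ y]) != 0.
    by apply/eqP => k0; move: fineV0; rewrite cVE k0 mul0r ltxx.
  by rewrite [_ * c]mulrC invfM -!mulrA mulKf// mulVKf// gt_eqF.
rewrite -cE -[RHS]/(mscale (NngNum (ltW c0)) mH (iH @^-1` A)) -E; last exact: measurable_pre.
rewrite restrE; congr (p _); apply/seteqP; split => k [Ak Vk]; split => //=.
  by rewrite retr_V.
by rewrite -(retr_V Vk).
Qed.

(** Off [V] the fibres of [r] are points, so [conv_r] determines every product there. What [r]
    cannot see is the part of a product inside [V]: on [V] itself it is [conv_H], for inverse points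
    it is [conv4], and in the remaining cases it is null. *)
Lemma join_recognition : exists m : {measure set (borel H) -> \bar R},
  [/\ is_haar HH m, m setT = 1%E, is_join HH HJ m HK iH iJ &
      forall A : set (borel K), measurable A -> mK A = 0%E -> m (iH @^-1` A) = 0%E].
Proof.
exists mH; split => //; last first.
  move=> A mA A0; rewrite mHE (_ : _ `&` _ = A `&` V).
    by rewrite (subset_measure0 _ mA _ A0) ?mule0//; exact: measurableI.
  apply/seteqP; split => k [Ak Vk]; split => //=; last by rewrite retr_V.
  by rewrite -(retr_V Vk).
split => //.
- move=> k; have [re|re] := pselect (r k = eJ); first by left; exact: fibre_id.
  by right; exists (r k); exact/esym/fibre_ne.
- move=> h y; split => [hy|[-> ->]]; last by rewrite iJ_id.
  have ye : y = eJ by rewrite -(rJ y) -hy.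
  by split => //; apply: iH_inj; rewrite hy ye iJ_id.
- exact: discrete_continuous.
- move=> x y xy A mA; apply: etrans (splitV (hconv HK (iJ x) (iJ y)) mA) _.
  rewrite -[X in (_ + X)%E]/(hconv HK (iJ x) (iJ y) (A `\` V)) outV conv_r !rJ.
  have z : hconv HJ x y [set eJ] = 0%E by exact: conv_isolated_id.
  rewrite [X in (X + _)%E](_ : _ = 0%E); last first.
    have zV : hconv HK (iJ x) (iJ y) V = 0%E by rewrite conv_V !rJ.
    by apply: subset_measure0 zV => //; exact: measurableI.
  rewrite add0e [RHS](@measureDI _ _ _ (hconv HJ x y) _ [set eJ])//.
  rewrite [X in (_ + X)%E](_ : _ = 0%E) ?adde0//.
  by apply: subset_measure0 z.
- move=> x y ye; apply: conv_dirac => // B mB.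
  by rewrite rH rJ; exact: conv_idl.
- move=> x y ye; apply: conv_dirac => // B mB.
  by rewrite rH rJ; exact: conv_idr.
Qed.

End join_recognition.

(** * The dual of the join as a join of the duals *)

Section strong_join.
Context {R : realType} {H J K : ptopologicalType}.
Variables (HH : hypergroup R H) (HJ : hypergroup R J) (HK : hypergroup R K).
Variables (mH : {measure set (borel H) -> \bar R}) (iH : H -> K) (iJ : J -> K).
Hypotheses (compactH : compact [set: H]) (haarH : is_haar HH mH)
  (mH1 : mH setT = 1%E) (joinK : is_join HH HJ mH HK iH iJ)
  (openJ : forall A : set J, open A).
Variables (DH : hypergroup R (dual HH)) (DJ : hypergroup R (dual HJ))
  (DK : hypergroup R (dual HK)).
Hypotheses (dualH : is_dual_hypergroup DH) (dualJ : is_dual_hypergroup DJ)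
  (dualK : is_dual_hypergroup DK).
Let r : dual HK -> dual HH := dual_join_restrict joinK.
Let iD : dual HJ -> dual HK := dual_join_extend mH1 joinK openJ.
Let jD : dual HH -> dual HK := dual_join_zero compactH haarH mH1 joinK openJ.

Let openDH (A : set (dual HH)) : open A.
Proof. exact: (dual_compact_discrete compactH haarH mH1 dualH). Qed.

Let compactDJ : compact [set: dual HJ]. Proof. exact: dual_discrete_compact. Qed.

Let rc : continuous r. Proof. exact: dual_join_restrict_continuous. Qed.

Let iDc : continuous iD. Proof. exact: dual_join_extend_continuous. Qed.

Let riD a : r (iD a) = dual1 HH. Proof. exact: dual_join_restrict_extend. Qed.

Let r_borel : measurable_fun setT (r : borel (dual HK) -> borel (dual HH)).
Proof. exact: continuous_borel_map. Qed.

(** Both sides, as measures on the discrete dual of [H], have the product of the two restricted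
    characters as Fourier transform. The left one is finitely supported because [r] maps the compact
    support of the convolution to a compact, hence finite, set. *)
Lemma dual_join_conv_restrict (chi1 chi2 : dual HK) (B : set (dual HH)) :
  hconv DK chi1 chi2 (r @^-1` B) = hconv DH (r chi1) (r chi2) B.
Proof.
rewrite -[LHS]/(borel_image r_borel (hconv DK chi1 chi2) B).
have [hK _ _] := dualK; have [hH _ _] := dualH.
have cs := @conv_compact_supp _ _ DK chi1 chi2.
have [s us sE] := compact_discrete_seq openDH (continuous_compact (continuous_subspaceT rc) cs).
have [t ut t0] := conv_finite_support DH (r chi1) (r chi2) openDH.
apply: (finite_dual_measure_unique compactH haarH mH1 dualH (s := s) (t := t)) => //.
- by rewrite borel_imageE preimage_setT; exact: probability_fin.
- exact: probability_fin.
- rewrite -sE borel_imageE; apply: subset_measure0 (conv_suppC DK chi1 chi2).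
  + rewrite -[X in measurable X]setTI; apply: r_borel => //.
    exact: open_borel (openDH _).
  + apply: open_borel; apply: closed_openC; apply: compact_closed => //.
    exact: hypergroup_hausdorff DK.
  + by move=> chi /= nr cchi; apply: nr; exists chi.
- move=> x; rewrite hH.
  rewrite (@cintegral_pushforward _ _ _ (borel_image r_borel (hconv DK chi1 chi2)) (hconv DK chi1 chi2) r)//.
  + exact: hK.
  + exact: probability_fin.
  + exact: eval_bounded_borel.
Qed.

Let retr : dual HK -> dual HJ := extend iD (dual1 HJ) id.

Let iD_inj : injective iD. Proof. exact: dual_join_extend_inj. Qed.

Let iD_closed (B : set (dual HJ)) : closed B -> closed (iD @` B).
Proof.
move=> cB; apply: compact_closed; first exact: hypergroup_hausdorff DK.
apply: (continuous_compact (continuous_subspaceT iDc)).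
exact: subclosed_compact cB compactDJ (@subsetT _ _).
Qed.

Let range_iD : range iD = r @^-1` [set dual1 HH]. Proof. exact: range_dual_join_extend. Qed.

Let open_range : open (range iD).
Proof. by rewrite range_iD; apply: open_comp => // chi _; exact: rc. Qed.

Let retr_continuous : continuous retr.
Proof. by apply: continuous_extend => // x; exact: cvg_id. Qed.

Let retr_borel : measurable_fun setT (retr : borel (dual HK) -> borel (dual HJ)).
Proof. exact: continuous_borel_map. Qed.

Let retriD a : retr (iD a) = a. Proof. exact: extendE. Qed.

(** Transported to the dual of [J], the convolution on the dual of [K] has the transform
    [a x * b x], as seen by evaluating at points of [J]; [dual_measure_unique] applies because both
    measures are inner regular. *)
Lemma dual_join_conv_extend (a b : dual HJ) :
  eq_borel (hconv DK (iD a) (iD b)) (fun A => hconv DJ a b (iD @^-1` A)).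
Proof.
have [hK _ _] := dualK; have [hJ _ _] := dualJ.
pose p := hconv DK (iD a) (iD b).
have mV : measurable (~` range iD : set (borel (dual HK))).
  by apply: measurableC; exact: open_borel.
(* Under [r] the convolution becomes that of the trivial character with itself, so it is carried by
   the fibre over the trivial character, which is the range of [iD]. *)
have p0 : p (~` range iD) = 0%E.
  rewrite range_iD preimage_setC /p dual_join_conv_restrict !riD.
  rewrite -(hid_dual dualH) (conv_idl DH (hid DH)); last exact: open_borel (openDH _).
  by rewrite diracE memNset//=; exact.
have E : eq_borel (borel_image retr_borel p) (hconv DJ a b).
  apply: dual_measure_unique => //.
  - by rewrite borel_imageE preimage_setT; exact: probability_fin.
  - exact: probability_fin.
  - apply: inner_regular_image => //; first exact: hypergroup_hausdorff DK.
    + exact: hypergroup_hausdorff DJ.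
    + by have [] := conv_radon DK (iD a) (iD b).
  - by have [] := conv_radon DJ a b.
  - exact: hypergroup_hausdorff DJ.
  - move=> x; rewrite hJ.
    rewrite (@cintegral_pushforward _ _ _ (borel_image retr_borel p) p retr)//; last 2 first.
    + exact: probability_fin.
    + exact: eval_bounded_borel.
    have <- : cintegral p (fun chi : dual HK => chi (iJ x)) = a x * b x.
      by rewrite hK !dual_join_extendE !(join_retractJ joinK).
    apply: (cintegral_ae_eq mV p0).
    + exact: bounded_borel_comp retr_borel (eval_bounded_borel x).
    + exact: eval_bounded_borel.
    + by move=> chi /contrapT[c _ <-]; rewrite retriD dual_join_extendE (join_retractJ joinK).
move=> A mA; have mA' : measurable (iD @^-1` A : set (borel (dual HJ))).
  by rewrite -[X in measurable X]setTI; exact: (continuous_borel_map iDc).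
rewrite -E// borel_imageE.
have mB : measurable (retr @^-1` (iD @^-1` A) : set (borel (dual HK))).
  by rewrite -[X in measurable X]setTI; exact: retr_borel.
have pV B : measurable B -> p B = p (B `&` range iD).
  move=> mB'; rewrite [LHS](@measureDI _ _ _ p _ (range iD))//; last exact: open_borel.
  rewrite [X in (X + _)%E](_ : _ = 0%E) ?add0e//; apply: subset_measure0 p0 => //.
    by apply: measurableD => //; exact: open_borel.
rewrite -/p pV// [RHS]pV//; congr (p _).
by apply/seteqP; split => chi [Bchi [c _ cE]]; move: Bchi; rewrite -cE /= retriD => Bchi;
  split => //; exists c.
Qed.

Variables (mDH : {measure set (borel (dual HH)) -> \bar R})
  (mDK : {measure set (borel (dual HK)) -> \bar R}).
Hypotheses (haarDH : is_haar DH mDH) (haarDK : is_haar DK mDK).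

(** The Haar measure on the dual of [J] is extracted from the given [mDK], so the comparison of null
    sets comes along with it. *)
Lemma dual_join_is_join : exists m : {measure set (borel (dual HJ)) -> \bar R},
  [/\ is_haar DJ m, m setT = 1%E, is_join DJ DH m DK iD jD &
      forall A : set (borel (dual HK)), measurable A -> mDK A = 0%E -> m (iD @^-1` A) = 0%E].
Proof.
have hidH := hid_dual dualH; have hidJ := hid_dual dualJ; have hidK := hid_dual dualK.
have rjD eta : r (jD eta) = eta by exact: dual_join_restrict_zero.
apply: (@join_recognition _ _ _ _ DJ DH DK iD jD r) => //.
- by move=> a; rewrite hidH.
- by move=> chi; rewrite hidH => /(dual_join_trivial mH1 openJ)[a ->]; exists a.
- by move=> chi eta; rewrite hidH => ne; exact: dual_join_zero_restrict.
- by rewrite hidH hidJ /jD /iD dual_join_zero1 dual_join_extend1.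
- by rewrite hidK hidJ /iD dual_join_extend1.
- by move=> a; apply: dual_eq => k; rewrite (hinv_dual dualK) !dual_join_extendE (hinv_dual dualJ).
- move=> eta; have [->|ne] := pselect (eta = dual1 HH).
    by rewrite -hidH hinv_id hidH /jD dual_join_zero1 -hidK hinv_id.
  apply: dual_join_zero_restrict.
    by move=> h1; apply: ne; rewrite -[eta](hinvK DH) h1 -hidH hinv_id.
  apply: dual_eq => h; rewrite dual_join_restrictE (hinv_dual dualK) (hinv_dual dualH).
  by rewrite -[in RHS](rjD eta).
- exact: dual_join_conv_restrict.
- exact: dual_join_conv_extend.
Qed.

(** The two definitions treat the trivial character of [H] differently: one leaves it out and takes
    the default [1], the other evaluates [beta] at the identity, which is also [1]. *)
Lemma extend_dualE (beta : dual DH) :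
  extend_dual iH beta = extend jD (1 : cplx R) beta.
Proof.
have jD_inj : injective jD by exact: dual_join_zero_inj.
apply/funext => chi; rewrite /extend_dual; case: pselect => [ex|nex].
  case: (cid ex) => eta /= [ne chiE].
  have -> : chi = jD eta.
    by apply: dual_eq => k; rewrite chiE /jD dual_join_zeroE.
  by rewrite extendE.
have [[eta etaE]|nj] := pselect (exists eta, jD eta = chi); last first.
  by rewrite extend_out// => eta etaE; apply: nj; exists eta.
rewrite -etaE extendE//; have [->|ne] := pselect (eta = dual1 HH).
  by rewrite -(hid_dual dualH) dual_id.
by case: nex; exists eta; split => //; rewrite -etaE /jD dual_join_zeroE.
Qed.

Lemma dual_join_amenable (beta : dual DH) :
  amenable DH mDH beta <-> amenable DK mDK (extend_dual iH beta).
Proof.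
have [m [haarm m1 joinD mD]] := dual_join_is_join.
rewrite extend_dualE; split.
  apply: (amenable_join_of_discrete compactDJ haarm m1 joinD openDH) => //; last exact: dual_id.
  move=> eta ne eta0.
  by have := join_haar_point_pos compactDJ joinD openDH haarDK ne; rewrite eta0 ltxx.
apply: (amenable_discrete_of_join m1 joinD openDH); last exact: dual_id.
by move=> eta eta0; have := haar_discrete_pos eta haarDH (openDH _); rewrite eta0 ltxx.
Qed.

End strong_join.

Theorem theorem1p3 (R : realType)
  (H : ptopologicalType) (J : pdiscreteTopologicalType) (K : ptopologicalType)
  (HH : hypergroup R H) (HJ : hypergroup R J) (HK : hypergroup R K)
  (mH : {measure set (borel H) -> \bar R}) (iH : H -> K) (iJ : J -> K)
  (commH : commutative_hypergroup HH) (commJ : commutative_hypergroup HJ)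
  (compactH : compact [set: H])
  (haarH : is_haar HH mH) (mH1 : mH [set: H] = 1%E)
  (joinK : is_join HH HJ mH HK iH iJ)
  (J2 : exists y : J, y <> hid HJ) :
  (forall (alpha : dual HJ)
      (mJ : {measure set (borel J) -> \bar R})
      (mK : {measure set (borel K) -> \bar R}),
    is_haar HJ mJ -> is_haar HK mK ->
    amenable HJ mJ alpha <->
    amenable HK mK (extend iJ (1 : cplx R) alpha)) /\
  (forall (DH : hypergroup R (dual HH)) (DJ : hypergroup R (dual HJ))
      (DK : hypergroup R (dual HK)),
    is_dual_hypergroup DH -> is_dual_hypergroup DJ -> is_dual_hypergroup DK ->
    forall (beta : dual DH)
      (mDH : {measure set (borel (dual HH)) -> \bar R})
      (mDK : {measure set (borel (dual HK)) -> \bar R}),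
    is_haar DH mDH -> is_haar DK mDK ->
    amenable DH mDH beta <->
    amenable DK mDK (extend_dual iH beta)).
Proof.
have openJ (A : set J) : open A by exact: discrete_open.
split=> [alpha mJ mK haarJ haarK|DH DJ DK dualH dualJ dualK beta mDH mDK haarDH haarDK].
  exact: (join_amenable compactH haarH mH1 joinK openJ haarJ haarK J2 (dual_id alpha)).
exact: (dual_join_amenable compactH haarH mH1 joinK openJ dualH dualJ dualK haarDH haarDK).
Qed.
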